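(* Let $N\ge 1$ and let $g:\mathbb{R}\to\mathbb{R}$ be a continuous odd function with $g(0)=0$; put $G(s)=\int_0^s g(\tau)\,d\tau$. Assume that $\lim_{s\to 0} g(s)/s=0$, that $\lim_{s\to\infty} g(s)/|s|^{1+4/N}=0$, that there exists $s_1>0$ with $G(s_1)>0$, and that there exists $\alpha>2$ such that $g(s)s\ge\alpha G(s)$ for all $s\ge 0$. Let $V\in C^1(\mathbb{R}^N)$ be real-valued, $V\not\equiv 0$, with $\lim_{|x|\to\infty}V(x)=\sup_{x\in\mathbb{R}^N}V(x)=0$, $V(0)=\min_{x\in\mathbb{R}^N}V(x)>-\infty$, and $\lim_{|x|\to\infty}\langle\nabla V(x),x\rangle=0$. Let $a_0\ge 0$ be the number such that $C_a<0$ and $C_a$ is attained for every $a>a_0$, while $C_a=0$ and $C_a$ is not attained for every $0<a<a_0$. Suppose further that one of the following holds: (i) $\displaystyle\liminf_{t\to 0^+}\frac{G(t)}{t^{2+4/N}}=\infty$; (ii) there exists $s_0>0$ such that $g(s)\ge 0$ for $s\in[0,s_0]$ and, in addition if $N\ge 3$, $$\inf\left\{\int_{\mathbb{R}^N}\left(|\nabla\varphi|^2+V(x)\varphi^2\right)dx\;:\;\varphi\in H^1(\mathbb{R}^N),\ \int_{\mathbb{R}^N}\varphi^2dx=1\right\}<0.$$ Then $a_0=0$; that is, for every $a>0$ there exists a ground state solution $(u_0,\lambda)$ with $u_0\in S_a$ of $$-\Delta u+(V(x)+\lambda)u=g(u)\quad\text{in }\mathbb{R}^N.$$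
   Context: All functions are real-valued. $S_a=\{u\in H^1(\mathbb{R}^N):\int_{\mathbb{R}^N}u^2dx=a\}$, $J[u]=\frac12\int_{\mathbb{R}^N}|\nabla u|^2dx+\frac12\int_{\mathbb{R}^N}V(x)u^2dx-\int_{\mathbb{R}^N}G(u)dx$, and $C_a=\inf_{u\in S_a}J[u]$; ''$C_a$ is attained'' means there is $u\in S_a$ with $J[u]=C_a$. Under the assumptions made on $g$ and $V$ before (i) and (ii), a number $a_0$ as described exists. A ground state solution on $S_a$ is a $u_0\in S_a$ with $dJ|_{S_a}[u_0]=0$ (i.e. $u_0$ is a critical point of $J$ constrained to $S_a$, so it solves the equation weakly for some Lagrange multiplier $\lambda\in\mathbb{R}$) and $J[u_0]=\inf\{J[u]: u\in S_a,\ dJ|_{S_a}[u]=0\}$. *)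

(* Defs.v *)
(* Throughout, R is an arbitrary realType and R^N is the type 'rV[R]_N. *)
From HB Require Import structures.
From mathcomp Require Import all_boot all_order all_algebra.
From mathcomp Require Import all_classical all_reals all_analysis.

Set Implicit Arguments.
Unset Strict Implicit.
Unset Printing Implicit Defensive.

Import Order.TTheory GRing.Theory Num.Theory.
Import numFieldNormedType.Exports.

Local Open Scope classical_set_scope.
Local Open Scope ring_scope.

Definition rV_coord (T : Type) (n : nat) (i : 'I_n) (x : 'rV[T]_n) : T :=
  x ord0 i.

(* The product sigma-algebra on row vectors, built exactly as the library does
   for n.-tuple T; on 'rV[R]_N it is the Borel sigma-algebra. *)
Section measurable_rV.
Context {d : measure_display} {T : measurableType d}.
Variable n : nat.

Let coords : 'I_n -> 'rV[T]_n -> T := @rV_coord T n.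

Let rV_set0 : g_sigma_preimage coords set0.
Proof. exact: sigma_algebra0. Qed.

Let rV_setC A : g_sigma_preimage coords A -> g_sigma_preimage coords (~` A).
Proof. exact: sigma_algebraC. Qed.

Let rV_bigcup (F : _^nat) : (forall i, g_sigma_preimage coords (F i)) ->
  g_sigma_preimage coords (\bigcup_i (F i)).
Proof. exact: sigma_algebra_bigcup. Qed.

HB.instance Definition _ := @isMeasurable.Build (measure_tuple_display d)
  'rV[T]_n (g_sigma_preimage coords) rV_set0 rV_setC rV_bigcup.

End measurable_rV.

Section measurable_fun_rV.
Context {d : measure_display} {T : measurableType d}.

Lemma measurable_rV_coord (n : nat) (i : 'I_n) :
  measurable_fun [set: 'rV[T]_n] (rV_coord i).
Proof.
move=> _ A mA; rewrite setTI; apply: sub_sigma_algebra.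
case: n i => [[] //|m i].
rewrite -bigcup_mkord_ord; exists i; first exact: ltn_ord.
by exists A => //; rewrite setTI inord_val.
Qed.

Lemma measurable_fun_rV (n : nat) d1 (T1 : measurableType d1)
    (f : T1 -> 'rV[T]_n) :
  (forall i, measurable_fun [set: T1] (rV_coord i \o f)) ->
  measurable_fun [set: T1] f.
Proof.
move=> mf _ A mA; rewrite setTI.
have sub : g_sigma_preimage (@rV_coord T n) `<=`
    [set B | measurable (f @^-1` B)].
  apply: smallest_sub.
    split => /=.
    - by rewrite preimage_set0.
    - by move=> B mB; rewrite setTD preimage_setC; exact: measurableC.
    - by move=> F mF; rewrite preimage_bigcup; exact: bigcup_measurable.
  case: n f mf {A mA} => [|m] f mf; first by rewrite big_ord0.
  rewrite -bigcup_mkord_ord; apply: bigcup_sub => i Ii.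
  move=> _ [B mB <-] /=; rewrite setTI -comp_preimage -[X in measurable X]setTI.
  exact: mf.
exact: (sub A mA).
Qed.

Lemma measurable_rV_box (n : nat) (A : 'I_n -> set T) :
  (forall i, measurable (A i)) ->
  measurable [set x : 'rV[T]_n | forall i, A i (x ord0 i)].
Proof.
move=> mA.
rewrite (_ : mkset _ = \bigcap_(i in [set: 'I_n]) (rV_coord i @^-1` A i)).
  apply: fin_bigcap_measurable => // i _.
  by rewrite -[X in measurable X]setTI; exact: measurable_rV_coord.
by apply/seteqP; split=> x /= Ax i; [move=> _|]; exact: Ax.
Qed.

End measurable_fun_rV.

(* Lebesgue measure on R^n as an n-fold product, transported along the
   identification R * R^n = R^(n+1). *)
Section lebesgue_measure_rV.
Context {R : realType}.

Definition rV_cons (n : nat) (z : measurableTypeR R * 'rV[R]_n) : 'rV[R]_n.+1 :=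
  @row_mx R 1 1 n z.1%:M z.2.

Definition rV_uncons (n : nat) (x : 'rV[R]_n.+1) :
    measurableTypeR R * 'rV[R]_n :=
  ((x : 'rV_(1 + n)) ord0 ord0, @rsubmx R 1 1 n x).

Lemma rV_consK n : cancel (@rV_cons n) (@rV_uncons n).
Proof.
move=> [a v]; rewrite /rV_uncons /rV_cons; congr pair; last exact: row_mxKr.
have -> : (ord0 : 'I_(1 + n)) = lshift n (ord0 : 'I_1) by exact/val_inj.
by rewrite (row_mxEl a%:M v ord0 ord0) mxE eqxx.
Qed.

Lemma rV_unconsK n : cancel (@rV_uncons n) (@rV_cons n).
Proof.
move=> x; rewrite /rV_uncons /rV_cons /=.
apply: etrans (@hsubmxK R 1 1 n x); congr (row_mx _ _).
apply/rowP => i; rewrite !ord1 !mxE eqxx mulr1n.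
by congr (x _ _); exact/val_inj.
Qed.

Lemma measurable_rV_cons n : measurable_fun setT (@rV_cons n).
Proof.
apply: measurable_fun_rV => i.
case: (@split_ordP 1 n i) => j ->.
  rewrite (_ : _ \o _ = fst)//; apply/funext => -[a v] /=.
  by rewrite /rV_coord /rV_cons (row_mxEl a%:M v ord0 j) !ord1 mxE eqxx.
rewrite (_ : _ \o _ = rV_coord j \o snd); last first.
  apply/funext => -[a v] /=.
  by rewrite /rV_coord /rV_cons (row_mxEr a%:M v ord0 j).
apply: measurableT_comp => //; exact: measurable_rV_coord.
Qed.

Lemma measurable_rV_uncons n : measurable_fun setT (@rV_uncons n).
Proof.
apply/measurable_fun_pairP; split.
  exact: (@measurable_rV_coord _ R n.+1 ord0).
apply: measurable_fun_rV => i.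
rewrite (_ : _ \o _ = rV_coord (rshift 1 i : 'I_n.+1)).
  exact: measurable_rV_coord.
by apply/funext => x; rewrite /= /rV_coord mxE.
Qed.

HB.instance Definition _ n := isMeasurableFun.Build _ _ _ _ (@rV_cons n)
  (@measurable_rV_cons n).

Section rV_prod.
Variables (n : nat) (mu : {sigma_finite_measure set 'rV[R]_n -> \bar R}).

Definition rV_prod : set 'rV[R]_n.+1 -> \bar R :=
  pushforward (lebesgue_measure \x mu)%E (@rV_cons n).

Let rV_prod0 : rV_prod set0 = 0%E. Proof. exact: measure0. Qed.

Let rV_prod_ge0 A : (0 <= rV_prod A)%E. Proof. exact: measure_ge0. Qed.

Let rV_prod_sigma_additive : semi_sigma_additive rV_prod.
Proof. exact: measure_semi_sigma_additive. Qed.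

HB.instance Definition _ := isMeasure.Build _ _ _ rV_prod
  rV_prod0 rV_prod_ge0 rV_prod_sigma_additive.

Let rV_prod_sigma_finite : sigma_finite setT rV_prod.
Proof.
have /sigma_finiteP[F [TF ndF Foo]] :=
  sigma_finiteT (lebesgue_measure : {sigma_finite_measure set _ -> \bar R}).
have /sigma_finiteP[G [TG ndG Goo]] := sigma_finiteT mu.
exists (fun k => @rV_uncons n @^-1` (F k `*` G k)).
  apply/esym; rewrite -subTset => x _.
  have [i _ Fi] : (\bigcup_i F i) (rV_uncons x).1 by rewrite -TF.
  have [j _ Gj] : (\bigcup_i G i) (rV_uncons x).2 by rewrite -TG.
  exists (maxn i j) => //; split.
  - by move: Fi; exact/subsetPset/ndF/leq_maxl.
  - by move: Gj; exact/subsetPset/ndG/leq_maxr.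
move=> k; have [mF Fk] := Foo k; have [mG Gk] := Goo k.
have mFG : measurable (F k `*` G k) by exact: measurableX.
split; first by rewrite -[X in measurable X]setTI; exact: measurable_rV_uncons.
rewrite /rV_prod /pushforward -comp_preimage.
rewrite (_ : _ \o _ = id); last by apply/funext => z /=; rewrite rV_consK.
by rewrite preimage_id product_measure1E// lte_mul_pinfty// ge0_fin_numE.
Qed.

HB.instance Definition _ := Measure_isSigmaFinite.Build _ _ _ rV_prod
  rV_prod_sigma_finite.

End rV_prod.

Fixpoint lebesgue_rV (n : nat) :
    {sigma_finite_measure set 'rV[R]_n -> \bar R} :=
  if n is n'.+1 then rV_prod (lebesgue_rV n') else \d_(0 : 'rV[R]_0).

(* Normalisation: a box has volume the product of its side lengths. *)
Lemma lebesgue_rV_box (n : nat) (A : 'I_n -> set R) :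
  (forall i, measurable (A i)) ->
  lebesgue_rV n [set x | forall i, A i (x ord0 i)] =
    (\prod_(i < n) lebesgue_measure (A i))%E.
Proof.
elim: n A => [|n IH] A mA.
  by rewrite big_ord0 /= diracE mem_set// => -[].
rewrite big_ord_recl -(IH (fun i => A (lift ord0 i)))//.
rewrite -product_measure1E; last 2 first.
- exact: mA.
- exact: (@measurable_rV_box _ R n (fun i => A (lift ord0 i))).
rewrite /= /rV_prod /pushforward; congr (product_measure1 _ _ _).
apply/seteqP; split => -[a v] /=.
  move=> Av; split => [|i] /=.
    have := Av ord0; rewrite /rV_cons.
    have -> : (ord0 : 'I_(1 + n)) = lshift n (ord0 : 'I_1) by exact/val_inj.
    by rewrite (row_mxEl a%:M v ord0 ord0) mxE eqxx.
  have := Av (lift ord0 i); rewrite /rV_cons.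
  have -> : (lift ord0 i : 'I_(1 + n)) = rshift 1 i by exact/val_inj.
  by rewrite (row_mxEr a%:M v ord0 i).
move=> [/= Aa Av] i; rewrite /rV_cons; case: (@split_ordP 1 n i) => j ij.
  rewrite ij (row_mxEl a%:M v ord0 j) !ord1 mxE eqxx.
  suff -> : lshift n (ord0 : 'I_1) = ord0 :> 'I_n.+1 by [].
  exact/val_inj.
rewrite ij (row_mxEr a%:M v ord0 j).
suff -> : rshift 1 j = lift ord0 j :> 'I_n.+1 by exact: Av.
exact/val_inj.
Qed.

End lebesgue_measure_rV.

Section sobolev.
Context {R : realType} {N : nat}.
Local Notation E := ('rV[R]_N).
Local Notation leb := (@lebesgue_rV R N).
Implicit Types (x y : E).

Definition dot x y : R :=
  \sum_(i < N) x ord0 i * y ord0 i.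

(* Euclidean norm; the library's `|x| on 'rV[R]_N is the maximum norm. *)
Definition enorm x : R := Num.sqrt (dot x x).

(* The filter of "|x| -> oo" in R^N. *)
Definition at_infty : set_system E :=
  [set P | \forall M \near +oo, forall x, M < enorm x -> P x].

Global Instance at_infty_filter : Filter at_infty.
Proof.
split.
- by rewrite /at_infty /=; apply: nearW.
- move=> P Q; rewrite /at_infty /=; apply: (@filterS2 _ (pinfty_nbhs R)).
  by move=> M MP MQ x Mx; split; [exact: MP|exact: MQ].
- move=> P Q PQ; rewrite /at_infty /=; apply: (@filterS _ (pinfty_nbhs R)).
  by move=> M MP x /MP /PQ.
Qed.

Definition unit_rV (i : 'I_N) : E := delta_mx ord0 i.

Definition gradient (f : E -> R) (x : E) : E :=
  \row_i 'D_(unit_rV i) f x.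

Definition continuously_differentiable (f : E -> R) : Prop :=
  forall i : 'I_N, (forall x, derivable f x (unit_rV i)) /\
    continuous (fun x => 'D_(unit_rV i) f x).

(* iter_partial [:: i1; ...; ik] f = D_i1 (... (D_ik f)). *)
Definition iter_partial (s : seq 'I_N) (f : E -> R) : E -> R :=
  foldr (fun i h => fun x => 'D_(unit_rV i) h x) f s.

Definition smooth (f : E -> R) : Prop :=
  forall s : seq 'I_N, continuous (iter_partial s f) /\
    forall i x, derivable (iter_partial s f) x (unit_rV i).

Definition test_function : set (E -> R) :=
  [set phi | smooth phi /\ compact (closure [set x | phi x != 0])].

Definition L2 : set (E -> R) := [set u | u \in Lfun leb 2%:E].

(* w is a square-integrable distributional gradient of u. *)
Definition is_weak_gradient (u : E -> R) (w : E -> E) : Prop :=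
  (forall i, L2 (fun x => w x ord0 i)) /\
  forall i phi, test_function phi ->
    \int[leb]_x (u x * 'D_(unit_rV i) phi x) =
    - \int[leb]_x (w x ord0 i * phi x).

(* Elements of H^1 are represented by (Borel) functions, not by classes. *)
Definition H1 : set (E -> R) :=
  [set u | L2 u /\ exists w, is_weak_gradient u w].

(* The weak gradient is unique almost everywhere: wgrad u is a
   representative of it, and is only meaningful when H1 u holds. *)
Definition wgrad (u : E -> R) : E -> E :=
  xget (fun _ => 0) [set w | is_weak_gradient u w].

Definition H1_norm (u : E -> R) : R :=
  Num.sqrt (\int[leb]_x (dot (wgrad u x) (wgrad u x) + u x ^+ 2)).

(* L is the Frechet derivative at u of the functional J on H^1. *)
Definition is_frechet_derivative (J : (E -> R) -> R) (u : E -> R)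
    (L : (E -> R) -> R) : Prop :=
  [/\ forall (c : R) v w, H1 v -> H1 w ->
        L (fun x => c * v x + w x) = c * L v + L w,
      exists C : R, forall v, H1 v -> `|L v| <= C * H1_norm v &
      forall e : R, 0 < e -> exists2 d : R, 0 < d &
        forall v, H1 v -> H1_norm v < d ->
          `|J (fun x => u x + v x) - J u - L v| <= e * H1_norm v].

Definition mass_sphere (a : R) : set (E -> R) :=
  [set u | H1 u /\ \int[leb]_x (u x ^+ 2) = a].

(* dJ|_{S_a}[u] = 0: the derivative of J at u vanishes on the tangent space
   {v in H^1 : (u, v)_{L^2} = 0} of S_a at u. *)
Definition constrained_critical (J : (E -> R) -> R) (a : R) : set (E -> R) :=
  [set u | mass_sphere a u /\ exists2 L, is_frechet_derivative J u L &
    forall v, H1 v -> \int[leb]_x (u x * v x) = 0 -> L v = 0].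

End sobolev.

Section schroedinger.
Context {R : realType} {N : nat}.
Local Notation E := ('rV[R]_N).
Local Notation leb := (@lebesgue_rV R N).

Definition primitive (g : R -> R) (s : R) : R :=
  if 0 <= s then \int[lebesgue_measure]_(t in `[0, s]) g t
  else - \int[lebesgue_measure]_(t in `[s, 0]) g t.

Definition energy (g : R -> R) (V : E -> R) (u : E -> R) : R :=
  2^-1 * \int[leb]_x dot (wgrad u x) (wgrad u x) +
  2^-1 * \int[leb]_x (V x * u x ^+ 2) -
  \int[leb]_x primitive g (u x).

Definition min_energy (g : R -> R) (V : E -> R) (a : R) : \bar R :=
  ereal_inf [set (energy g V u)%:E | u in mass_sphere a].

Definition min_energy_attained (g : R -> R) (V : E -> R) (a : R) : Prop :=
  exists2 u, mass_sphere a u & (energy g V u)%:E = min_energy g V a.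

(* Infimum of the spectrum of - Laplacian + V, in variational form. *)
Definition spectral_bottom (V : E -> R) : \bar R :=
  ereal_inf [set (\int[leb]_x
      (dot (wgrad phi x) (wgrad phi x) + V x * phi x ^+ 2))%:E |
    phi in [set phi | H1 phi /\ \int[leb]_x (phi x ^+ 2) = 1]].

Definition weak_solution (g : R -> R) (V : E -> R) (lambda : R)
    (u : E -> R) : Prop :=
  H1 u /\ forall phi, H1 phi ->
    \int[leb]_x
      (dot (wgrad u x) (wgrad phi x) + (V x + lambda) * u x * phi x) =
    \int[leb]_x (g (u x) * phi x).

Definition ground_state (g : R -> R) (V : E -> R) (a : R) : set (E -> R) :=
  [set u | constrained_critical (energy g V) a u /\
    (energy g V u)%:E =
    ereal_inf
      [set (energy g V v)%:E | v in constrained_critical (energy g V) a]].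

End schroedinger.

(* Main.v *)
Require Import Defs.
From HB Require Import structures.
From mathcomp Require Import all_boot all_order all_algebra.
From mathcomp Require Import all_classical all_reals all_analysis.
From mathcomp Require Import measurable_realfun ring lra.

Set Implicit Arguments.
Unset Strict Implicit.
Unset Printing Implicit Defensive.

Import Order.TTheory GRing.Theory Num.Theory.
Import numFieldNormedType.Exports.

Local Open Scope classical_set_scope.
Local Open Scope ring_scope.

(** By Fréchet differentiability of the energy on [H1], a minimiser of the energy on
the mass sphere is a critical point there and solves the equation, with
multiplier read off by testing against the minimiser itself; so it suffices to
exclude [0 < a0], that is, to find functions of negative energy and arbitrarily
small mass. In case (i), put [s = m t] with a fixed [m], and spread a plateau of
height [s] over a cube of side of order [t^(-2/N)]: the mass stays proportional to
[m^2], the Dirichlet energy is of order [t^(4/N)], and the integral of the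
primitive exceeds any given multiple of [t^(4/N)] as [t] goes to [0]. In case (ii),
some [phi] has a negative quadratic form, and [s phi] has negative energy for
small [s] because the primitive of [g] is [o(s^2)] at [0]. For [N <= 2] such a
[phi] is a sum of [n] plateaus at the scales [4^k]: their gradients have disjoint
supports and bounded [L2] norms, so the Dirichlet energy grows at most like [n],
whereas the potential term decreases like [- n^2].

Differentiability rests on the embedding of [H1] into [L^p], [p = 2 + 4/N]. Let
[tail u l] be the measure of the set where [|u| > l]. Comparing [u] with its
translates by the vectors of a cube of volume [2 * tail u l] shows that a decay
[tail u l <= A l^(-s)] improves to the exponent [2 + 2 s / N]. Starting from
[s = 2] (Chebyshev), the first step gives [p], and the second one an exponent
larger than [p], which is enough for integrability of [|u|^p]. *)

(** * Smooth bump functions *)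

Section smooth_real.
Context {R : realType}.
Implicit Types (f g : R -> R) (n k : nat) (x y : R).

(** The definition of [H1] gives access to a weak gradient only through integrals against test
    functions, and no element of [H1] is approximated by smooth functions: the translation estimate
    is proved by duality, moving an average along a segment from the weak gradient to the test
    function. Products of one-variable bumps suffice for this. They determine a square-integrable
    function almost everywhere, and both a partial derivative and an average along an axis change a
    single factor. The power [p = 2 + 4 / N] is the one for which the Dirichlet energy and the
    integral of [|u|^p] scale alike at fixed mass. It lies strictly below the limiting Sobolev
    exponent in every dimension, so a weak-type bound slightly beyond [p] is enough, with no sharp
    inequality and no case distinction on [N]. Bounds on a direction [v] are stated with an
    arbitrary [t > 0] above [H1_norm v]. Dividing by [t] is always possible, weighted elementary
    inequalities then take the place of Hölder's, and the case of norm zero is recovered at the end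
    by letting [t] tend to the norm. *)

Fixpoint Ck n f : Prop :=
  if n is n'.+1 then
    exists2 f', (forall x, is_derive x 1 f (f' x)) & Ck n' f'
  else True.

Definition Cinfty f := forall n, Ck n f.

Lemma is_derive1_add f g x (a b : R) : is_derive x 1 f a ->
  is_derive x 1 g b -> is_derive x 1 (fun y => f y + g y) (a + b).
Proof. by move=> fa gb; exact: is_deriveD. Qed.

Lemma is_derive1_mul f g x (a b : R) : is_derive x 1 f a ->
  is_derive x 1 g b -> is_derive x 1 (fun y => f y * g y) (a * g x + f x * b).
Proof.
move=> fa gb; have := @is_deriveM _ _ f g x 1 a b fa gb.
by rewrite /GRing.scale /= addrC [g x * _]mulrC.
Qed.

Lemma is_derive1_affine (c d : R) f x (a : R) : is_derive (c * x + d) 1 f a ->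
  is_derive x 1 (fun y => f (c * y + d)) (c * a).
Proof.
move=> fa; rewrite mulrC; apply: (@is_derive1_comp _ f (fun y => c * y + d)).
have dc (e : R) : is_derive x 1 (fun=> e) 0 by exact: is_derive_cst.
have := is_derive1_add (is_derive1_mul (dc c) (is_derive_id x 1)) (dc d).
by rewrite mul0r add0r addr0 mulr1.
Qed.

Lemma is_derive1_continuous f f' : (forall x, is_derive x 1 f (f' x)) ->
  continuous f.
Proof.
move=> df x; apply: differentiable_continuous; apply/derivable1_diffP.
by have := df x.
Qed.

Lemma CkW n f : Ck n.+1 f -> Ck n f.
Proof.
elim: n f => [//|n IH] f [f' df Cf']; exists f' => //; exact: IH.
Qed.

Lemma Ck_cst n (c : R) : Ck n (fun=> c).
Proof.
elim: n c => [//|n IH] c; exists (fun=> 0) => // x; exact: is_derive_cst.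
Qed.

Lemma Ck_add n f g : Ck n f -> Ck n g -> Ck n (fun x => f x + g x).
Proof.
elim: n f g => [//|n IH] f g [f' df Cf] [g' dg Cg].
by exists (fun x => f' x + g' x); [move=> x; exact: is_derive1_add|exact: IH].
Qed.

Lemma Ck_mul n f g : Ck n f -> Ck n g -> Ck n (fun x => f x * g x).
Proof.
elim: n f g => [//|n IH] f g Cf1 Cg1.
have [Cf Cg] := (CkW Cf1, CkW Cg1).
move: Cf1 Cg1 => [f' df Cf'] [g' dg Cg'].
exists (fun x => f' x * g x + f x * g' x).
  by move=> x; exact: is_derive1_mul.
by apply: Ck_add; exact: IH.
Qed.

Lemma Ck_affine n (c d : R) f : Ck n f -> Ck n (fun x => f (c * x + d)).
Proof.
elim: n f => [//|n IH] f [f' df Cf'].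
exists (fun x => c * f' (c * x + d)); first by move=> x; exact: is_derive1_affine.
by apply: Ck_mul; [exact: Ck_cst|exact: IH].
Qed.

(** The derivative [- f' / f ^ 2] contains the inverse of [f] itself, so the induction asks for the
    inverse only at one order less. *)
Lemma Ck_inv n f : (forall x, f x != 0) -> Ck n f -> Ck n (fun x => (f x)^-1).
Proof.
move=> f0; elim: n => [//|n IH] Cf; have Cn := IH (CkW Cf).
case: Cf => [f' df Cf']; exists (fun x => (-1) * ((f x)^-1 * (f x)^-1) * f' x).
  move=> x; have := is_deriveV (f0 x) (df x).
  by rewrite /GRing.scale /= mulN1r -invfM -expr2.
by apply: Ck_mul => //; apply: Ck_mul; [exact: Ck_cst|exact: Ck_mul].
Qed.

(** Each order of [Ck] comes with its own witness of the derivative; by uniqueness of derivatives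
    they are all the same function. *)
Lemma Cinfty_derive f : Cinfty f ->
  (forall x, is_derive x 1 f (f^`()%classic x)) /\ Cinfty f^`()%classic.
Proof.
move=> Cf; have H n : (forall x, is_derive x 1 f (f^`()%classic x)) /\ Ck n f^`()%classic.
  have [f' df Cf'] := Cf n.+1.
  suff -> : f^`()%classic = f' by [].
  by apply/funext => x; rewrite derive1E; exact: derive_val.
by split; [exact: (H 0%N).1|move=> n; exact: (H n).2].
Qed.

Lemma Cinfty_continuous f : Cinfty f -> continuous f.
Proof. by move=> /Cinfty_derive[df _]; exact: is_derive1_continuous df. Qed.

Lemma Cinfty_primitive f f' : (forall x, is_derive x 1 f (f' x)) ->
  Cinfty f' -> Cinfty f.
Proof. by move=> df Cf' [//|n]; exists f'. Qed.

(** The powers of [x^-1] are carried along because the derivative of a member of this family is a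
    linear combination of members; smoothness then follows by one induction, for all [k] at once. *)
Definition expinv k x : R :=
  if 0 < x then x^-1 ^+ k * expR (- x^-1) else 0.

Lemma expinv_ge0 k x : 0 <= expinv k x.
Proof.
rewrite /expinv; case: ifP => // x0.
by rewrite mulr_ge0 ?expR_ge0// exprn_ge0// invr_ge0 ltW.
Qed.

(** From [y ^ (k + 1) / (k + 1)! <= exp y] at [y = 1 / x]; the spare power of [x] gives continuity
    at the origin. *)
Lemma expinv_bound k x : 0 < x -> expinv k x <= k.+1`!%:R * x.
Proof.
move=> x0; rewrite /expinv x0 expRN.
rewrite ler_pdivrMr ?expR_gt0//.
have y0 : 0 <= x^-1 by rewrite invr_ge0 ltW.
have F0 : 0 < k.+1`!%:R :> R by rewrite ltr0n fact_gt0.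
have H : x^-1 ^+ k.+1 <= k.+1`!%:R * expR x^-1.
  rewrite -ler_pdivrMl// mulrC; apply: le_trans (expR_ge1Dxn k y0).
  by rewrite lerDr.
rewrite mulrAC -ler_pdivrMr//; apply: le_trans H.
by rewrite exprSr.
Qed.

Lemma expinv_le0 k x : x <= 0 -> expinv k x = 0.
Proof. by move=> x0; rewrite /expinv ltNge x0. Qed.

Lemma expinv_continuous0 k : {for 0, continuous (expinv k)}.
Proof.
rewrite /prop_for /continuous_at [X in _ --> X]expinv_le0//.
apply: (@squeeze_cvgr _ _ _ _ (cst 0) (fun x => k.+1`!%:R * `|x|)).
- near=> x; rewrite expinv_ge0 /=; case: (ltP 0 x) => x0.
    by rewrite gtr0_norm// expinv_bound.
  by rewrite expinv_le0// mulr_ge0.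
- exact: cvg_cst.
- rewrite -[X in _ --> X](mulr0 k.+1`!%:R); apply: cvgMr.
  by rewrite -[X in _ --> X](@normr0 _ R); apply: cvg_norm; exact: cvg_id.
Unshelve. all: by end_near. Qed.

Lemma is_derive_expinv k x :
  is_derive x 1 (expinv k) (- k%:R * expinv k.+1 x + expinv k.+2 x).
Proof.
have [x0|x0|->] := ltgtP x 0.
- rewrite !expinv_le0 ?ltW// mulr0 addr0.
  apply: (@near_eq_is_derive _ _ _ (cst 0) (expinv k)).
  near=> z; rewrite expinv_le0//; apply/ltW; near: z.
  exact: lt_nbhsl.
- have dV : is_derive x 1 (fun y : R => y^-1) (- x^-1 ^+ 2).
    have := is_deriveV (lt0r_neq0 x0) (is_derive_id x 1).
    by rewrite /GRing.scale /= mulr1 exprVn.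
  have dE : is_derive x 1 (fun y : R => expR (- y^-1))
      (expR (- x^-1) * x^-1 ^+ 2).
    have dN : is_derive x 1 (fun y : R => - y^-1) (x^-1 ^+ 2).
      by have := is_deriveN dV; rewrite opprK.
    by apply: (@is_derive1_comp _ expR (fun y => - y^-1)).
  have dX : is_derive x 1 (fun y : R => y^-1 ^+ k) (- k%:R * x^-1 ^+ k.+1).
    case: k => [|k]; first by rewrite oppr0 mul0r; exact: is_derive_cst.
    have := @is_deriveX _ _ _ k.+1 _ _ _ dV.
    rewrite /GRing.scale /= exprfctE => H.
    apply: is_derive_eq H _; rewrite !exprS; ring.
  apply: (@near_eq_is_derive _ _ _ (fun y => y^-1 ^+ k * expR (- y^-1))).
    near=> z; rewrite /expinv ifT//; near: z.
    exact: lt_nbhsr.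
  have := is_derive1_mul dX dE; congr is_derive.
  rewrite /expinv x0 !exprS; ring.
(* At the origin the slope of [expinv k] is exactly [expinv k.+1], since
   [expinv k z = z * expinv k.+1 z], and that function is continuous with value zero there. *)
- apply/is_derive1_caratheodory; exists (expinv k.+1); split.
  + move=> z; rewrite (expinv_le0 _ (lexx 0)) !subr0.
    rewrite /expinv; case: ltP => z0; last by rewrite mul0r.
    by rewrite exprSr mulrAC divfK// gt_eqF.
  + exact: expinv_continuous0.
  + by rewrite !expinv_le0// mulr0 addr0.
Unshelve. all: by end_near. Qed.

Lemma Cinfty_expinv k : Cinfty (expinv k).
Proof.
move=> n; elim: n k => [//|n IH] k.
exists (fun x => - k%:R * expinv k.+1 x + expinv k.+2 x).
  exact: is_derive_expinv.
by apply: Ck_add => //; apply: Ck_mul => //; exact: Ck_cst.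
Qed.

Definition smoothstep x : R := expinv 0 x / (expinv 0 x + expinv 0 (1 - x)).

Let den_gt0 x : 0 < expinv 0 x + expinv 0 (1 - x).
Proof.
have pos y : 0 < y -> 0 < expinv 0 y.
  by move=> y0; rewrite /expinv y0 expr0 mul1r expR_gt0.
have [x0|x0] := ltP 0 x; first by rewrite ltr_wpDr ?expinv_ge0 ?pos.
by rewrite ltr_wpDl ?expinv_ge0// pos// subr_gt0 (le_lt_trans x0).
Qed.

Lemma Cinfty_smoothstep : Cinfty smoothstep.
Proof.
move=> n; apply: Ck_mul; first exact: Cinfty_expinv.
apply: Ck_inv => [x|]; first by rewrite gt_eqF.
apply: Ck_add; first exact: Cinfty_expinv.
rewrite (_ : (fun _ => _) = fun x => expinv 0 ((-1) * x + 1)).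
  by apply: Ck_affine; exact: Cinfty_expinv.
by apply/funext => x; rewrite mulN1r addrC.
Qed.

Lemma smoothstep_ge0 x : 0 <= smoothstep x.
Proof. by rewrite divr_ge0 ?expinv_ge0// ltW. Qed.

Lemma smoothstep_le1 x : smoothstep x <= 1.
Proof. by rewrite ler_pdivrMr// mul1r lerDl expinv_ge0. Qed.

Lemma smoothstep0 x : x <= 0 -> smoothstep x = 0.
Proof. by move=> x0; rewrite /smoothstep expinv_le0// mul0r. Qed.

Lemma smoothstep1 x : 1 <= x -> smoothstep x = 1.
Proof.
move=> x1; rewrite /smoothstep [expinv 0 (1 - x)]expinv_le0 ?subr_le0//.
rewrite addr0 divff//; have := den_gt0 x.
by rewrite [expinv 0 (1 - x)]expinv_le0 ?subr_le0// addr0 => /lt0r_neq0.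
Qed.

End smooth_real.

(** * Lebesgue measure on row vectors *)

Section measure_rV.
Context {R : realType} {N : nat}.
Local Notation E := ('rV[R]_N).
Local Notation leb := (@lebesgue_rV R N).
Implicit Types (x y a b : E).

Lemma rV_norm_coord x i : `|x ord0 i| <= `|x|.
Proof. by rewrite [leRHS]mx_normrE; apply: (le_bigmax _ _ (ord0, i)). Qed.

(** Half-open on the left, as the generating intervals [ocitv]: these boxes form a generating family
    stable under intersection, as uniqueness of measures and Dynkin induction require. *)
Definition ocbox a b : set E := [set x | forall i, a ord0 i < x ord0 i <= b ord0 i].

Lemma ocboxE a b :
  ocbox a b = [set x | forall i, `]a ord0 i, b ord0 i]%classic (x ord0 i)].
Proof. by apply/seteqP; split=> x /= xab i; have := xab i; rewrite in_itv. Qed.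

Lemma measurable_ocbox a b : measurable (ocbox a b).
Proof.
rewrite ocboxE.
apply: (@measurable_rV_box _ R N (fun i => `]a ord0 i, b ord0 i]%classic)) => i.
exact: (measurable_itv `]a ord0 i, b ord0 i]). Qed.

Definition ocboxes : set (set E) := [set ocbox z.1 z.2 | z in [set: E * E]].

Lemma ocboxesI : setI_closed ocboxes.
Proof.
move=> _ _ [[a b] _ <-] [[c d] _ <-] /=.
exists (\row_i Num.max (a ord0 i) (c ord0 i), \row_i Num.min (b ord0 i) (d ord0 i)) => //=.
apply/seteqP; split=> x /=.
  move=> H; split=> i; have := H i; rewrite !mxE gt_max le_min;
  by case/andP => /andP[H1 H2] /andP[H3 H4]; apply/andP.
move=> [H1 H2] i; have := H1 i; have := H2 i; rewrite !mxE gt_max le_min.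
by move=> /andP[-> ->] /andP[-> ->].
Qed.

Definition nbox (n : nat) : set E := ocbox (const_mx (- n%:R)) (const_mx n%:R).

Lemma nbox_cover : \bigcup_n nbox n = setT.
Proof.
apply/seteqP; split=> // x _.
exists (Num.truncn `|x|).+1 => // i; rewrite !mxE.
have xi : `|x ord0 i| < (Num.truncn `|x|).+1%:R.
  apply: le_lt_trans (truncnS_gt _).
  exact: rV_norm_coord.
by move: xi; rewrite ltr_norml => /andP[-> /ltW].
Qed.

(** The preimage of an interval under one coordinate is a slab, hence the union over [n] of boxes
    whose other sides are []-n, n]]. *)
Lemma measurable_coord_ocboxes (i : 'I_N) (A : set R) :
  measurable A -> <<s ocboxes >> (rV_coord i @^-1` A).
Proof.
have sub : <<s @ocitv R >> `<=` [set B | <<s ocboxes >> (rV_coord i @^-1` B)].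
  apply: smallest_sub.
    split => /=.
    - by rewrite preimage_set0; exact: sigma_algebra0.
    - by move=> B mB; rewrite setTD preimage_setC; exact: sigma_algebraC.
    - by move=> F mF; rewrite preimage_bigcup; exact: sigma_algebra_bigcup.
  move=> _ [[c d] _ <-] /=.
  pose p (n : nat) (e : R) : E := \row_j (if j == i then e else n%:R).
  pose q (n : nat) (e : R) : E := \row_j (if j == i then e else - n%:R).
  rewrite (_ : _ @^-1` _ = \bigcup_n ocbox (q n c) (p n d)).
    by apply: sigma_algebra_bigcup => n; apply: sub_sigma_algebra; exists (q n c, p n d).
  apply/seteqP; split=> x /=.
    rewrite in_itv /= => xi.
    have [n _ xn] : (\bigcup_n nbox n) x by rewrite nbox_cover.
    exists n => // j; rewrite !mxE; case: eqP => [->//|_].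
    by have := xn j; rewrite !mxE.
  by move=> [n _ /(_ i)]; rewrite !mxE eqxx in_itv.
by move=> mA; exact: (sub A mA).
Qed.

Lemma measurable_ocboxesE : @measurable _ E = <<s ocboxes >>.
Proof.
apply/seteqP; split.
  apply: smallest_sub; first exact: smallest_sigma_algebra.
  apply: (@big_ind _ (fun S => S `<=` <<s ocboxes >>)) => //.
    by move=> A B As Bs x [/As|/Bs].
  move=> i _ _ [B mB <-].
  by rewrite setTI; exact: measurable_coord_ocboxes.
apply: smallest_sub; first exact: sigma_algebra_measurable.
by move=> _ [[a b] _ <-]; exact: measurable_ocbox.
Qed.

Lemma lebesgue_ocbox a b : leb (ocbox a b) =
  (\prod_(i < N) lebesgue_measure `]a ord0 i, b ord0 i]%classic)%E.
Proof.
rewrite ocboxE (lebesgue_rV_box (A := fun i => `]a ord0 i, b ord0 i]%classic))//.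
Qed.

Lemma lebesgue_ocbox_lty a b : (leb (ocbox a b) < +oo)%E.
Proof.
rewrite lebesgue_ocbox.
suff : (0 <= \prod_(i < N) lebesgue_measure `]a ord0 i, b ord0 i]%classic < +oo)%E.
  by case/andP.
apply: (@big_ind _ (fun z => 0 <= z < +oo)%E) => [|x y /andP[x0 xoo] /andP[y0 yoo]|i _].
- by rewrite lee01 ltry.
- by rewrite mule_ge0//=; apply: lte_mul_pinfty => //; rewrite ge0_fin_numE.
- rewrite measure_ge0/= lebesgue_measure_itv/=; case: ifP; rewrite ?ltry// -EFinB ltry.
Qed.

Definition rV_shift y x := x + y.

Lemma measurable_rV_shift y : measurable_fun setT (rV_shift y).
Proof.
apply: (@measurable_fun_rV _ R N) => i.
rewrite (_ : _ \o _ = fun x : E => rV_coord i x + y ord0 i).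
  apply: measurable_funD => //; exact: (@measurable_rV_coord _ R N i).
by apply/funext => x; rewrite /rV_coord /= mxE.
Qed.

HB.instance Definition _ y := isMeasurableFun.Build _ _ _ _ (rV_shift y)
  (measurable_rV_shift y).

(** The measure and its image under the translation agree on boxes, by invariance of interval
    lengths, and the boxes [nbox n] of finite measure exhaust the space; uniqueness of measures does
    the rest. *)
Lemma lebesgue_rV_shift y (A : set E) : measurable A ->
  pushforward leb (rV_shift y) A = leb A.
Proof.
move=> mA; apply/esym.
apply: (@measure_unique _ _ _ ocboxes nbox).
- exact: measurable_ocboxesE.
- exact: ocboxesI.
- by move=> n; exists (const_mx (- n%:R), const_mx n%:R).
- exact: nbox_cover.
- move=> _ [[a b] _ <-] /=; rewrite /pushforward.
  rewrite (_ : _ @^-1` _ = ocbox (a - y) (b - y)); last first.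
    by apply/seteqP; split=> x /= H i; have := H i; rewrite !mxE ltrBlDr lerBrDr.
  rewrite !lebesgue_ocbox; apply: eq_bigr => i _.
  rewrite !lebesgue_measure_itv/= !mxE !lte_fin ltrD2r; case: ifP => // _.
  by rewrite -!EFinB; congr EFin; ring.
- by move=> n; exact: lebesgue_ocbox_lty.
- by [].
Qed.

Lemma ge0_integral_rV_shift y (f : E -> \bar R) : measurable_fun setT f ->
  (forall x, 0 <= f x)%E ->
  (\int[leb]_x f (x + y)%R = \int[leb]_x f x)%E.
Proof.
move=> mf f0; rewrite -[RHS](@eq_measure_integral _ _ _ _ _ (pushforward leb (rV_shift y))).
  by rewrite ge0_integral_pushforward//.
by move=> A mA _; exact: lebesgue_rV_shift.
Qed.

Lemma integrable_rV_shift y (f : E -> \bar R) :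
  leb.-integrable setT f -> leb.-integrable setT (fun x => f (x + y)).
Proof.
move=> /integrableP[mf foo]; apply/integrableP; split.
  exact: (measurableT_comp mf (measurable_rV_shift y)).
rewrite (ge0_integral_rV_shift y (f := fun x => `|f x|%E))//; last exact: measurableT_comp.
Qed.

Lemma integral_rV_shift y (f : E -> \bar R) : leb.-integrable setT f ->
  (\int[leb]_x f (x + y)%R = \int[leb]_x f x)%E.
Proof.
move=> intf; have [mf _] := integrableP _ _ _ intf.
rewrite integralE [RHS]integralE; congr (_ - _)%E.
  rewrite -[RHS](ge0_integral_rV_shift y (measurable_funepos mf))//.
  by apply: eq_integral => x _; rewrite !funeposE.
rewrite -[RHS](ge0_integral_rV_shift y (measurable_funeneg mf))//.
by apply: eq_integral => x _; rewrite !funenegE.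
Qed.

Lemma measurable_rV_add : measurable_fun setT (fun z : E * E => z.1 + z.2).
Proof.
apply: (@measurable_fun_rV _ R N) => i.
rewrite (_ : _ \o _ = fun z : E * E => rV_coord i z.1 + rV_coord i z.2).
  by apply: measurable_funD; apply: (measurableT_comp (@measurable_rV_coord _ R N i)).
by apply/funext => x; rewrite /rV_coord /= mxE.
Qed.

Lemma measurable_rV_add_scale (v : E) :
  measurable_fun setT (fun z : E * R => z.1 + z.2 *: v).
Proof.
apply: (@measurable_fun_rV _ R N) => i.
rewrite (_ : _ \o _ = fun z : E * R => rV_coord i z.1 + z.2 * v ord0 i).
  apply: measurable_funD; first exact: (measurableT_comp (@measurable_rV_coord _ R N i)).
  by apply: measurable_funM.
by apply/funext => x; rewrite /rV_coord /= !mxE.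
Qed.

(** The sigma-algebra is generated by coordinates, not by open sets; the two are linked by writing
    an open set as the union of the countably many rational cubes contained in it. *)
Lemma open_rV_measurable (U : set E) : open U -> measurable U.
Proof.
move=> oU.
pose B (z : 'rV[rat]_N * rat) := ocbox (\row_i (ratr (z.1 ord0 i) - ratr z.2))
                                       (\row_i (ratr (z.1 ord0 i) + ratr z.2)) : set E.
rewrite (_ : U = \bigcup_z (B z `&` [set _ | B z `<=` U])).
  apply: countable_bigcupT_measurable => // z.
  have [zU|zU] := pselect (B z `<=` U).
    rewrite (_ : _ `&` _ = B z); first exact: measurable_ocbox.
    by apply/seteqP; split => [x []|].
  by rewrite (_ : _ `&` _ = set0)//; apply/seteqP; split => [x []|].
apply/seteqP; split => [x Ux|x [z _ [zx zU]]]; last exact: zU.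
have /nbhs_ballP[e /= e0 xeU] := open_nbhs_nbhs (conj oU Ux).
have [r] := rat_in_itvoo (divr_gt0 e0 (ltr0n R 2)).
rewrite in_itv /= => /andP[r0 re].
have /choice[q qP] : forall i : 'I_N, exists q : rat,
    x ord0 i - ratr r < ratr q < x ord0 i + ratr r.
  move=> i; have [|q] := @rat_in_itvoo R (x ord0 i - ratr r) (x ord0 i + ratr r).
    by rewrite ltrBlDr -addrA ltrDl addr_gt0.
  by rewrite in_itv => ?; exists q.
exists (\row_i q i, r) => //; split => /=; last first.
  move=> y yz; apply: xeU; rewrite -ball_normE /=.
  rewrite [ltLHS]mx_normrE; apply/bigmax_ltP; split => // -[j i] _ /=.
  have := yz i; have := qP i; rewrite !mxE !ord1.
  rewrite ltr_norml; lra.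
by move=> i; have := qP i; rewrite !mxE; lra.
Qed.

Lemma continuous_rV_measurable (f : E -> R) : continuous f -> measurable_fun setT f.
Proof.
move=> cf; apply: (measurability _ (RGenOpens.measurableE R)) .
move=> _ [_ [a [b ->] <-]]; rewrite setTI; apply: open_rV_measurable.
by apply: open_comp => [x _|]; [exact: cf|exact: interval_open].
Qed.

End measure_rV.

(** * Real-valued integrals and square-integrable functions *)

Notation integrableR mu f := (mu.-integrable setT (EFin \o f)).

Section real_integrals.
Context d (T : measurableType d) (R : realType) (mu : {measure set T -> \bar R}).
Implicit Types f g h : T -> R.
Local Notation int f := (integrableR mu f).

Lemma integrableR_meas f : int f -> measurable_fun setT f.
Proof. by move=> /integrableP[/measurable_EFinP]. Qed.

Lemma integrableRD f g : int f -> int g -> int (fun x => f x + g x).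
Proof. by move=> intf intg; exact: (integrableD measurableT intf intg). Qed.

Lemma integrableRB f g : int f -> int g -> int (fun x => f x - g x).
Proof. by move=> intf intg; exact: (integrableB measurableT intf intg). Qed.

Lemma integrableRZ (c : R) f : int f -> int (fun x => c * f x).
Proof. by move=> intf; exact: (integrableZl measurableT c intf). Qed.

Lemma integrableR0 : int (fun=> 0).
Proof. exact: integrable0. Qed.

Lemma integrableR_norm f : int f -> int (fun x => `|f x|).
Proof. by move=> intf; exact: integrable_norm. Qed.

Lemma integrableR_sum n (F : 'I_n -> T -> R) : (forall i, int (F i)) ->
  int (fun x => \sum_(i < n) F i x).
Proof.
move=> iF; rewrite (_ : _ \o _ = fun x => (\sum_(i < n) (F i x)%:E)%E).
  by apply: (integrable_sum measurableT) => i _; exact: iF.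
by apply/funext => x /=; rewrite sumEFin.
Qed.

Lemma integrableR_le f g : measurable_fun setT f -> (forall x, `|f x| <= g x) ->
  int g -> int f.
Proof.
move=> mf fg; apply: le_integrable => //; first exact/measurable_EFinP.
by move=> x _ /=; rewrite lee_fin (le_trans (fg x))// ler_norm.
Qed.

Lemma RintD f g : int f -> int g ->
  \int[mu]_x (f x + g x) = \int[mu]_x f x + \int[mu]_x g x.
Proof. by move=> *; exact: RintegralD. Qed.

Lemma RintB f g : int f -> int g ->
  \int[mu]_x (f x - g x) = \int[mu]_x f x - \int[mu]_x g x.
Proof. by move=> *; exact: RintegralB. Qed.

Lemma RintZ (c : R) f : int f -> \int[mu]_x (c * f x) = c * \int[mu]_x f x.
Proof. by move=> *; exact: RintegralZl. Qed.

Lemma Rint_sum n (F : 'I_n -> T -> R) : (forall i, int (F i)) ->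
  \int[mu]_x (\sum_(i < n) F i x) = \sum_(i < n) \int[mu]_x F i x.
Proof.
elim: n F => [|n IH] F iF.
  rewrite big_ord0; under eq_Rintegral do rewrite big_ord0.
  by rewrite /Rintegral integral0.
rewrite big_ord_recr /=; under eq_Rintegral do rewrite big_ord_recr /=.
rewrite RintD ?IH//; exact: integrableR_sum.
Qed.

Lemma Rint_le f g : int f -> int g -> (forall x, f x <= g x) ->
  \int[mu]_x f x <= \int[mu]_x g x.
Proof. by move=> *; exact: le_Rintegral. Qed.

Lemma Rint_ge0 f : (forall x, 0 <= f x) -> 0 <= \int[mu]_x f x.
Proof. by move=> f0; exact: Rintegral_ge0. Qed.

Lemma Rint_norm f : int f -> `|\int[mu]_x f x| <= \int[mu]_x `|f x|.
Proof. by move=> *; exact: le_normr_Rintegral. Qed.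

Lemma Rint_norm_le f g : measurable_fun setT f -> (forall x, `|f x| <= g x) ->
  int g -> `|\int[mu]_x f x| <= \int[mu]_x g x.
Proof.
move=> mf fg ig; have intf := integrableR_le mf fg ig.
by apply: le_trans (Rint_norm intf) _; apply: Rint_le => //; exact: integrableR_norm.
Qed.

Lemma Rint_ae f g : measurable_fun setT f -> measurable_fun setT g ->
  {ae mu, forall x, f x = g x} -> \int[mu]_x f x = \int[mu]_x g x.
Proof.
move=> mf mg fg; congr fine; apply: ae_eq_integral => //; try exact/measurable_EFinP.
by apply: filterS fg => x /= -> _.
Qed.

Lemma integrableR_ae f g : measurable_fun setT g ->
  {ae mu, forall x, f x = g x} -> int f -> int g.
Proof.
move=> mg fg intf; have mf := integrableR_meas intf.
move/integrableP : intf => [_ foo]; apply/integrableP; split; first exact/measurable_EFinP.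
rewrite (_ : \int[mu]_x `|(EFin \o g) x| = \int[mu]_x `|(EFin \o f) x|)%E//.
apply: ae_eq_integral => //.
- by apply/measurable_EFinP; exact: measurableT_comp.
- by apply/measurable_EFinP; exact: measurableT_comp.
- by apply: filterS fg => x /= -> _.
Qed.

Lemma Rint_fine f : int f -> (\int[mu]_x f x)%:E = (\int[mu]_x (f x)%:E)%E.
Proof. by move=> intf; rewrite fineK//; exact: integrable_fin_num. Qed.

Lemma Rint_eq0 f : int f -> (forall x, 0 <= f x) -> \int[mu]_x f x = 0 ->
  {ae mu, forall x, f x = 0}.
Proof.
move=> intf f0 I0; have mf := integrableR_meas intf.
have mf' : measurable_fun setT (EFin \o f) by exact/measurable_EFinP.
have /(ae_eq_integral_abs mu measurableT mf') : (\int[mu]_x `|(EFin \o f) x| = 0)%E.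
  under eq_integral do rewrite gee0_abs ?lee_fin//.
  by rewrite -Rint_fine// I0.
by apply: filterS => x /= /(_ Logic.I) [].
Qed.

Lemma Rint_dominated_cvg (F : nat -> T -> R) f g :
  (forall n, measurable_fun setT (F n)) ->
  (forall x, F n x @[n --> \oo] --> f x) -> int g ->
  (forall n x, `|F n x| <= g x) ->
  int f /\ \int[mu]_x F n x @[n --> \oo] --> \int[mu]_x f x.
Proof.
move=> mF Ff ig Fg.
have mf : measurable_fun setT f by apply: (measurable_fun_cvg mF) => x _; exact: Ff.
have [intf _ cv] : [/\ int f,
    [sequence \int[mu]_x `|(F n x)%:E - (f x)%:E|]_n @ \oo --> 0 &
    [sequence \int[mu]_x (F n x)%:E]_n @ \oo --> \int[mu]_x (f x)%:E]%E.
  apply: (@dominated_convergence _ _ _ _ _ measurableT _ _ (EFin \o g)) => //.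
  - by move=> n; exact/measurable_EFinP.
  - exact/measurable_EFinP.
  - by apply: aeW => x _; apply: cvg_EFin; [exact: nearW|exact: Ff].
  - by apply: aeW => x n _ /=; rewrite lee_fin.
by split=> //; apply: fine_cvg; rewrite Rint_fine.
Qed.

Definition sqint f := f \in Lfun mu 2%:E.

Lemma sqintP f : sqint f <-> measurable_fun setT f /\ int (fun x => f x ^+ 2).
Proof.
split=> [l2f|[mf sf]].
  split; last exact: Lfun2_integrable_sqr.
  by move: l2f; rewrite /sqint inE => /andP[/[!inE]].
rewrite /sqint inE; apply/andP; split; rewrite inE//= /finite_norm.
have : ('N[mu]_2%:E[EFin \o f] `^ 2 < +oo)%E.
  rewrite powR_Lnorm//; under eq_integral => x _.
    rewrite /= powR_mulrn// real_normK ?num_real//; over.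
  by move/integrable_lty : sf; apply.
rewrite !ltey; apply: contra_neq => ->.
by rewrite poweRyr.
Qed.

Lemma sqint_meas f : sqint f -> measurable_fun setT f.
Proof. by move/sqintP => []. Qed.

Lemma sqint_sqr f : sqint f -> int (fun x => f x ^+ 2).
Proof. by move/sqintP => []. Qed.

Lemma sqint_mul f g : sqint f -> sqint g -> int (fun x => f x * g x).
Proof.
move=> /sqintP[mf sf] /sqintP[mg sg].
apply: (@integrableR_le _ (fun x => f x ^+ 2 + g x ^+ 2)).
- exact: measurable_funM.
- move=> x; rewrite ler_norml; nra.
- exact: integrableRD.
Qed.

Lemma sqintZ (c : R) f : sqint f -> sqint (fun x => c * f x).
Proof.
move=> /sqintP[mf sf]; apply/sqintP; split; first exact: measurable_funM.
rewrite (_ : (fun _ => _) = fun x => c ^+ 2 * f x ^+ 2); first exact: integrableRZ.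
by apply/funext => x; rewrite exprMn.
Qed.

Lemma sqintD f g : sqint f -> sqint g -> sqint (fun x => f x + g x).
Proof.
move=> l2f l2g; apply/sqintP; split.
  by apply: measurable_funD; exact: sqint_meas.
rewrite (_ : (fun _ => _) = fun x => (f x ^+ 2 + 2 * (f x * g x)) + g x ^+ 2).
  apply: integrableRD; last exact: sqint_sqr.
  by apply: integrableRD; [exact: sqint_sqr|apply: integrableRZ; exact: sqint_mul].
by apply/funext => x; ring.
Qed.

End real_integrals.

(** * Test functions *)

Section compact_support.
Context {R : realType} {N : nat}.
Local Notation E := ('rV[R]_N).
Local Notation leb := (@lebesgue_rV R N).
Implicit Types (x y : E) (f g : E -> R) (i j : 'I_N).

Definition bounded_support f := exists K : R, forall x, K < `|x| -> f x = 0.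

Definition bounded_fun f := exists M : R, forall x, `|f x| <= M.

Lemma integrable_nbox n : integrableR leb (\1_(nbox n : set E) : E -> R).
Proof.
have mA : measurable (nbox n : set E) by exact: measurable_ocbox.
apply/integrableP; split; first by apply/measurable_EFinP; exact: measurable_indic.
under eq_integral do rewrite /= ger0_norm//.
by rewrite integral_indic// setIT; exact: lebesgue_ocbox_lty.
Qed.

Lemma nbox_norm_le (K : R) : exists n, forall x, `|x| <= K -> nbox n x.
Proof.
exists (Num.truncn K).+1 => x xK i; rewrite !mxE.
have : `|x ord0 i| < (Num.truncn K).+1%:R.
  by apply: le_lt_trans (truncnS_gt _); apply: le_trans (rV_norm_coord _ _) _.
by rewrite ltr_norml => /andP[-> /ltW ->].
Qed.

Lemma integrable_bounded_support f : measurable_fun setT f -> bounded_fun f ->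
  bounded_support f -> integrableR leb f.
Proof.
move=> mf [M fM] [K fK]; have [n nK] := nbox_norm_le K.
apply: (@integrableR_le _ _ _ _ _ (fun x => M * \1_(nbox n) x)) => //.
  move=> x; rewrite indicE; have [xn|xn] := boolP (x \in _); first by rewrite mulr1.
  rewrite mulr0 fK ?normr0// ltNge; apply: contra xn => /nK.
  by move/mem_set.
exact: integrableRZ (integrable_nbox n).
Qed.

Lemma bounded_funM f g : bounded_fun f -> bounded_fun g ->
  bounded_fun (fun x => f x * g x).
Proof.
by move=> [M fM] [L gL]; exists (M * L) => x; rewrite normrM ler_pM.
Qed.

Lemma bounded_supportMl f g : bounded_support f -> bounded_support (fun x => f x * g x).
Proof. by move=> [K fK]; exists K => x /fK ->; rewrite mul0r. Qed.

Lemma sqint_bounded_support f : measurable_fun setT f -> bounded_fun f ->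
  bounded_support f -> sqint leb f.
Proof.
move=> mf bf sf; apply/sqintP; split => //; apply: integrable_bounded_support.
- exact: measurable_funX.
- exact: bounded_funM.
- exact: bounded_supportMl.
Qed.

Lemma compact_norm_le (K : R) : compact [set x : E | `|x| <= K].
Proof.
apply: bounded_closed_compact.
  by exists K; split; rewrite ?num_real// => M KM x /= xK; rewrite (le_trans xK)// ltW.
apply: (@closed_comp _ _ (fun x : E => `|x|) [set t | t <= K]); last exact: closed_le.
by move=> x _; exact: norm_continuous.
Qed.

Lemma continuous_bounded_support f : continuous f -> bounded_support f ->
  bounded_fun f.
Proof.
move=> cf [K fK]; pose A := [set x : E | `|x| <= Num.max K 0].
have A0 : A 0 by rewrite /A /= normr0 le_max lexx orbT.
have cA : compact A by exact: compact_norm_le.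
have [c _ cM] : exists2 c, c \in A & forall t, t \in A -> `|f t| <= `|f c|.
  apply: (@EVT_max_rV _ _ (fun t => `|f t|)) => //; first by exists 0.
  apply: continuous_subspaceT => x.
  by apply: continuous_comp; [exact: cf|exact: norm_continuous].
exists `|f c| => x; have [/mem_set/cM//|xA] := pselect (A x).
rewrite fK ?normr0//; move/negP: xA; rewrite -ltNge; apply: le_lt_trans.
by rewrite le_max lexx.
Qed.

Lemma unit_rV_coord i j : (unit_rV i : E) ord0 j = (j == i)%:R.
Proof. by rewrite /unit_rV mxE eqxx. Qed.

Lemma is_derive_line f x (v : E) (d : R) :
  is_derive (0 : R) 1 (fun t : R => f (t *: v + x)) d <-> is_derive x v f d.
Proof.
have eqf : (fun h : R => h^-1 *: (((fun t : R => f (t *: v + x)) \o shift 0) (h *: 1) -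
      f ((0 : R) *: v + x))) = (fun h : R => h^-1 *: ((f \o shift x) (h *: v) - f x)).
  apply/funext => h /=; rewrite scale0r add0r addr0.
  by rewrite [_ *: 1]mulr1.
split=> -[H1 H2]; constructor.
- by move: H1; rewrite /derivable eqf.
- by move: H2; rewrite /derive eqf.
- by rewrite /derivable eqf.
- by rewrite /derive eqf.
Qed.

Lemma is_derive_along f (v x : E) (f' : E -> R) : (forall y, is_derive y v f (f' y)) ->
  forall t : R, is_derive t 1 (fun s : R => f (s *: v + x)) (f' (t *: v + x)).
Proof.
move=> df t; have H := (@is_derive_line f (t *: v + x) v _).2 (df _).
have := @is_derive1_affine _ 1 (- t) (fun s : R => f (s *: v + (t *: v + x))) t
  (f' (t *: v + x)).
rewrite mul1r subrr => /(_ H); rewrite mul1r.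
suff -> : (fun s : R => f (s *: v + x)) =
  (fun y : R => f ((1 * y - t) *: v + (t *: v + x))) by [].
by apply/funext => s; rewrite mul1r addrA -scalerDl subrK.
Qed.

Lemma partial_MVT f (v x : E) (f' : E -> R) (h : R) :
  (forall y, is_derive y v f (f' y)) ->
  exists2 t : R, `|t| <= `|h| & f (h *: v + x) - f x = f' (t *: v + x) * h.
Proof.
move=> df; pose F (t : R) := f (t *: v + x).
have dF (t : R) : is_derive t 1 F (f' (t *: v + x)) by exact: is_derive_along.
have cF : continuous F by exact: is_derive1_continuous dF.
have F0 : F 0 = f x by rewrite /F scale0r add0r.
have [h0|h0] := leP 0 h.
  have [|c] := @MVT_segment _ F (fun t => f' (t *: v + x)) 0 h h0.
    exact: continuous_subspaceT.
  rewrite in_itv /= => /andP[c0 ch] E; exists c; first by rewrite !ger0_norm.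
  by rewrite -F0 -/(F h) E subr0.
have [|c] := @MVT_segment _ F (fun t => f' (t *: v + x)) h 0 (ltW h0).
  exact: continuous_subspaceT.
rewrite in_itv /= => /andP[c0 ch] E; exists c; first by rewrite !ler0_norm ?lerN2// ltW.
by rewrite -F0 -/(F h) -opprB E sub0r mulrN opprK.
Qed.

Lemma derive_bounded_support f (v : E) (f' : E -> R) :
  (forall y, is_derive y v f (f' y)) -> bounded_support f -> bounded_support f'.
Proof.
move=> df [K fK]; exists K => x xK.
have oK : open [set y : E | K < `|y|].
  apply: (@open_comp _ _ (fun y : E => `|y|) [set t | K < t]); last exact: open_gt.
  by move=> z _; exact: norm_continuous.
have d0 : is_derive x v f 0.
  apply: (@near_eq_is_derive _ E R (fun=> 0) f).
  near=> y; rewrite fK//; near: y.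
  exact: (open_nbhs_nbhs (conj oK xK)).
have dx := df x.
by rewrite -[f' x](@derive_val _ _ _ _ _ _ _ dx) (@derive_val _ _ _ _ _ _ _ d0).
Unshelve. all: by end_near. Qed.

End compact_support.

Section test_functions.
Context {R : realType} {N : nat}.
Local Notation E := ('rV[R]_N).
Local Notation leb := (@lebesgue_rV R N).
Implicit Types (x y : E) (f g : E -> R) (i j : 'I_N).

(** By translation invariance every difference quotient of [f] has integral zero, and the quotients
    converge to [f'] under a common bound. No iterated integral is involved, and the direction [v]
    is arbitrary. *)
Lemma Rint_derive_eq0 f f' (v : E) : continuous f -> bounded_support f ->
  (forall x, is_derive x v f (f' x)) -> continuous f' ->
  \int[leb]_x f' x = 0.
Proof.
move=> cf sf df cf'.
have [K fK] := sf.
have sf' := derive_bounded_support df sf.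
have [M f'M] := continuous_bounded_support cf' sf'.
have M0 : 0 <= M by apply: le_trans (f'M 0).
have mf := continuous_rV_measurable cf.
have intf := integrable_bounded_support mf (continuous_bounded_support cf sf) sf.
pose h (n : nat) : R := n.+1%:R^-1.
have h0 n : 0 < h n by rewrite invr_gt0.
have h1 n : h n <= 1 by rewrite invf_le1// ler1n.
pose F n x := (h n)^-1 * (f (x + h n *: v) - f x).
have intFv n : integrableR leb (fun x => f (x + h n *: v)).
  exact: (integrable_rV_shift (h n *: v) intf).
have F0 n : \int[leb]_x F n x = 0.
  rewrite RintZ; last exact: integrableRB.
  rewrite RintB// /Rintegral (integral_rV_shift (h n *: v) intf) subrr mulr0//.
(* The step lengths are at most [1], so all difference quotients vanish where the norm exceeds
   [K + |v|]. *)
have [m mK] := @nbox_norm_le R N (K + `|v|).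
have [||||_] := @Rint_dominated_cvg _ _ _ leb F f' (fun x => M * \1_(nbox m) x).
- move=> n; apply: integrableR_meas; apply: integrableRZ; exact: integrableRB.
- move=> x.
  have /choice[t tP] n : exists t : R, `|t| <= h n /\ F n x = f' (t *: v + x).
    have [t th Et] := @partial_MVT _ _ f v x f' (h n) df.
    exists t; split; first by rewrite (le_trans th)// gtr0_norm.
    by rewrite /F [x + _]addrC Et mulrCA mulVf ?gt_eqF// mulr1.
  have t0 : t n @[n --> \oo] --> (0 : R).
    apply/norm_cvg0P; apply: (@squeeze_cvgr _ _ _ _ (cst 0) h).
    - by apply: nearW => n; rewrite normr_ge0 (tP n).1.
    - exact: cvg_cst.
    - exact: cvg_harmonic.
  rewrite (_ : F ^~ x = fun n => f' (t n *: v + x)); last first.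
    by apply/funext => n; exact: (tP n).2.
  have -> : f' x = f' (0 *: v + x) by rewrite scale0r add0r.
  apply: continuous_cvg; first exact: cf'.
  by apply: cvgD; [apply: cvgZr_tmp|exact: cvg_cst].
- exact: integrableRZ (integrable_nbox m).
- move=> n x; rewrite indicE; have [xm|xm] := boolP (x \in _); rewrite /= ?mulr1 ?mulr0.
    have [t _] := @partial_MVT _ _ f v x f' (h n) df.
    rewrite /F [x + _]addrC => ->; rewrite mulrCA mulVf ?gt_eqF// mulr1.
    exact: f'M.
  have xK : K + `|v| < `|x|.
    by rewrite ltNge; apply: contra xm => /mK/mem_set.
  rewrite /F !fK ?subrr ?mulr0 ?normr0//; first by rewrite (le_lt_trans _ xK)// lerDl.
  rewrite -(ltrD2r `|v|) (lt_le_trans xK)// -{1}(addrK (h n *: v) x).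
  rewrite (le_trans (ler_normB _ _))// lerD2l normrZ gtr0_norm//.
  by rewrite ler_piMl.
- have -> : (fun n => \int[leb]_x F n x) = fun=> 0 by apply/funext.
  by move=> /(cvg_unique _ (cvg_cst 0)) <-.
Qed.

Definition bump (h : R -> R) :=
  Cinfty h /\ exists K : R, forall s, K < `|s| -> h s = 0.

(** Differentiating such a product along an axis replaces one factor by its derivative and gives a
    product again, so smoothness of every order reduces to one variable. *)
Definition tprod (h : 'I_N -> R -> R) x : R := \prod_(j < N) h j (x ord0 j).

Definition tprod_upd (h : 'I_N -> R -> R) i (d : R -> R) : 'I_N -> R -> R :=
  fun j => if j == i then d else h j.

Lemma line_coord (t : R) i j x :
  (t *: unit_rV i + x : E) ord0 j = t * (j == i)%:R + x ord0 j.
Proof. by rewrite mxE mxE unit_rV_coord. Qed.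

Lemma is_derive_tprod (h : 'I_N -> R -> R) i (d : R -> R) x :
  (forall s : R, is_derive s 1 (h i) (d s)) ->
  is_derive x (unit_rV i) (tprod h) (tprod (tprod_upd h i d) x).
Proof.
move=> dh; apply/is_derive_line.
pose c := \prod_(j < N | j != i) h j (x ord0 j).
have -> : (fun t : R => tprod h (t *: unit_rV i + x)) =
    fun t => c * h i (1 * t + x ord0 i).
  apply/funext => t; rewrite /tprod (bigD1 i)//= mulrC; congr (_ * h i _).
    apply: eq_bigr => j ji; congr (h j _).
    by rewrite line_coord (negPf ji) mulr0 add0r.
  by rewrite line_coord eqxx mulr1 mul1r.
have -> : tprod (tprod_upd h i d) x = c * d (x ord0 i).
  rewrite /tprod (bigD1 i)//= /tprod_upd eqxx mulrC; congr (_ * _).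
  by apply: eq_bigr => j /negPf ->.
have dc : is_derive (0 : R) 1 (fun=> c) 0 by exact: is_derive_cst.
have := is_derive1_mul dc (@is_derive1_affine _ 1 (x ord0 i) (h i) 0 _ (dh _)).
by rewrite mul0r add0r mul1r mulr0 add0r.
Qed.

Lemma continuous_tprod (h : 'I_N -> R -> R) : (forall j, continuous (h j)) ->
  continuous (tprod h).
Proof.
move=> ch; rewrite /tprod; elim: (index_enum _) => [|j s IH].
  rewrite (_ : (fun _ => _) = fun=> 1); first exact: cst_continuous.
  by apply/funext => x; rewrite big_nil.
rewrite (_ : (fun _ => _) = fun x => h j (x ord0 j) * \prod_(k <- s) h k (x ord0 k)).
  have chj : continuous (fun y : E => h j (y ord0 j)).
    move=> y; apply: (@continuous_comp _ _ _ (fun y : E => y ord0 j) (h j)); last exact: ch.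
    exact: coord_continuous.
  by move=> x; apply: (@continuousM _ _ (fun y : E => h j (y ord0 j))); [exact: chj|exact: IH].
by apply/funext => x; rewrite big_cons.
Qed.

Lemma Cinfty_upd (h : 'I_N -> R -> R) i d : (forall j, Cinfty (h j)) -> Cinfty d ->
  forall j, Cinfty (tprod_upd h i d j).
Proof. by move=> Ch Cd j; rewrite /tprod_upd; case: ifP. Qed.

Lemma smooth_tprod (h : 'I_N -> R -> R) : (forall j, Cinfty (h j)) ->
  smooth (tprod h).
Proof.
move=> Ch s.
have [k Ck ->] : exists2 k : 'I_N -> R -> R, (forall j, Cinfty (k j)) &
    iter_partial s (tprod h) = tprod k.
  elim: s => [|i s [k Ck /= ->]]; first by exists h.
  have [dk Cdk] := Cinfty_derive (Ck i).
  exists (tprod_upd k i ((k i)^`()%classic)); first exact: Cinfty_upd.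
  by apply/funext => x; have := is_derive_tprod x dk => -[_ ->].
split; first by apply: continuous_tprod => j; exact: Cinfty_continuous.
move=> i x; have [dk _] := Cinfty_derive (Ck i).
by have [] := is_derive_tprod x dk.
Qed.

Lemma bounded_support_tprod (h : 'I_N -> R -> R) : (forall j, bump (h j)) ->
  bounded_support (tprod h).
Proof.
move=> bh; have /choice[K KP] := fun j => (bh j).2.
exists (\big[Num.max/0]_j K j) => x Kx.
have [i xi] : exists i, `|x| = `|x ord0 i|.
  have [|[k i] /= xi] := @mx_norm_neq0 R 1 N x; last by exists i; rewrite [ord0]ord1 -[0](ord1 k).
  by rewrite -[X in X != _]/`|x| gt_eqF// (le_lt_trans _ Kx)// bigmax_ge_id.
rewrite /tprod (bigD1 i)//= KP ?mul0r// -xi (le_lt_trans _ Kx)//.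
exact: le_bigmax.
Qed.

Lemma test_function_tprod (h : 'I_N -> R -> R) : (forall j, bump (h j)) ->
  test_function (tprod h).
Proof.
move=> bh; split; first by apply: smooth_tprod => j; exact: (bh j).1.
have [K hK] := bounded_support_tprod bh.
apply: (@subclosed_compact _ _ [set y : E | `|y| <= K]); [exact: closed_closure|exact: compact_norm_le|].
have : closed [set x : E | `|x| <= K].
  apply: (@closed_comp _ _ (fun x : E => `|x|) [set t | t <= K]); last exact: closed_le.
  by move=> x _; exact: norm_continuous.
move=> /closure_id ->; apply: closureS => x /=.
by apply: contraNT; rewrite -ltNge => /hK ->; rewrite eqxx.
Qed.

Lemma test_function_continuous f : test_function f -> continuous f.
Proof. by move=> [/(_ [::])[]]. Qed.

Lemma test_function_derive f i : test_function f ->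
  (forall x, is_derive x (unit_rV i) f ('D_(unit_rV i) f x)) /\
  continuous (fun x => 'D_(unit_rV i) f x).
Proof.
move=> [sf _]; split; last exact: (sf [:: i]).1.
by move=> x; apply: derivableP; exact: (sf [::]).2.
Qed.

Lemma test_function_bounded_support f : test_function f -> bounded_support f.
Proof.
move=> [_ /compact_bounded[M [_ H]]]; exists (M + 1) => x Mx; apply/eqP/negPn/negP => fx.
have xcl : closure [set y | f y != 0] x by exact: subset_closure.
have M1 : M < M + 1 by rewrite ltrDl.
by have := H _ M1 _ xcl => /=; rewrite leNgt Mx.
Qed.

End test_functions.

(** * Weak gradients and H1 *)

Section weak_gradients.
Context {R : realType} {N : nat}.
Local Notation E := ('rV[R]_N).
Local Notation leb := (@lebesgue_rV R N).
Implicit Types (x y a b : E) (u v f g : E -> R) (i j : 'I_N).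

Lemma test_function_measurable f : test_function f -> measurable_fun setT f.
Proof. by move=> tf; apply: continuous_rV_measurable; exact: test_function_continuous. Qed.

Lemma test_function_bounded f : test_function f -> bounded_fun f.
Proof.
move=> tf; apply: continuous_bounded_support; first exact: test_function_continuous.
exact: test_function_bounded_support.
Qed.

Lemma sqint_test_function f : test_function f -> sqint leb f.
Proof.
move=> tf; apply: sqint_bounded_support.
- exact: test_function_measurable.
- exact: test_function_bounded.
- exact: test_function_bounded_support.
Qed.

Lemma sqint_derive_test_function f i : test_function f ->
  sqint leb (fun x => 'D_(unit_rV i) f x).
Proof.
move=> tf; have [df cdf] := test_function_derive i tf.
have sdf : bounded_support (fun x => 'D_(unit_rV i) f x).
  by apply: (derive_bounded_support df); exact: test_function_bounded_support.
apply: sqint_bounded_support => //; first exact: continuous_rV_measurable.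
exact: continuous_bounded_support.
Qed.

(** Integration by parts: the derivative of the compactly supported product [f * phi] has integral
    zero. *)
Lemma is_weak_gradient_test_function f : test_function f ->
  is_weak_gradient f (gradient f).
Proof.
move=> tf; have gE x i : gradient f x ord0 i = 'D_(unit_rV i) f x by rewrite mxE.
split=> [i|i phi tphi].
  by rewrite /L2 /=; under eq_fun do rewrite gE; exact: sqint_derive_test_function.
have [df cdf] := test_function_derive i tf.
have [dp cdp] := test_function_derive i tphi.
have cf := test_function_continuous tf; have cp := test_function_continuous tphi.
have int1 : integrableR leb (fun x => f x * 'D_(unit_rV i) phi x).
  by apply: sqint_mul; [exact: sqint_test_function|exact: sqint_derive_test_function].
have int2 : integrableR leb (fun x => 'D_(unit_rV i) f x * phi x).
  by apply: sqint_mul; [exact: sqint_derive_test_function|exact: sqint_test_function].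
under [in RHS]eq_Rintegral do rewrite gE.
apply/eqP; rewrite -subr_eq0 opprK -RintD//; apply/eqP.
apply: (@Rint_derive_eq0 _ _ (fun x => f x * phi x) _ (unit_rV i)).
- by move=> x; apply: (@continuousM _ _ f phi); [exact: cf|exact: cp].
- by apply: bounded_supportMl; exact: test_function_bounded_support.
- move=> x; have := @is_deriveM _ _ f phi x (unit_rV i) _ _ (df x) (dp x).
  by rewrite /GRing.scale /= [phi x * _]mulrC.
- move=> x; apply: (@continuousD _ _ _ (fun x => f x * _) (fun x => _ * phi x)).
    by apply: (@continuousM _ _ f); [exact: cf|exact: cdp].
  by apply: (@continuousM _ _ _ phi); [exact: cdf|exact: cp].
Qed.

Section box_bump.
Variables (a b : R).

(** The rise takes place just inside [a] and the fall just outside [b], both over a length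
    [1 / (k + 1)]; so the pointwise limit is the indicator of the half-open interval at every point,
    endpoints included. *)
Definition box_bump (k : nat) (s : R) : R :=
  smoothstep (k.+1%:R * s - k.+1%:R * a) *
  smoothstep (- k.+1%:R * s + (k.+1%:R * b + 1)).

Lemma Cinfty_box_bump k : Cinfty (box_bump k).
Proof.
move=> n; apply: Ck_mul; first by apply: Ck_affine; exact: Cinfty_smoothstep.
by apply: Ck_affine; exact: Cinfty_smoothstep.
Qed.

Lemma box_bump_ge0 k s : 0 <= box_bump k s.
Proof. by rewrite mulr_ge0// smoothstep_ge0. Qed.

Lemma box_bump_le1 k s : box_bump k s <= 1.
Proof. by rewrite mulr_ile1 ?smoothstep_ge0 ?smoothstep_le1. Qed.

Lemma box_bump0 k s : ~~ (a < s <= b + 1) -> box_bump k s = 0.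
Proof.
rewrite negb_and -leNgt -ltNge => /orP[sa|bs]; rewrite /box_bump.
  by rewrite smoothstep0 ?mul0r// subr_le0 ler_pM2l.
rewrite [X in _ * X]smoothstep0 ?mulr0//.
have k1 : 1 <= k.+1%:R :> R by rewrite ler1n.
nra.
Qed.

Lemma bump_box_bump k : bump (box_bump k).
Proof.
split; first exact: Cinfty_box_bump.
exists (`|a| + `|b| + 1) => s; rewrite ltr_normr => Ks; apply: box_bump0.
have a1 := ler_norm a; have a2 := ler_norm (- a); have b1 := ler_norm b; have b2 := ler_norm (- b).
rewrite normrN in a2; rewrite normrN in b2.
apply/negP => /andP[as1 sb]; case/orP: Ks => H; lra.
Qed.

Lemma box_bump_cvg s :
  box_bump k s @[k --> \oo] --> (if a < s <= b then 1 else 0 : R).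
Proof.
case: ifPn => [/andP[sa sb]|].
  apply: cvg_near_cst; near=> k.
  have k1 : (s - a)^-1 <= k.+1%:R.
    near: k; exists (Num.truncn (s - a)^-1) => // k /= Hk.
    by rewrite ltW// (lt_le_trans (truncnS_gt _))// ler_nat.
  rewrite /box_bump !smoothstep1 ?mulr1//.
    by rewrite mulNr addrA lerDr addrC subr_ge0 ler_wpM2l.
  by rewrite -mulrBr -ler_pdivrMr ?subr_gt0// div1r.
rewrite negb_and -leNgt -ltNge => /orP[sa|bs].
  apply: cvg_near_cst; apply: nearW => k; apply: box_bump0.
  by rewrite negb_and -leNgt sa.
apply: cvg_near_cst; near=> k.
have k1 : (s - b)^-1 <= k.+1%:R.
  near: k; exists (Num.truncn (s - b)^-1) => // k /= Hk.
  by rewrite ltW// (lt_le_trans (truncnS_gt _))// ler_nat.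
rewrite /box_bump [X in _ * X]smoothstep0 ?mulr0//.
have : 1 <= k.+1%:R * (s - b) by rewrite -ler_pdivrMr ?subr_gt0// div1r.
rewrite mulrBr; lra.
Unshelve. all: by end_near. Qed.

End box_bump.

Lemma ocbox_bump_integral0 v a b : sqint leb v ->
  (forall h : 'I_N -> R -> R, (forall j, bump (h j)) ->
    \int[leb]_x (v x * tprod h x) = 0) ->
  \int[leb]_x (v x * \1_(ocbox a b) x) = 0.
Proof.
move=> sv v0.
pose h k j := box_bump (a ord0 j) (b ord0 j) k.
have bh k j : bump (h k j) by exact: bump_box_bump.
(* A common support of the approximants, whose falls have length at most [1]. The bound
   [|v t| <= v ^ 2 + 1] for [0 <= t <= 1] then gives a dominating function on it. *)
pose B := ocbox a (b + const_mx 1).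
have mB : measurable B by exact: measurable_ocbox.
have intB : integrableR leb (fun x => v x ^+ 2 + \1_B x).
  apply: integrableRD; first exact: sqint_sqr.
  apply/integrableP; split; first by apply/measurable_EFinP; exact: measurable_indic.
  under eq_integral do rewrite /= ger0_norm//.
  by rewrite integral_indic// setIT; exact: lebesgue_ocbox_lty.
have [||||_] := @Rint_dominated_cvg _ _ _ leb (fun k x => v x * tprod (h k) x)
   (fun x => v x * \1_(ocbox a b) x) (fun x => v x ^+ 2 + \1_B x).
- move=> k; apply: measurable_funM; first exact: sqint_meas sv.
  by apply: test_function_measurable; exact: test_function_tprod.
- move=> x; apply: cvgMr.
  have -> : \1_(ocbox a b) x = \prod_(j < N)
      (if a ord0 j < x ord0 j <= b ord0 j then 1 else 0 : R).
    rewrite indicE; have [/set_mem xab|xab] := boolP (x \in _).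
      by rewrite big1// => j _; rewrite (xab j).
    have /existsNP[j /negP/negPf xj] : ~ ocbox a b x by move/mem_set; exact/negP.
    by rewrite (bigD1 j)//= xj mul0r.
  rewrite /tprod; elim: (index_enum _) => [|j s IH].
    by under eq_fun do rewrite big_nil; rewrite big_nil; exact: cvg_cst.
  under eq_fun do rewrite big_cons; rewrite big_cons.
  by apply: cvgM => //; exact: box_bump_cvg.
- exact: intB.
- move=> k x; rewrite indicE.
  have [/set_mem xB|xB] := boolP (x \in _).
    have : 0 <= tprod (h k) x <= 1.
      by apply/andP; split; [apply: prodr_ge0 => j _; exact: box_bump_ge0|
        apply: prodr_ile1 => j _; rewrite box_bump_ge0 box_bump_le1].
    move: (tprod _ _) (v x) => t c /andP[t0 t1]; rewrite mulr1n ler_norml.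
    have := mulr_ge0 t0 (etrans (subr_ge0 t 1) t1); have := sqr_ge0 (c - t / 2); have := sqr_ge0 (c + t / 2).
    by move=> ? ? ?; apply/andP; split; nra.
  have /existsNP[j /negP xj] : ~ B x by move/mem_set; exact/negP.
  rewrite /tprod (bigD1 j)//= {1}/h box_bump0.
    by rewrite mul0r mulr0 normr0 addr0 sqr_ge0.
  by move: xj; rewrite !mxE.
- rewrite (_ : (fun _ => _) = fun=> 0); last by apply/funext => k; exact: v0.
  by move=> /(cvg_unique _ (cvg_cst 0)) <-.
Qed.

(** The sets over which the truncation [w n] has integral zero contain the half-open boxes and form
    a Dynkin class, hence are all measurable sets. Truncating to a box makes the square-integrable
    [v] integrable. *)
Lemma bump_integral_ae0 v : sqint leb v ->
  (forall h : 'I_N -> R -> R, (forall j, bump (h j)) ->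
    \int[leb]_x (v x * tprod h x) = 0) ->
  {ae leb, forall x, v x = 0}.
Proof.
move=> sv v0; have mv := sqint_meas sv.
have box0 a b : \int[leb]_x (v x * \1_(ocbox a b) x) = 0 by exact: ocbox_bump_integral0.
have mn n : measurable (nbox n : set E) by exact: measurable_ocbox.
pose w n x := v x * \1_(nbox n) x.
have mw n : measurable_fun setT (w n) by apply: measurable_funM => //; exact: measurable_indic.
have iw n : integrableR leb (w n).
  apply: (@integrableR_le _ _ _ _ _ (fun x => v x ^+ 2 + \1_(nbox n) x)) => //.
    by move=> x; rewrite /w indicE ler_norml; case: (x \in _) => /=; nra.
  by apply: integrableRD; [exact: sqint_sqr|exact: integrable_nbox].
suff wn n : ae_eq leb setT (EFin \o w n) (cst 0%E).
  have /ae_foralln : forall n, {ae leb, forall x, w n x = 0}.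
    by move=> n; apply: filterS (wn n) => x /= /(_ Logic.I)[].
  apply: filterS => x wx; have [n _ xn] : (\bigcup_n nbox n) x by rewrite nbox_cover.
  by have := wx n; rewrite /w indicE mem_set// mulr1.
apply: integral_ae_eq => // A _ mA; rewrite integral0.
move: mA; rewrite measurable_ocboxesE.
apply: (@dynkin_induction _ _ _ (fun A => \int[leb]_(x in A) (EFin \o w n) x = 0)%E).
- exact: measurable_ocboxesE.
- exact: ocboxesI.
- by rewrite -(Rint_fine (iw n)); congr EFin; exact: box0.
- move=> _ [[a b] _ <-].
  have [[c d] _ /= cdE] : ocboxes (ocbox a b `&` nbox n).
    apply: ocboxesI; [by exists (a, b)|].
    by exists (const_mx (- n%:R), const_mx n%:R).
  have ivb : integrableR leb (fun x => v x * \1_(ocbox c d) x).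
    apply: (integrableR_le _ _ (integrableR_norm (iw n))) => [|x].
      by apply: measurable_funM => //; apply: measurable_indic; exact: measurable_ocbox.
    rewrite cdE indicI /w /= !normrM ler_wpM2l//.
    by rewrite ler_piMl// indicE; case: (x \in _); rewrite ?normr1 ?normr0.
  rewrite /= integral_mkcond -[RHS]/(0%:E) -(box0 c d) (Rint_fine ivb).
  apply: eq_integral => x _; rewrite patchE /w cdE indicI /=.
  by case: ifPn => xab; rewrite indicE [in RHS]indicE ?(negPf xab) ?xab ?mul1r ?mul0r ?mulr0.
- move=> S mS S0.
  have := @integral_setU _ _ _ leb S (~` S) (EFin \o w n) mS (measurableC mS).
  rewrite setUv S0 add0e => <-.
  - by rewrite -(Rint_fine (iw n)); congr EFin; exact: box0.
  - exact/measurable_EFinP.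
  - by rewrite disj_set2E; apply/eqP; exact: setICr.
- move=> F mF tF F0; rewrite integral_bigcup//; last first.
    by apply: (integrableS measurableT) => //; exact: bigcup_measurable.
  by rewrite eseries0.
Qed.

End weak_gradients.

Section H1_space.
Context {R : realType} {N : nat}.
Local Notation E := ('rV[R]_N).
Local Notation leb := (@lebesgue_rV R N).
Implicit Types (x y : E) (u v f g : E -> R) (w : E -> E) (i j : 'I_N).

Lemma weak_gradient_unique u w w' : is_weak_gradient u w -> is_weak_gradient u w' ->
  {ae leb, forall x, w x = w' x}.
Proof.
move=> [sw iw] [sw' iw'].
have ae_i i : {ae leb, forall x, w x ord0 i + (-1) * w' x ord0 i = 0}.
  apply: bump_integral_ae0.
    by apply: sqintD; [exact: sw|apply: sqintZ; exact: sw'].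
  move=> h /test_function_tprod th.
  have H k : is_weak_gradient u k -> integrableR leb (fun x => k x ord0 i * tprod h x).
    by move=> [sk _]; apply: sqint_mul; [exact: sk|exact: sqint_test_function].
  under eq_Rintegral do rewrite mulrDl -mulrA.
  rewrite RintD; [|exact: H|by apply: integrableRZ; exact: H].
  rewrite RintZ ?mulN1r; last exact: H.
  apply: oppr_inj; rewrite opprD opprK oppr0.
  by rewrite -(iw i _ th) -[X in _ + X]opprK -(iw' i _ th) subrr.
have /filter_forall := ae_i; apply: filterS => x wx; apply/rowP => i.
by apply/eqP; rewrite -subr_eq0 -mulN1r; apply/eqP; exact: wx.
Qed.

Lemma H1_wgrad u : H1 u -> is_weak_gradient u (wgrad u).
Proof. by move=> [_ [w uw]]; exact: (xgetPex (fun=> 0) (ex_intro _ w uw)). Qed.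

(** Since [wgrad] is a choice among weak gradients, its values are known only almost everywhere;
    computations compare it with an explicit weak gradient by this lemma. *)
Lemma wgrad_ae u w : is_weak_gradient u w -> {ae leb, forall x, wgrad u x = w x}.
Proof.
move=> uw; apply: (weak_gradient_unique _ uw).
exact: (xgetPex (fun=> 0) (ex_intro _ w uw)).
Qed.

Lemma H1_sqint u : H1 u -> sqint leb u.
Proof. by move=> [su _]. Qed.

Lemma H1_meas u : H1 u -> measurable_fun setT u.
Proof. by move=> /H1_sqint/sqint_meas. Qed.

Lemma wgrad_sqint u i : H1 u -> sqint leb (fun x => wgrad u x ord0 i).
Proof. by move=> /H1_wgrad[sw _]; exact: sw. Qed.

Lemma weak_gradient_lin (c : R) u v w w' : sqint leb u -> sqint leb v ->
  is_weak_gradient u w -> is_weak_gradient v w' ->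
  is_weak_gradient (fun x => c * u x + v x) (fun x => c *: w x + w' x).
Proof.
move=> su sv [sw iw] [sw' iw'].
have cE i x : (c *: w x + w' x) ord0 i = c * w x ord0 i + w' x ord0 i by rewrite !mxE.
split=> [i|i phi tphi].
  by rewrite /L2 /=; under eq_fun do rewrite cE; apply: sqintD; [apply: sqintZ; exact: sw|exact: sw'].
have sphi := sqint_test_function tphi.
have sdphi := sqint_derive_test_function i tphi.
under eq_Rintegral do rewrite mulrDl -mulrA.
rewrite RintD; [|by apply: integrableRZ; exact: sqint_mul|exact: sqint_mul].
rewrite RintZ; last exact: sqint_mul.
under [in RHS]eq_Rintegral do rewrite cE mulrDl -mulrA.
have i1 : integrableR leb (fun x => w x ord0 i * phi x) by apply: sqint_mul => //; exact: sw.
have i2 : integrableR leb (fun x => w' x ord0 i * phi x) by apply: sqint_mul => //; exact: sw'.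
rewrite RintD//; last exact: integrableRZ.
by rewrite RintZ// iw// iw'// mulrN opprD.
Qed.

Lemma H1_lin (c : R) u v : H1 u -> H1 v -> H1 (fun x => c * u x + v x).
Proof.
move=> Hu Hv; split.
  by apply: sqintD; [apply: sqintZ|]; exact: H1_sqint.
exists (fun x => c *: wgrad u x + wgrad v x).
by apply: weak_gradient_lin; [exact: H1_sqint|exact: H1_sqint|exact: H1_wgrad|exact: H1_wgrad].
Qed.

Lemma wgrad_lin (c : R) u v : H1 u -> H1 v ->
  {ae leb, forall x, wgrad (fun x => c * u x + v x) x = c *: wgrad u x + wgrad v x}.
Proof.
move=> Hu Hv; apply: wgrad_ae.
by apply: weak_gradient_lin; [exact: H1_sqint|exact: H1_sqint|exact: H1_wgrad|exact: H1_wgrad].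
Qed.

Lemma weak_gradient0 : is_weak_gradient (fun _ : E => 0) (fun=> 0).
Proof.
have s0 : sqint leb (fun _ : E => 0).
  by apply/sqintP; split => //; rewrite expr0n; exact: integrableR0.
split=> [i|i phi _].
  by rewrite /L2 /=; under eq_fun do rewrite mxE.
under eq_Rintegral do rewrite mul0r; under [in RHS]eq_Rintegral do rewrite mxE mul0r.
by rewrite /Rintegral integral0 oppr0.
Qed.

Lemma H1_0 : H1 (fun _ : E => 0).
Proof.
split; last by exists (fun=> 0); exact: weak_gradient0.
by apply/sqintP; split => //; rewrite expr0n; exact: integrableR0.
Qed.

Lemma H1Z (c : R) u : H1 u -> H1 (fun x => c * u x).
Proof.
move=> Hu; have := H1_lin c Hu H1_0; congr H1; apply/funext => x; exact: addr0.
Qed.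

Lemma H1D u v : H1 u -> H1 v -> H1 (fun x => u x + v x).
Proof.
move=> Hu Hv; have := H1_lin 1 Hu Hv; congr H1; apply/funext => x; by rewrite mul1r.
Qed.

Lemma wgradZ (c : R) u : H1 u ->
  {ae leb, forall x, wgrad (fun x => c * u x) x = c *: wgrad u x}.
Proof.
move=> Hu; apply: wgrad_ae.
have := weak_gradient_lin c (H1_sqint Hu) (H1_sqint H1_0) (H1_wgrad Hu) weak_gradient0.
by congr is_weak_gradient; apply/funext => x; rewrite addr0.
Qed.

Lemma integrable_dot_wgrad u v : H1 u -> H1 v ->
  integrableR leb (fun x => dot (wgrad u x) (wgrad v x)).
Proof.
move=> Hu Hv; apply: integrableR_sum => i; apply: sqint_mul; exact: wgrad_sqint.
Qed.

Lemma dot_ge0 x : 0 <= dot x x.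
Proof. by apply: sumr_ge0 => i _; rewrite -expr2 sqr_ge0. Qed.

Lemma dotC x y : dot x y = dot y x.
Proof. by apply: eq_bigr => i _; rewrite mulrC. Qed.

Lemma dotDr x y z : dot x (y + z) = dot x y + dot x z.
Proof. by rewrite /dot -big_split /=; apply: eq_bigr => i _; rewrite mxE mulrDr. Qed.

Lemma dotZr (c : R) x y : dot x (c *: y) = c * dot x y.
Proof. by rewrite /dot mulr_sumr; apply: eq_bigr => i _; rewrite mxE mulrCA. Qed.

Lemma dotDl x y z : dot (x + y) z = dot x z + dot y z.
Proof. by rewrite dotC dotDr !(dotC z). Qed.

Lemma dotZl (c : R) x y : dot (c *: x) y = c * dot x y.
Proof. by rewrite dotC dotZr dotC. Qed.

End H1_space.

(** * Primitives and the fundamental theorem of calculus *)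

Section calculus.
Context {R : realType}.
Implicit Types (f g F : R -> R) (a b x y : R).
Notation lebesgue := (@lebesgue_measure R).

Lemma continuous_integrable_itv f a b : continuous f ->
  lebesgue.-integrable `[a, b] (EFin \o f).
Proof.
move=> cf; apply: continuous_compact_integrable; first exact: segment_compact.
exact: continuous_subspaceT.
Qed.

(** The two cases in the definition of [primitive] are merged by integrating from a base point [- M]
    to the left of both [x] and [0]; near [x] this changes the function by a constant only. *)
Lemma is_derive_primitive g x : continuous g -> is_derive x 1 (primitive g) (g x).
Proof.
move=> cg; pose M := `|x| + 1.
have xM : - M < x < M by rewrite -ltr_norml /M ltrDl.
pose G y := \int[lebesgue]_(t in `[- M, y]) g t.
have GE y : - M < y < M -> primitive g y = G y - G 0.
  move=> /andP[My yM]; have M0 : 0 < M by rewrite /M ltr_wpDl.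
  have ig a b : lebesgue.-integrable `[a, b] (EFin \o g) by exact: continuous_integrable_itv.
  have ig' a b : lebesgue.-integrable `]a, b] (EFin \o g).
    by apply: (integrableS _ _ _ (ig a b)) => //; exact: subset_itv_oc_cc.
  rewrite /primitive; case: leP => y0; rewrite /G.
    rewrite Rintegral_itvB ?bnd_simp//; last by rewrite oppr_le0 ltW.
    by rewrite Rintegral_itv_obnd_cbnd.
  rewrite -opprB Rintegral_itvB ?bnd_simp//; [|exact: ltW|exact: ltW].
  by rewrite Rintegral_itv_obnd_cbnd.
have [dG G'] : derivable G x 1 /\ (G^`() x = g x)%classic.
  case/andP: xM => Mx xM.
  apply: (@continuous_FTC1_closed _ g (- M) x M) => //; last exact: cg.
  exact: continuous_integrable_itv.
have dG' : is_derive x 1 G (g x) := DeriveDef dG (etrans (esym (derive1E G x)) G').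
have dG0 : is_derive x 1 (fun y => G y + - G 0) (g x + 0).
  by apply: is_derive1_add => //; exact: is_derive_cst.
rewrite addr0 in dG0.
apply: (@near_eq_is_derive _ _ _ (fun y => G y + - G 0)).
near=> y; apply/esym/GE; apply/andP; split; near: y.
  by case/andP: xM => xM _; exact: lt_nbhsr.
by case/andP: xM => _ xM; exact: lt_nbhsl.
Unshelve. all: by end_near. Qed.

Lemma Rintegral_FTC2 f F a b : a <= b -> continuous f ->
  (forall x, is_derive x 1 F (f x)) ->
  \int[lebesgue]_(t in `[a, b]) f t = F b - F a.
Proof.
rewrite le_eqVlt => /predU1P[<- _ _|ab cf dF].
  by rewrite set_itv1 Rintegral_set1 subrr.
have cF := is_derive1_continuous dF.
rewrite /Rintegral (@continuous_FTC2 _ f F)//.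
- exact: continuous_subspaceT.
- split=> [t _||]; first by have [] := dF t.
  + by apply: cvg_at_right_filter; exact: cF.
  + by apply: cvg_at_left_filter; exact: cF.
- by move=> t _; rewrite derive1E; exact: derive_val.
Qed.

End calculus.

(** * Almost everywhere comparison and Fubini's theorem for real integrals *)

Section real_integrals_ae.
Context d (T : measurableType d) (R : realType) (mu : {measure set T -> \bar R}).
Implicit Types f g : T -> R.

(** Replacing [g] by the maximum, which equals it almost everywhere, turns an almost everywhere
    inequality into one valid at every point. *)
Lemma le_max_ae f g : measurable_fun setT f -> {ae mu, forall x, f x <= g x} ->
  integrableR mu g -> integrableR mu (fun x => Num.max (f x) (g x)) /\
  \int[mu]_x (Num.max (f x) (g x)) = \int[mu]_x g x.
Proof.
move=> mf fg ig; have mg := integrableR_meas ig.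
have mm : measurable_fun setT (fun x => Num.max (f x) (g x)) by exact: measurable_maxr.
have ae : {ae mu, forall x, g x = Num.max (f x) (g x)}.
  by apply: filterS fg => x /max_r ->.
by split; [exact: (integrableR_ae mm ae ig)|apply/esym/Rint_ae].
Qed.

Lemma Rint_le_ae f g : measurable_fun setT f -> (forall x, 0 <= f x) ->
  {ae mu, forall x, f x <= g x} -> integrableR mu g ->
  integrableR mu f /\ \int[mu]_x f x <= \int[mu]_x g x.
Proof.
move=> mf f0 fg ig; have [im mE] := le_max_ae mf fg ig.
have intf : integrableR mu f.
  by apply: (integrableR_le mf _ im) => x; rewrite ger0_norm// le_max lexx.
by split=> //; rewrite -mE; apply: Rint_le => // x; rewrite le_max lexx.
Qed.

(** The inner integrals in Fubini's theorem are extended reals that may be infinite on a null set;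
    only there does [fine] change them. *)
Lemma integrable_fine (G : T -> \bar R) : mu.-integrable setT G ->
  integrableR mu (fun x => fine (G x)) /\
  fine (\int[mu]_x G x) = \int[mu]_x (fine (G x)).
Proof.
move=> iG; have [mG _] := integrableP _ _ _ iG.
have mfG : measurable_fun setT (fun x => fine (G x)).
  by apply: (measurableT_comp _ mG); exact: fine_measurable.
have ae : ae_eq mu setT G (fun x => (fine (G x))%:E).
  by apply: filterS (integrable_ae measurableT iG) => x /= Gx _; rewrite fineK// Gx.
split.
  apply: le_integrable iG => //; first exact/measurable_EFinP.
  by move=> x _ /=; case: (G x) => [r| |] //=; rewrite ?normr0 ?leey.
by congr fine; apply: ae_eq_integral => //; exact/measurable_EFinP.
Qed.

End real_integrals_ae.

Section real_fubini.
Context d1 d2 (T1 : measurableType d1) (T2 : measurableType d2) (R : realType).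
Variable m1 : {sigma_finite_measure set T1 -> \bar R}.
Variable m2 : {sigma_finite_measure set T2 -> \bar R}.
Variable f : T1 * T2 -> R.
Hypothesis intf : integrableR (m1 \x m2)%E f.

Lemma integrableR_fubini1 : integrableR m1 (fun x => \int[m2]_y f (x, y)).
Proof. exact: (integrable_fine (integrable_fubini_F intf)).1. Qed.

Let integrable_G : m2.-integrable setT (fubini_G m1 (EFin \o f)).
Proof.
have mf := measurable_int _ intf.
have maf : measurable_fun setT (abse \o (EFin \o f)) by exact: measurableT_comp.
apply/integrableP; split; first exact: (measurable_fubini_G intf).
have H := (integrable21ltyP m1 m2 mf).1 intf.
refine (le_lt_trans _ H); apply: ge0_le_integral => //.
- by apply: measurableT_comp => //; exact: (measurable_fubini_G intf).
- by apply: (measurable_fun_fubini_tonelli_G (abse \o (EFin \o f))) => //=.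
- move=> y _; apply: le_abse_integral => //; exact: (measurableT_comp mf).
Qed.

Lemma integrableR_fubini2 : integrableR m2 (fun y => \int[m1]_x f (x, y)).
Proof. exact: (integrable_fine integrable_G).1. Qed.

Lemma Rint_fubini :
  \int[m1]_x \int[m2]_y f (x, y) = \int[m2]_y \int[m1]_x f (x, y).
Proof.
rewrite -[LHS](integrable_fine (integrable_fubini_F intf)).2.
rewrite -[RHS](integrable_fine integrable_G).2.
by rewrite integral12_prod_meas1// integral21_prod_meas1.
Qed.

Lemma integrableR_fubini1_ae : {ae m1, forall x, integrableR m2 (fun y => f (x, y))}.
Proof. exact: ae_integrable1 intf. Qed.

End real_fubini.

(** * Translation estimate *)

Section translation.
Context {R : realType} {N : nat}.
Local Notation E := ('rV[R]_N).
Local Notation leb := (@lebesgue_rV R N).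
Local Notation lambda := (@lebesgue_measure R).
Implicit Types (x y d : E) (u v f g q : E -> R) (w : E -> E) (i j : 'I_N).

Lemma Rint_shift y f : integrableR leb f ->
  integrableR leb (fun x => f (x + y)) /\ \int[leb]_x f (x + y) = \int[leb]_x f x.
Proof.
move=> intf; split; first exact: (integrable_rV_shift y intf).
by rewrite /Rintegral (integral_rV_shift y intf).
Qed.

Lemma sqint_shift y f : sqint leb f -> sqint leb (fun x => f (x + y)).
Proof.
move=> /sqintP[mf sf]; apply/sqintP; split.
  exact: (measurableT_comp mf (measurable_rV_shift y)).
exact: (Rint_shift y sf).1.
Qed.

Variable r : R.
Hypothesis r0 : 0 <= r.
Local Notation I := (`[0, r]%classic : set R).

Lemma integrable_indic_I : integrableR lambda (\1_I : R -> R).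
Proof. exact: integrable_indic_itv. Qed.

Lemma Rint_indic_I : \int[lambda]_t (\1_I t : R) = r.
Proof.
rewrite /Rintegral integral_indic// setIT /= lebesgue_measure_itv/= lte_fin.
case: ifPn => [_|]; first by rewrite sube0.
by rewrite -leNgt => r0'; apply/eqP; rewrite eq_le r0 r0'.
Qed.

Lemma Rint_I (f : R -> R) : \int[lambda]_t (f t * \1_I t) = \int[lambda]_(t in I) f t.
Proof.
rewrite [RHS]Rintegral_mkcond; apply: eq_Rintegral => t _.
by rewrite patchE indicE; case: ifP; rewrite ?mulr1 ?mulr0.
Qed.

Lemma measurable_line f d : measurable_fun setT f ->
  measurable_fun setT (fun z : E * R => f (z.1 + z.2 *: d) * \1_I z.2).
Proof.
move=> mf; apply: measurable_funM.
  exact: (measurableT_comp mf (measurable_rV_add_scale d)).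
have mI : measurable_fun setT (\1_I : R -> R) by exact: measurable_indic.
exact: (measurableT_comp mI).
Qed.

(** Integrating in [x] before [t] makes the inner integral independent of [t] on the interval, by
    translation invariance. *)
Lemma integrable_line q d : integrableR leb q ->
  integrableR (leb \x lambda)%E (fun z : E * R => q (z.1 + z.2 *: d) * \1_I z.2).
Proof.
move=> iq; have mq := integrableR_meas iq.
apply/integrable21ltyP.
  by apply/measurable_EFinP; exact: measurable_line.
rewrite (_ : (fun _ => _) = fun t => `|((\int[leb]_x `|q x|) * \1_I t)%:E|%E).
  by have /integrableP[] := integrableRZ (\int[leb]_x `|q x|) integrable_indic_I.
apply/funext => t /=; rewrite [X in _ = X%:E]ger0_norm; last by rewrite mulr_ge0// Rint_ge0.
under eq_integral do rewrite normrM.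
have iq' : integrableR leb (fun x => \1_I t * `|q (x + t *: d)|).
  by apply: integrableRZ; apply: integrableR_norm; exact: (Rint_shift _ iq).1.
transitivity (\int[leb]_x (\1_I t * `|q (x + t *: d)|)%:E)%E.
  by apply: eq_integral => x _; rewrite mulrC ger0_norm.
rewrite -(Rint_fine iq') RintZ; last by apply: integrableR_norm; exact: (Rint_shift _ iq).1.
by rewrite (Rint_shift (t *: d) (integrableR_norm iq)).2 mulrC.
Qed.

Lemma Rint_line q d : integrableR leb q ->
  \int[leb]_x \int[lambda]_t (q (x + t *: d) * \1_I t) = r * \int[leb]_x q x.
Proof.
move=> iq; rewrite (Rint_fubini (integrable_line d iq)).
transitivity ((\int[leb]_x q x) * \int[lambda]_t (\1_I t)); last first.
  by rewrite Rint_indic_I mulrC.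
rewrite -RintZ; last exact: integrable_indic_I.
apply: eq_Rintegral => t _ /=.
transitivity (\int[leb]_x (\1_I t * q (x + t *: d))).
  by apply: eq_Rintegral => x _; rewrite mulrC.
rewrite RintZ; last exact: (Rint_shift _ iq).1.
by rewrite (Rint_shift _ iq).2 mulrC.
Qed.

(** Cauchy-Schwarz against the constant function: the integral of [(k - c) ^ 2] over the interval is
    nonnegative for every [c], and [c = A / r] is the optimal choice. *)
Lemma sqr_Rint_I (k : R -> R) : integrableR lambda (fun t => k t ^+ 2 * \1_I t) ->
  measurable_fun setT (fun t => k t * \1_I t) ->
  integrableR lambda (fun t => k t * \1_I t) /\
  (\int[lambda]_t (k t * \1_I t)) ^+ 2 <= r * \int[lambda]_t (k t ^+ 2 * \1_I t).
Proof.
move=> ik2 mk.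
have ik : integrableR lambda (fun t => k t * \1_I t).
  apply: (@integrableR_le _ _ _ lambda _ (fun t => k t ^+ 2 * \1_I t + \1_I t)).
  - exact: mk.
  - move=> t.
    rewrite indicE; case: (t \in _); rewrite ?mulr0 ?normr0 ?addr0 ?mulr1//=.
    by move: (k t) => c; rewrite ler_norml; apply/andP; split; nra.
  - exact: (integrableRD ik2 integrable_indic_I).
split=> //.
set A := \int[lambda]_t (k t * _); set B := \int[lambda]_t (k t ^+ 2 * _).
have quad (c : R) : 0 <= B - 2 * c * A + c ^+ 2 * r.
  have -> : c ^+ 2 * r = \int[lambda]_t (c ^+ 2 * \1_I t).
    by rewrite RintZ ?Rint_indic_I//; exact: integrable_indic_I.
  have -> : 2 * c * A = \int[lambda]_t (2 * c * (k t * \1_I t)) by rewrite RintZ.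
  rewrite -RintB//; last exact: integrableRZ.
  rewrite -RintD; [|by apply: integrableRB => //; exact: integrableRZ|
    by apply: integrableRZ; exact: integrable_indic_I].
  apply: Rint_ge0 => t; rewrite indicE; have := sqr_ge0 (k t - c).
  case: (t \in _); rewrite /= ?mulr1n ?mulr0n; nra.
have B0 : 0 <= B by apply: Rint_ge0 => t; rewrite mulr_ge0// sqr_ge0.
have [r1|] := ltP 0 r; last first.
  move=> r0'; have r00 : r = 0 by apply/eqP; rewrite eq_le r0 r0'.
  have A0 : A = 0.
    (* For [r = 0] the quadratic is affine in [c], and at this value it would equal [-1]. *)
    apply/eqP/negPn/negP => A0; have := quad ((B + 1) / A / 2).
    rewrite r00 (_ : 2 * _ * A = B + 1); last by field.
    lra.
  by rewrite A0 r00 expr0n mul0r.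
have := quad (A / r).
have -> : B - 2 * (A / r) * A + (A / r) ^+ 2 * r = (r * B - A ^+ 2) / r.
  by field; rewrite gt_eqF.
by rewrite pmulr_lge0 ?invr_gt0// subr_ge0.
Qed.

End translation.

Section tprod_lemmas.
Context {R : realType} {N : nat}.
Implicit Types (x : 'rV[R]_N) (h : 'I_N -> R -> R) (i : 'I_N).

Definition tprod_others h i x : R := \prod_(j < N | j != i) h j (x ord0 j).

Lemma tprod_split h i x : tprod h x = tprod_others h i x * h i (x ord0 i).
Proof. by rewrite /tprod (bigD1 i)//= mulrC. Qed.

Lemma tprod_others_upd h i d x : tprod_others (tprod_upd h i d) i x = tprod_others h i x.
Proof. by apply: eq_bigr => j /negPf ji; rewrite /tprod_upd ji. Qed.

Lemma tprod_upd_split h i d x :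
  tprod (tprod_upd h i d) x = tprod_others h i x * d (x ord0 i).
Proof. by rewrite (tprod_split _ i) tprod_others_upd /tprod_upd eqxx. Qed.

Lemma tprod_line h i x (t : R) :
  tprod h (x - t *: unit_rV i) = tprod_others h i x * h i (x ord0 i - t).
Proof.
rewrite (tprod_split h i) -scaleNr addrC line_coord eqxx mulr1 [- t + _]addrC.
congr (_ * _); apply: eq_bigr => j /negPf ji.
by rewrite line_coord ji mulr0 add0r.
Qed.

Lemma bump_bounded (k : R -> R) : bump k -> exists M : R, forall s, `|k s| <= M.
Proof.
move=> [Ck [K kK]]; have ck := Cinfty_continuous Ck.
have K0 : - `|K| <= `|K| by rewrite ge0_cp.
have [c _ cM] : exists2 c, c \in `[- `|K|, `|K|] &
    forall t, t \in `[- `|K|, `|K|] -> `|k t| <= `|k c|.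
  apply: (@EVT_max _ (fun t => `|k t|)) => //; apply: continuous_subspaceT => t.
  by apply: continuous_comp; [exact: ck|exact: norm_continuous].
exists `|k c| => s; have [sK|sK] := leP `|s| `|K|.
  by apply: cM; rewrite in_itv /= -ler_norml.
by rewrite kK ?normr0// (le_lt_trans (ler_norm _) sK).
Qed.

End tprod_lemmas.

Section translation_estimate.
Context {R : realType} {N : nat}.
Local Notation E := ('rV[R]_N).
Local Notation leb := (@lebesgue_rV R N).
Local Notation lambda := (@lebesgue_measure R).
Implicit Types (x y d : E).

Variables (r : R) (u : E -> R) (w : E -> E) (i : 'I_N).
Hypotheses (r0 : 0 <= r) (su : sqint leb u) (uw : is_weak_gradient u w).
Local Notation I := (`[0, r]%classic : set R).
Local Notation e := (unit_rV i : E).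
Local Notation W := (fun x => w x ord0 i).

Let sW : sqint leb W. Proof. by move: uw => [sw _]; exact: sw. Qed.

Definition line_integral x : R := \int[lambda]_t (w (x + t *: e) ord0 i * \1_I t).
Local Notation L := line_integral.

(** The integrand is only square-integrable in [x], so Fubini's theorem does not apply to it
    directly; Tonelli's theorem applies to its positive and negative parts. *)
Lemma measurable_line_integral : measurable_fun setT L.
Proof.
have mk := measurable_line r e (sqint_meas sW).
pose k := fun z : E * R => (W (z.1 + z.2 *: e) * \1_I z.2)%:E.
have mk' : measurable_fun setT k by exact/measurable_EFinP.
rewrite (_ : L = fun x => fine (\int[lambda]_t k^\+ (x, t) - \int[lambda]_t k^\- (x, t))%E).
  apply: (measurableT_comp (fine_measurable measurableT)) => //.
  apply: emeasurable_funB.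
    by apply: measurable_fun_fubini_tonelli_F => //; exact: measurable_funepos.
  by apply: measurable_fun_fubini_tonelli_F => //; exact: measurable_funeneg.
apply/funext => x; rewrite /L /Rintegral integralE; congr (fine (_ - _)).
  by apply: eq_integral => t _; rewrite !funeposE.
by apply: eq_integral => t _; rewrite !funenegE.
Qed.

Let good : {ae leb, forall x,
  integrableR lambda (fun t => W (x + t *: e) ^+ 2 * \1_I t)}.
Proof.
exact: (integrableR_fubini1_ae (integrable_line r e (sqint_sqr sW))).
Qed.

Let mline x : measurable_fun setT (fun t : R => W (x + t *: e) * \1_I t).
Proof.
exact: (measurableT_comp (measurable_line r e (sqint_meas sW)) (measurable_pair1 x)).
Qed.

Let ae_line : {ae leb, forall x, integrableR lambda (fun t => W (x + t *: e) * \1_I t) /\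
  L x ^+ 2 <= r * \int[lambda]_t (W (x + t *: e) ^+ 2 * \1_I t)}.
Proof.
apply: filterS good => x ix.
exact: (@sqr_Rint_I _ r r0 (fun t => W (x + t *: e)) ix (mline x)).
Qed.

(** One factor [r] comes from Cauchy-Schwarz on almost every segment, the other from integrating the
    translates of the squared derivative over [[0, r]]. *)
Lemma line_integral_sqr : sqint leb L /\
  \int[leb]_x (L x ^+ 2) <= r ^+ 2 * \int[leb]_x (W x ^+ 2).
Proof.
have iF := integrableR_fubini1 (integrable_line r e (sqint_sqr sW)).
have [||||iL LE] := @Rint_le_ae _ _ _ leb (fun x => L x ^+ 2)
    (fun x => r * \int[lambda]_t (W (x + t *: e) ^+ 2 * \1_I t)).
- by apply: measurable_funX; exact: measurable_line_integral.
- by move=> x; exact: sqr_ge0.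
- by apply: filterS ae_line => x [].
- exact: integrableRZ iF.
split; first by apply/sqintP; split=> //; exact: measurable_line_integral.
apply: le_trans LE _; rewrite RintZ; last exact: iF.
by rewrite (Rint_line r0 e (sqint_sqr sW)) expr2 mulrA.
Qed.

Section test.
Variable h : 'I_N -> R -> R.
Hypothesis bh : forall j, bump (h j).

(** The convolution of the factor [h i] with the indicator of [[0, r]]. Its derivative is the
    increment of [h i] over the length [r], so that testing the weak gradient against it produces a
    difference of translates. *)
Definition bump_average s : R := \int[lambda]_t (h i (s - t) * \1_I t).
Local Notation P := bump_average.

Let chi : continuous (h i). Proof. exact: Cinfty_continuous (bh i).1. Qed.

Lemma bump_averageE s : P s = primitive (h i) s - primitive (h i) (s - r).
Proof.
rewrite /P (Rint_I r (fun t => h i (s - t))).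
have dF (t : R) : is_derive t 1 (fun t => (-1) * primitive (h i) ((-1) * t + s)) (h i (s - t)).
  have d1 := @is_derive1_affine _ (-1) s (primitive (h i)) t _ (is_derive_primitive _ chi).
  have := is_derive1_mul (is_derive_cst (-1 : R) t 1) d1.
  by rewrite mul0r add0r mulrA mulrNN !mul1r mulN1r [- t + s]addrC.
rewrite (Rintegral_FTC2 r0 _ dF); last first.
  apply: is_derive1_continuous => t.
  have [dh _] := Cinfty_derive (bh i).1.
  have := @is_derive1_affine _ (-1) s (h i) t _ (dh _).
  by under eq_fun do rewrite mulN1r addrC.
by rewrite mulr0 add0r !mulN1r opprK addrC [- r + s]addrC.
Qed.

Lemma is_derive_bump_average (s : R) : is_derive s 1 P (h i s - h i (s - r)).
Proof.
have -> : P = fun s => primitive (h i) s + (-1) * primitive (h i) (1 * s + - r).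
  by apply/funext => t; rewrite bump_averageE mulN1r mul1r.
have d1 := @is_derive1_affine _ 1 (- r) (primitive (h i)) s _ (is_derive_primitive _ chi).
have d2 := is_derive1_mul (is_derive_cst (-1 : R) s 1) d1.
have := is_derive1_add (is_derive_primitive s chi) d2.
by rewrite mul0r add0r mulN1r !mul1r.
Qed.

Lemma bump_bump_average : bump P.
Proof.
split.
  apply: (Cinfty_primitive is_derive_bump_average) => n.
  apply: Ck_add; first exact: (bh i).1.
  have := Ck_mul (Ck_cst n (-1)) (Ck_affine 1 (- r) ((bh i).1 n)).
  by congr Ck; apply/funext => s; rewrite mulN1r mul1r.
have [K hK] := (bh i).2; exists (K + r) => s Ks.
rewrite /P /Rintegral; under eq_integral => t _.
  rewrite indicE; have [tI|tI] := boolP (t \in _); last first.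
    rewrite mulr0; over.
  rewrite hK ?mul0r; first over.
  move: tI; rewrite inE /= in_itv /= => /andP[t0 tr].
  rewrite -(ltrD2r r) (lt_le_trans Ks)//.
  rewrite -{1}(subrK t s) (le_trans (ler_normD _ _))// lerD2l ger0_norm//.
by rewrite integral0.
Qed.

Local Notation f := (tprod h).
Local Notation Phi := (tprod (tprod_upd h i P)).

Lemma integrable_bump_average s : integrableR lambda (fun t => h i (s - t) * \1_I t).
Proof.
have [M hM] := bump_bounded (bh i).
apply: (@integrableR_le _ _ _ lambda _ (fun t => M * \1_I t)).
- apply: measurable_funM; last exact: measurable_indic.
  apply: measurableT_comp; first exact: continuous_measurable_fun.
  exact: measurable_funB.
- by move=> t; rewrite normrM [X in _ * X]ger0_norm// ler_wpM2r.
- apply: integrableRZ; exact: integrable_indic_I.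
Qed.

Lemma tprod_averageE x (c : R) :
  c * Phi x = \int[lambda]_t (c * (f (x - t *: e) * \1_I t)).
Proof.
rewrite tprod_upd_split mulrA -RintZ; last exact: integrable_bump_average.
by apply: eq_Rintegral => t _; rewrite tprod_line !mulrA.
Qed.

Lemma test_Phi : test_function Phi.
Proof.
apply: test_function_tprod => j; rewrite /tprod_upd; case: ifP => // _.
exact: bump_bump_average.
Qed.

Lemma test_f : test_function f.
Proof. exact: test_function_tprod. Qed.

(** The derivative of [Phi] along the axis is [f x - f (x - r e)]; the definition of the weak
    gradient applies to it, and a change of variables moves the translation from [f] to [u]. *)
Lemma difference_test :
  \int[leb]_x ((u (x + r *: e) - u x) * f x) = \int[leb]_x (W x * Phi x).
Proof.
have sf := sqint_test_function test_f.
have sfr : sqint leb (fun x => f (x - r *: e)) by exact: sqint_shift.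
have sur := sqint_shift (r *: e) su.
apply: oppr_inj; move: uw => [_ /(_ i _ test_Phi) <-].
have dPhi x : 'D_e Phi x = f x - f (x - r *: e).
  have dP (s : R) : is_derive s 1 (tprod_upd h i P i) (h i s - h i (s - r)).
    by rewrite /tprod_upd eqxx; exact: is_derive_bump_average.
  have := is_derive_tprod x dP => -[_ ->].
  rewrite tprod_upd_split tprod_others_upd mulrBr -tprod_line.
  by rewrite -tprod_split.
under [in RHS]eq_Rintegral do rewrite dPhi mulrBr.
rewrite RintB; [|exact: sqint_mul|exact: sqint_mul].
under [in LHS]eq_Rintegral do rewrite mulrBl.
rewrite RintB; [|exact: sqint_mul|exact: sqint_mul].
rewrite opprB; congr (_ - _).
have := (Rint_shift (r *: e) (sqint_mul su sfr)).2 => <-.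
by apply: eq_Rintegral => x _; rewrite addrK.
Qed.

(** Exchange the integrals and translate by [t e] for each fixed [t]: the average along the segment
    passes from the derivative to the test function. *)
Lemma line_integral_test :
  \int[leb]_x (L x * f x) = \int[leb]_x (W x * Phi x).
Proof.
have sf := sqint_test_function test_f; have mf := sqint_meas sf.
have mW := sqint_meas sW.
pose k1 (z : E * R) := W (z.1 + z.2 *: e) * \1_I z.2 * f z.1.
pose k2 (z : E * R) := W z.1 * (f (z.1 - z.2 *: e) * \1_I z.2).
have dom (a b c : R) : `|a * \1_I c * b| <= a ^+ 2 * \1_I c + b ^+ 2 * \1_I c.
  rewrite indicE; case: (c \in _); rewrite ?mulr1n ?mulr0n ?mulr1 ?mulr0 ?mul0r ?normr0 ?addr0//.
  have := sqr_ge0 (a - b); have := sqr_ge0 (a + b).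
  by move=> ? ?; rewrite ler_norml; apply/andP; split; nra.
have ik1 : integrableR (leb \x lambda)%E k1.
  (* A product is dominated by the sum of the squares. Writing [z.2 *: 0] makes the second square an
     instance of [integrable_line] in the zero direction. *)
  apply: (@integrableR_le _ _ _ (leb \x lambda)%E k1 (fun z : E * R =>
    W (z.1 + z.2 *: e) ^+ 2 * \1_I z.2 + f (z.1 + z.2 *: 0) ^+ 2 * \1_I z.2)).
  - by apply: measurable_funM; [exact: (measurable_line r e mW)|exact: (measurableT_comp mf measurable_fst)].
  - by move=> z; rewrite scaler0 addr0; exact: dom.
  - by apply: integrableRD; [exact: (integrable_line r e (sqint_sqr sW))|
      exact: (integrable_line r 0 (sqint_sqr sf))].
have ik2 : integrableR (leb \x lambda)%E k2.
  apply: (@integrableR_le _ _ _ (leb \x lambda)%E k2 (fun z : E * R =>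
    f (z.1 + z.2 *: (- e)) ^+ 2 * \1_I z.2 + W (z.1 + z.2 *: 0) ^+ 2 * \1_I z.2)).
  - apply: measurable_funM; first exact: (measurableT_comp mW measurable_fst).
    have := measurable_line r (- e) mf.
    by under eq_fun do rewrite scalerN.
  - by move=> z; rewrite /k2 mulrC scaler0 addr0 scalerN; exact: dom.
  - by apply: integrableRD; [exact: (integrable_line r (- e) (sqint_sqr sf))|
      exact: (integrable_line r 0 (sqint_sqr sW))].
transitivity (\int[leb]_x \int[lambda]_t k1 (x, t)).
  apply: Rint_ae.
  - by apply: measurable_funM => //; exact: measurable_line_integral.
  - exact: integrableR_meas (integrableR_fubini1 ik1).
  - apply: filterS ae_line => x [il _].
    by rewrite /k1 /= mulrC -RintZ//; apply: eq_Rintegral => t _; rewrite mulrC.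
rewrite (Rint_fubini ik1).
transitivity (\int[lambda]_t \int[leb]_x k2 (x, t)).
  apply: eq_Rintegral => t _; rewrite /k1 /k2 /=.
  have sft : sqint leb (fun x => f (x - t *: e)) by exact: sqint_shift.
  have i3 : integrableR leb (fun x => \1_I t * (W x * f (x - t *: e))).
    by apply: integrableRZ; exact: sqint_mul.
  transitivity (\int[leb]_x (\1_I t * (W x * f (x - t *: e)))); last first.
    by apply: eq_Rintegral => x _; rewrite mulrC mulrA.
  rewrite -(Rint_shift (t *: e) i3).2; apply: eq_Rintegral => x _.
  by rewrite addrK mulrA [_ * W _]mulrC.
rewrite -(Rint_fubini ik2); apply: Rint_ae.
- exact: integrableR_meas (integrableR_fubini1 ik2).
- by apply: measurable_funM => //; exact: sqint_meas (sqint_test_function test_Phi).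
- by apply: aeW => x; rewrite tprod_averageE.
Qed.

End test.

(* Both sides have the same integral against every product of bumps: averaging
   a bump over [0, r] yields a test function for the weak gradient. *)
Lemma translation_line : {ae leb, forall x, u (x + r *: e) - u x = L x}.
Proof.
have sur := sqint_shift (r *: e) su.
have sD : sqint leb (fun x => u (x + r *: e) - u x).
  have := sqintD sur (sqintZ (-1) su); congr sqint; apply/funext => x; by rewrite mulN1r.
have [sL _] := line_integral_sqr.
have sDL : sqint leb (fun x => (u (x + r *: e) - u x) + (-1) * L x).
  by apply: sqintD => //; exact: sqintZ.
apply: (filterS _ (bump_integral_ae0 sDL _)).
  by move=> x /eqP; rewrite mulN1r subr_eq0 => /eqP.
move=> h bh; have sf := sqint_test_function (test_f bh).
under eq_Rintegral do rewrite mulrDl -mulrA.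
rewrite RintD; [|exact: sqint_mul|by apply: integrableRZ; exact: sqint_mul].
rewrite RintZ; last exact: sqint_mul.
by rewrite difference_test// line_integral_test// mulN1r subrr.
Qed.

Lemma translation_sqr :
  \int[leb]_x ((u (x + r *: e) - u x) ^+ 2) <= r ^+ 2 * \int[leb]_x (W x ^+ 2).
Proof.
have [sL] := line_integral_sqr; apply: le_trans; rewrite le_eqVlt; apply/orP; left; apply/eqP.
have mu := sqint_meas su; have mur := sqint_meas (sqint_shift (r *: e) su).
apply: Rint_ae.
- by apply: measurable_funX; exact: measurable_funB.
- by apply: measurable_funX; exact: measurable_line_integral.
- by apply: filterS translation_line => x ->.
Qed.

End translation_estimate.

(** * Sobolev embedding *)

Section tonelli.
Context d1 d2 (T1 : measurableType d1) (T2 : measurableType d2) (R : realType).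
Variable m1 : {sigma_finite_measure set T1 -> \bar R}.
Variable m2 : {sigma_finite_measure set T2 -> \bar R}.

Lemma Rint_tonelli_le (f : T1 * T2 -> R) (g : T2 -> R) :
  measurable_fun setT f -> (forall z, 0 <= f z) ->
  (forall y, integrableR m1 (fun x => f (x, y))) ->
  (forall y, \int[m1]_x f (x, y) <= g y) -> integrableR m2 g ->
  integrableR (m1 \x m2)%E f /\ \int[m2]_y \int[m1]_x f (x, y) <= \int[m2]_y g y.
Proof.
move=> mf f0 intf fg ig.
have mf' : measurable_fun setT (EFin \o f) by exact/measurable_EFinP.
have fE y : (\int[m1]_x `|(EFin \o f) (x, y)|)%E = (\int[m1]_x f (x, y))%:E.
  rewrite (Rint_fine (intf y)); apply: eq_integral => x _ /=.
  by rewrite ger0_norm.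
have iF : integrableR (m1 \x m2)%E f.
  apply/integrable21ltyP => //.
  have [mg goo] := integrableP _ _ _ ig; apply: le_lt_trans goo.
  apply: ge0_le_integral => //.
  - by move=> y _; exact: integral_ge0.
  - apply: (measurable_fun_fubini_tonelli_G (m1 := m1) (abse \o (EFin \o f))) => //=; exact: measurableT_comp.
  - exact: measurableT_comp.
  - by move=> y _; rewrite fE /= lee_fin (le_trans (fg y))// ler_norm.
by split=> //; apply: Rint_le => //; exact: integrableR_fubini2 iF.
Qed.

End tonelli.

Section weak_type.
Context {R : realType} {N : nat}.
Local Notation E := ('rV[R]_N).
Local Notation leb := (@lebesgue_rV R N).
Implicit Types (x y : E) (u : E -> R) (w : E -> E).

(** The vector is reached one coordinate at a time. By [(a + b) ^ 2 <= 2 a ^ 2 + 2 b ^ 2] the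
    constants obey [c_(k+1) = 2 c_k + 2] with [c_0 = 0], whence [2 ^ (k + 1) - 2]. *)
Lemma translation_sqr_vec u w y (r D : R) : (0 < N)%N -> sqint leb u -> is_weak_gradient u w ->
  (forall i, \int[leb]_x (w x ord0 i ^+ 2) <= D) ->
  (forall i, 0 <= y ord0 i <= r) ->
  \int[leb]_x ((u (x + y) - u x) ^+ 2) <= 2 ^+ N.+1 * r ^+ 2 * D.
Proof.
move=> N0 su uw wD yr.
pose yk k : E := \row_j (if (j < k)%N then y ord0 j else 0).
have sB v v' : sqint leb v -> sqint leb v' -> sqint leb (fun x => v x - v' x).
  move=> sv sv'; have := sqintD sv (sqintZ (-1) sv').
  by congr sqint; apply/funext => x; rewrite mulN1r.
have D0 : 0 <= D.
  apply: le_trans (wD (Ordinal N0)); apply: Rint_ge0 => x; exact: sqr_ge0.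
have step k : (k <= N)%N ->
    \int[leb]_x ((u (x + yk k) - u x) ^+ 2) <= (2 ^+ k.+1 - 2) * (r ^+ 2 * D).
  elim: k => [_|k IH kN].
    rewrite expr1 subrr mul0r (_ : yk 0%N = 0); last by apply/rowP => j; rewrite !mxE.
    under eq_Rintegral do rewrite addr0 subrr expr0n.
    by rewrite /Rintegral integral0.
  pose i := Ordinal kN; pose t := y ord0 i.
  have ykS : yk k.+1 = yk k + t *: unit_rV i.
    apply/rowP => j; rewrite !mxE eqxx /= ltnS leq_eqVlt.
    have [->|ji] := eqVneq j i; first by rewrite eqxx /= ltnn mulr1 add0r.
    have -> : ((j : nat) == k) = false.
      by apply: contraNF ji => /eqP jk; apply/eqP/val_inj.
    by rewrite /= mulr0 addr0.
  have /andP[t0 tr] := yr i.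
  have s1 := sB _ _ (sqint_shift (yk k) su) su.
  have s2 : sqint leb (fun x => u (x + yk k + t *: unit_rV i) - u (x + yk k)).
    apply: (sqint_shift (yk k) (f := fun x => u (x + t *: unit_rV i) - u x)).
    by apply: sB => //; exact: sqint_shift.
  have i1 := sqint_sqr s1; have i2 := sqint_sqr s2.
  apply: (@le_trans _ _ (\int[leb]_x (2 * (u (x + yk k + t *: unit_rV i) - u (x + yk k)) ^+ 2
      + 2 * (u (x + yk k) - u x) ^+ 2))).
    apply: Rint_le.
    - by apply: sqint_sqr; apply: sB => //; exact: sqint_shift.
    - by apply: integrableRD; exact: integrableRZ.
    - move=> x; rewrite ykS addrA.
      set a := u (x + _ + _); set b := u (x + _); set c := u x.
      have := sqr_ge0 (a - b - (b - c)); nra.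
  rewrite RintD; [|exact: integrableRZ|exact: integrableRZ].
  rewrite !RintZ//.
  have H : \int[leb]_x ((u (x + yk k + t *: unit_rV i) - u (x + yk k)) ^+ 2) <= r ^+ 2 * D.
    have s3 := sB _ _ (sqint_shift (t *: unit_rV i) su) su.
    rewrite (Rint_shift (yk k) (sqint_sqr s3)).2.
    apply: le_trans (translation_sqr i t0 su uw) _.
    rewrite ler_pM ?sqr_ge0//; first by apply: Rint_ge0 => x; exact: sqr_ge0.
    by rewrite ler_sqr// nnegrE// (le_trans t0).
  have := IH (ltnW kN); rewrite [2 ^+ k.+2]exprS; nra.
have -> : y = yk N by apply/rowP => j; rewrite !mxE ltn_ord.
apply: le_trans (step N (leqnn _)) _; rewrite -mulrA.
rewrite ler_wpM2r//; last by rewrite lerBlDr lerDl.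
by rewrite mulr_ge0 ?sqr_ge0.
Qed.

Definition tail_set u (l : R) : set E := [set x | l < `|u x|].

Definition tail u (l : R) : R := \int[leb]_x \1_(tail_set u l) x.

Lemma measurable_tail_set u l : measurable_fun setT u -> measurable (tail_set u l).
Proof.
move=> mu; have mau : measurable_fun setT (fun x => `|u x|) by exact: measurableT_comp.
have := mau measurableT `]l, +oo[%classic (measurable_itv _); rewrite setTI.
by congr measurable; apply/seteqP; split => x /=; rewrite in_itv /= andbT.
Qed.

Lemma integrable_tail u l : 0 < l -> sqint leb u ->
  integrableR leb (\1_(tail_set u l) : E -> R) /\ l ^+ 2 * tail u l <= \int[leb]_x (u x ^+ 2).
Proof.
move=> l0 su; have mA := measurable_tail_set l (sqint_meas su).
have bound x : \1_(tail_set u l) x <= (l ^+ 2)^-1 * u x ^+ 2.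
  rewrite indicE; have [/set_mem xA|_] := boolP (x \in _); last first.
    by rewrite mulr_ge0 ?sqr_ge0// invr_ge0 sqr_ge0.
  rewrite mulrC ler_pdivlMr ?exprn_gt0// mul1r -(real_normK (num_real (u x))).
  by rewrite ler_sqr ?nnegrE ?normr_ge0 ?(ltW l0)//; exact: ltW.
have i2 := integrableRZ (l ^+ 2)^-1 (sqint_sqr su).
have iA : integrableR leb (\1_(tail_set u l) : E -> R).
  apply: (integrableR_le _ _ i2) => [|x]; first exact: measurable_indic.
  by rewrite ger0_norm.
split=> //; have := Rint_le iA i2 bound; rewrite RintZ; last exact: sqint_sqr.
by rewrite mulrC ler_pdivlMr ?exprn_gt0// mulrC.
Qed.

Lemma Rint_cube (r : R) : 0 <= r ->
  integrableR leb (\1_(ocbox 0 (const_mx r)) : E -> R) /\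
  \int[leb]_x (\1_(ocbox 0 (const_mx r)) x) = r ^+ N.
Proof.
move=> r0; have mQ : measurable (ocbox 0 (const_mx r) : set E) by exact: measurable_ocbox.
split.
  apply/integrableP; split; first by apply/measurable_EFinP; exact: measurable_indic.
  under eq_integral do rewrite /= ger0_norm//.
  by rewrite integral_indic// setIT; exact: lebesgue_ocbox_lty.
rewrite /Rintegral integral_indic// setIT.
transitivity (fine (\prod_(i < N) lebesgue_measure
    `](0%R : E) ord0 i, (const_mx r : E) ord0 i]%classic)%E).
  by congr fine; exact: lebesgue_ocbox.
rewrite (eq_bigr (fun=> r%:E)); last first.
  move=> i _; rewrite lebesgue_measure_itv/= !mxE lte_fin.
  case: ifPn => [_|]; first by rewrite sube0.
  by rewrite -leNgt => r0'; congr EFin; apply/eqP; rewrite eq_le r0 r0'.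
by rewrite prodEFin /= prodr_const card_ord.
Qed.

(* If [|u x| > 2 l], then [|u (x + y) - u x| > l] for all [y] in the cube of side [r]
   outside a subset of volume [tail u l <= r ^ N / 2]; integrate over [x] and [y]. *)
Lemma tail_step u w (l r : R) : (0 < N)%N -> sqint leb u -> is_weak_gradient u w ->
  (forall i, \int[leb]_x (w x ord0 i ^+ 2) <= 1) ->
  0 < l -> 0 < r -> 2 * tail u l <= r ^+ N ->
  l ^+ 2 * tail u (2 * l) <= 2 * 2 ^+ N.+1 * r ^+ 2.
Proof.
move=> N0 su uw w1 l0 r0 tr.
have mu := sqint_meas su.
pose Q : set E := ocbox 0 (const_mx r).
have mQ : measurable Q by exact: measurable_ocbox.
have [iQ QE] := Rint_cube (ltW r0).
have [iB _] := integrable_tail l0 su.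
have l20 : 0 < 2 * l by rewrite mulr_gt0.
have [iA _] := integrable_tail l20 su.
pose F (z : E * E) := (u (z.1 + z.2) - u z.1) ^+ 2 * \1_Q z.2.
have mF : measurable_fun setT F.
  apply: measurable_funM; last first.
    have m1 : measurable_fun setT (\1_Q : E -> R) by exact: measurable_indic.
    exact: (measurableT_comp m1 measurable_snd).
  apply: measurable_funX; apply: measurable_funB.
    exact: (measurableT_comp mu measurable_rV_add).
  exact: (measurableT_comp mu measurable_fst).
have sD y : sqint leb (fun x => u (x + y) - u x).
  have := sqintD (sqint_shift y su) (sqintZ (-1) su).
  by congr sqint; apply/funext => x; rewrite mulN1r.
have [||||iF FE] := @Rint_tonelli_le _ _ _ _ _ leb leb F
    (fun y => 2 ^+ N.+1 * r ^+ 2 * 1 * \1_Q y) mF.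
- by move=> z; rewrite mulr_ge0// sqr_ge0.
- move=> y; have := integrableRZ (\1_Q y) (sqint_sqr (sD y)).
  by congr (integrableR leb _); apply/funext => x; rewrite mulrC.
- move=> y; rewrite /F /=; under eq_Rintegral do rewrite mulrC.
  rewrite RintZ; last exact: sqint_sqr.
  rewrite mulrC indicE; have [/set_mem yQ|] := boolP (y \in Q); last by rewrite !mulr0.
  rewrite ler_wpM2r//; apply: (translation_sqr_vec N0 su uw w1) => i.
  by have := yQ i; rewrite !mxE => /andP[/ltW -> ->].
- exact: integrableRZ iQ.
rewrite RintZ// QE mulr1 -(Rint_fubini iF) in FE.
have rN : 0 < r ^+ N by rewrite exprn_gt0.
have l2 : 0 < l ^+ 2 by rewrite exprn_gt0.
have [||||_ AE] := @Rint_le_ae _ _ _ leb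
    (fun x => l ^+ 2 * (r ^+ N / 2) * \1_(tail_set u (2 * l)) x)
    (fun x => \int[leb]_y F (x, y)).
- exact: integrableR_meas (integrableRZ _ iA).
- by move=> x; rewrite mulr_ge0// mulr_ge0 ?ltW// divr_gt0.
- apply: filterS (integrableR_fubini1_ae iF) => x iFx.
  rewrite indicE; have [/set_mem xA|_] := boolP (x \in _); last first.
    by rewrite mulr0; apply: Rint_ge0 => y; rewrite mulr_ge0// sqr_ge0.
  have [iBx BxE] := Rint_shift x iB.
  have iG : integrableR leb (fun y => l ^+ 2 * (\1_Q y - \1_(tail_set u l) (y + x))).
    by apply: integrableRZ; exact: integrableRB.
  (* Subtracting the two indicators, instead of removing the exceptional set from the cube, keeps
     the integral explicit; off the cube the difference is nonpositive, and on the exceptional part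
     of the cube it is zero. *)
  apply: (@le_trans _ _ (\int[leb]_y (l ^+ 2 * (\1_Q y - \1_(tail_set u l) (y + x))))).
    rewrite RintZ; last exact: integrableRB.
    rewrite RintB// QE BxE -/(tail u l) mulr1n mulr1 ler_pM2l//; lra.
  apply: Rint_le => // y; rewrite /F /= indicE.
  have [yQ|yQ] := boolP (y \in Q); rewrite ?mulr1n ?mulr0n; last first.
    by rewrite mulr0 sub0r mulrN oppr_le0 mulr_ge0// ltW.
  rewrite mulr1 indicE; have [|yB] := boolP (_ \in _); rewrite ?mulr1n ?mulr0n.
    by rewrite subrr mulr0 sqr_ge0.
  rewrite subr0 mulr1 -(real_normK (num_real (_ - _))) ler_sqr ?nnegrE ?(ltW l0)//.
  have yl : `|u (x + y)| <= l.
    by rewrite leNgt; apply: contra yB => yB; rewrite inE /tail_set /= addrC.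
  have := ler_distD (u (x + y)) (u x) 0; rewrite !subr0 distrC.
  move: xA; rewrite /tail_set /=; lra.
- exact: integrableR_fubini1 iF.
rewrite RintZ// -/(tail u _) in AE.
have := le_trans AE FE.
rewrite (_ : l ^+ 2 * (r ^+ N / 2) * _ = l ^+ 2 * tail u (2 * l) / 2 * r ^+ N); last by field.
rewrite ler_pM2r// => H; rewrite -mulrA; lra.
Qed.

End weak_type.

Section monotone.
Context d (T : measurableType d) (R : realType) (mu : {measure set T -> \bar R}).

Lemma Rint_monotone_bound (F : nat -> T -> R) (f : T -> R) (K : R) :
  (forall n, integrableR mu (F n)) -> (forall n x, 0 <= F n x) ->
  (forall x, nondecreasing_seq (F ^~ x)) ->
  (forall x, F n x @[n --> \oo] --> f x) -> (forall n, \int[mu]_x F n x <= K) ->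
  integrableR mu f /\ \int[mu]_x f x <= K.
Proof.
move=> iF F0 ndF Ff FK.
have mF n := integrableR_meas (iF n).
have mf : measurable_fun setT f by apply: (measurable_fun_cvg mF) => x _; exact: Ff.
have f0 x : 0 <= f x.
  by apply: (cvgr_to_ge (Ff x)); exact: nearW.
have IK : (\int[mu]_x (f x)%:E <= K%:E)%E.
  have -> : (\int[mu]_x (f x)%:E = limn (fun n => \int[mu]_x (F n x)%:E))%E.
    rewrite -monotone_convergence//=.
    - apply: eq_integral => x _; apply/esym/cvg_lim => //.
      by apply: cvg_EFin; [exact: nearW|exact: Ff].
    - by move=> n; exact/measurable_EFinP.
    - by move=> n x _; rewrite lee_fin.
    - by move=> x _ m n mn; rewrite lee_fin; exact: ndF.
  apply: lime_le; last by apply: nearW => n; rewrite -Rint_fine// lee_fin.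
  apply: ereal_nondecreasing_is_cvgn => m n mn; apply: ge0_le_integral => //.
  - by move=> x _; rewrite lee_fin.
  - exact/measurable_EFinP.
  - exact/measurable_EFinP.
  - by move=> x _; rewrite lee_fin; exact: ndF.
have intf : integrableR mu f.
  apply/integrableP; split; first exact/measurable_EFinP.
  under eq_integral do rewrite gee0_abs ?lee_fin//.
  by apply: le_lt_trans IK _; exact: ltry.
by split=> //; rewrite -lee_fin Rint_fine.
Qed.

End monotone.

Section sobolev_embedding.
Context {R : realType} {N : nat}.
Local Notation E := ('rV[R]_N).
Local Notation leb := (@lebesgue_rV R N).
Implicit Types (x y : E) (u : E -> R) (w : E -> E).
Hypothesis N0 : (0 < N)%N.

Let NR0 : 0 < N%:R :> R. Proof. by rewrite ltr0n. Qed.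

(** In [tail_step] a side [r] with [r ^ N] of order [l ^ (- s)] gives decay [l ^ (- 2 - 2 s / N)].
    For [N >= 3] the fixed point of this map is the Sobolev exponent [2 N / (N - 2)]; for [N <= 2]
    its iterates are unbounded. *)
Definition tail_exponent (s : R) : R := 2 + 2 * s / N%:R.

(** The first factors come from [tail_step], the power of [2 A] from the side of the cube, and the
    last factor from passing from the level [l / 2] to [l]. *)
Definition tail_constant (A s : R) : R :=
  2 * 2 ^+ N.+1 * ((2 * A) `^ N%:R^-1) ^+ 2 * 2 `^ tail_exponent s.

Lemma tail_constant_gt0 A s : 0 < A -> 0 < tail_constant A s.
Proof.
move=> A0; rewrite mulr_gt0 ?powR_gt0// mulr_gt0 ?exprn_gt0 ?powR_gt0 ?mulr_gt0//.
Qed.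

Section normalized.
Variables (u : E -> R) (w : E -> E).
Hypotheses (su : sqint leb u) (uw : is_weak_gradient u w).
Hypotheses (w1 : forall i, \int[leb]_x (w x ord0 i ^+ 2) <= 1)
           (u1 : \int[leb]_x (u x ^+ 2) <= 1).

Lemma tail_improve (A s : R) : 0 < A ->
  (forall l, 0 < l -> tail u l <= A * l `^ (- s)) ->
  forall l, 0 < l -> tail u l <= tail_constant A s * l `^ (- tail_exponent s).
Proof.
move=> A0 tA l l0; pose m := l / 2.
have m0 : 0 < m by rewrite divr_gt0.
have b0 : 0 < 2 * A * m `^ (- s) by rewrite !mulr_gt0// powR_gt0.
(* The smallest cube that the assumed decay allows in [tail_step]: its volume is twice the bound on
   the tail at the level [m]. *)
pose r := (2 * A * m `^ (- s)) `^ N%:R^-1.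
have r0 : 0 < r by rewrite powR_gt0.
have rN : r ^+ N = 2 * A * m `^ (- s).
  rewrite -powR_mulrn ?(ltW r0)// -powRrM mulVf ?gt_eqF// powRr1// ltW//.
have := tail_step N0 su uw w1 m0 r0.
rewrite rN -mulrA ler_pM2l// => /(_ (tA _ m0)).
have -> : 2 * m = l by rewrite /m mulrC divfK.
rewrite mulrC -ler_pdivlMr ?exprn_gt0// => /le_trans; apply.
rewrite /r powRM ?powR_ge0 ?mulr_ge0 ?(ltW A0)//.
have alg (c a b d : R) : c * (a * b) ^+ 2 / d = c * a ^+ 2 * (b ^+ 2 / d).
  by rewrite exprMn !mulrA.
rewrite alg.
have -> : (m `^ (- s) `^ N%:R^-1) ^+ 2 / m ^+ 2 = m `^ (- tail_exponent s).
  rewrite -[X in X / _]powR_mulrn ?powR_ge0// -!powRrM -powR_invn ?(ltW m0)//.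
  rewrite -powRD; last by rewrite (gt_eqF m0) implybT.
  by congr (_ `^ _); rewrite /tail_exponent; field; rewrite gt_eqF.
have -> : m `^ (- tail_exponent s) = l `^ (- tail_exponent s) * 2 `^ tail_exponent s.
  rewrite /m powRM ?invr_ge0 ?(ltW l0)//; congr (_ * _).
  by rewrite -powR_inv1// -powRrM mulN1r opprK.
rewrite le_eqVlt; apply/orP; left; apply/eqP; rewrite /tail_constant; ring.
Qed.

Lemma tail_decay l : 0 < l ->
  tail u l <= tail_constant (tail_constant 1 2) (2 + 4 / N%:R) *
    l `^ (- tail_exponent (2 + 4 / N%:R)).
Proof.
have t2 : forall l, 0 < l -> tail u l <= 1 * l `^ (- 2).
  move=> m m0; have [_ H] := integrable_tail m0 su.
  rewrite mul1r powR_invn ?(ltW m0)// -[_ ^- 2]mul1r ler_pdivlMr ?exprn_gt0// mulrC.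
  exact: le_trans H u1.
have -> : 2 + 4 / N%:R = tail_exponent 2.
  by rewrite /tail_exponent -natrM.
by move: l; apply: tail_improve; [exact: tail_constant_gt0|exact: tail_improve].
Qed.

End normalized.

Local Notation p := (2 + 4 / N%:R : R).

Lemma p_ge2 : 2 <= p. Proof. by rewrite lerDl divr_ge0// ltW. Qed.

(** For [|s| <= 1] the square dominates because [p >= 2]. Otherwise the term of the largest [k] with
    [2 ^ k < |s|] dominates alone, and the others are nonnegative. *)
Lemma dyadic_powR_le (s : R) n : `|s| <= 2 ^+ n ->
  `|s| `^ p <= s ^+ 2 + \sum_(k < n) (2 ^+ k.+1) `^ p * ((2 ^+ k < `|s|)%R)%:R.
Proof.
elim: n => [|n IH] sn.
  rewrite big_ord0 addr0 -(real_normK (num_real s)) -powR_mulrn//.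
  rewrite expr0 in sn; have [->|s0] := eqVneq `|s| 0.
    by rewrite !powR0 ?gt_eqF ?(lt_le_trans _ p_ge2).
  apply: (@le_trans _ _ (`|s| `^ 2 * `|s| `^ (p - 2))).
    by rewrite -powRD ?s0 ?implybT// subrKC.
  rewrite ler_piMr ?powR_ge0// -[leRHS](congr1 (@^~ (p - 2)) (@powR1 R)).
  by apply: ge0_ler_powR; rewrite ?nnegrE// subr_ge0 p_ge2.
rewrite big_ord_recr /= addrA; have [s'|s'] := leP `|s| (2 ^+ n).
  by rewrite mulr0 addr0; exact: IH.
rewrite mulr1 -[leLHS]add0r lerD//.
  apply: addr_ge0; [exact: sqr_ge0|apply: sumr_ge0 => k _].
  by apply: mulr_ge0; rewrite ?powR_ge0.
by apply: ge0_ler_powR; rewrite ?nnegrE ?(le_trans _ p_ge2)//.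
Qed.

Let A := tail_constant (tail_constant 1 2) p.
Let A0 : 0 < A. Proof. by rewrite !tail_constant_gt0. Qed.

(** The ratio of the geometric series formed by the dyadic layers; it is less than [1] because the
    improved exponent exceeds [p] by [8 / N ^ 2]. *)
Let z : R := 2 `^ (p - tail_exponent p).

Let z01 : 0 < z < 1.
Proof.
rewrite powR_gt0//=; have d0 : 0 < tail_exponent p - p.
  rewrite (_ : _ - _ = 8 / N%:R / N%:R); first by rewrite !divr_gt0.
  by rewrite /tail_exponent; field; rewrite gt_eqF.
rewrite /z -opprB powRN invf_lt1 ?powR_gt0//.
rewrite -[ltLHS](congr1 (@^~ (tail_exponent p - p)) (@powR1 R)).
by apply: gt0_ltr_powR; rewrite ?nnegrE// ltr1n.
Qed.

(** The term [1] bounds the integral of the square; the layer of index [k] contributes at most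
    [2 ^ p * A * z ^ k]. *)
Definition sobolev_constant : R := 1 + 2 `^ p * A / (1 - z).

Lemma sobolev_constant_ge0 : 0 <= sobolev_constant.
Proof.
have /andP[z0 z1] := z01; rewrite addr_ge0// divr_ge0 ?subr_ge0 ?(ltW z1)//.
by rewrite mulr_ge0 ?powR_ge0 ?(ltW A0).
Qed.

Lemma geometric_le n : \sum_(k < n) z ^+ k <= (1 - z)^-1.
Proof.
have /andP[z0 z1] := z01; rewrite -[leRHS]mul1r ler_pdivlMr ?subr_gt0//.
have := subrX1 z n; have := exprn_ge0 n (ltW z0); nra.
Qed.

(** Integrability of [|u|^p] is itself to be proved: the truncations to [|u| <= 2 ^ n] are dominated
    by finitely many dyadic layers, with integrals bounded uniformly in [n], and increase to
    [|u|^p]. *)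
Lemma sobolev_normalized u w : sqint leb u -> is_weak_gradient u w ->
  (forall i, \int[leb]_x (w x ord0 i ^+ 2) <= 1) -> \int[leb]_x (u x ^+ 2) <= 1 ->
  integrableR leb (fun x => `|u x| `^ p) /\
  \int[leb]_x (`|u x| `^ p) <= sobolev_constant.
Proof.
move=> su uw w1 u1; have mu := sqint_meas su.
have mau : measurable_fun setT (fun x => `|u x|) by exact: measurableT_comp.
have mp : measurable_fun setT (fun x => `|u x| `^ p).
  exact: (measurableT_comp (measurable_powR p) mau).
have pow2 n : 0 < 2 ^+ n :> R by rewrite exprn_gt0.
have mt n : measurable (tail_set u (2 ^+ n)) by exact: measurable_tail_set.
have it n := (integrable_tail (pow2 n) su).1.
pose G n x := u x ^+ 2 + \sum_(k < n) (2 ^+ k.+1) `^ p * \1_(tail_set u (2 ^+ k)) x.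
have iS n : integrableR leb (fun x => \sum_(k < n) (2 ^+ k.+1) `^ p * \1_(tail_set u (2 ^+ k)) x).
  by apply: integrableR_sum => k; exact: integrableRZ.
have iG n : integrableR leb (G n) by apply: integrableRD => //; exact: sqint_sqr.
pose F n x := `|u x| `^ p * \1_(~` tail_set u (2 ^+ n)) x.
have F0 n x : 0 <= F n x by rewrite mulr_ge0// powR_ge0.
have FG n x : F n x <= G n x.
  rewrite /F indicE in_setC; have [xt|xt] := boolP (x \in _).
    rewrite mulr0; apply: addr_ge0; [exact: sqr_ge0|apply: sumr_ge0 => k _].
    by apply: mulr_ge0; rewrite ?powR_ge0.
  rewrite mulr1; apply: (le_trans (@dyadic_powR_le _ n _)).
    by rewrite leNgt; apply: contra xt => xt; rewrite inE.
  rewrite lerD2l le_eqVlt; apply/orP; left; apply/eqP; apply: eq_bigr => k _.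
  by congr (_ * _); rewrite indicE; congr (nat_of_bool _)%:R; apply/idP/idP; rewrite inE.
have iF n : integrableR leb (F n).
  apply: (integrableR_le _ _ (iG n)) => [|x]; last by rewrite ger0_norm.
  by apply: measurable_funM => //; apply: measurable_indic; exact: measurableC.
apply: (@Rint_monotone_bound _ _ _ leb F) => //.
- move=> x m n mn; rewrite /F ler_wpM2l ?powR_ge0// !indicE !in_setC.
  have [xn|xn] := boolP (x \in tail_set u (2 ^+ n)); last by rewrite mulr1n; case: (x \in _).
  have -> // : x \in tail_set u (2 ^+ m).
  move: xn; rewrite !inE /tail_set /=; apply: le_lt_trans.
  by rewrite ler_eXn2l// ltr1n.
- move=> x; apply: cvg_near_cst; near=> n.
  rewrite /F indicE in_setC (_ : _ \in _ = false) ?mulr1//.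
  apply/negbTE; rewrite notin_setE /tail_set /=; apply/negP; rewrite -leNgt.
  apply/ltW/(lt_le_trans (truncnS_gt _)).
  apply: (@le_trans _ _ (n%:R)); last by rewrite -natrX ler_nat ltnW// ltn_expl.
  rewrite ler_nat; near: n; exact: nbhs_infty_ge.
- move=> n; apply: le_trans (Rint_le (iF n) (iG n) (FG n)) _.
  rewrite RintD//; last exact: sqint_sqr.
  rewrite lerD// Rint_sum; last by move=> k; exact: integrableRZ.
  apply: (@le_trans _ _ (\sum_(k < n) 2 `^ p * A * z ^+ k)).
    apply: ler_sum => k _; rewrite RintZ// -/(tail u _).
    apply: le_trans (ler_wpM2l (powR_ge0 _ _) (tail_decay su uw w1 u1 (pow2 k))) _.
    rewrite -/A exprS powRM// mulrACA ler_wpM2l ?mulr_ge0 ?powR_ge0 ?(ltW A0)//.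
    rewrite -powRD; last by rewrite (gt_eqF (pow2 k)) implybT.
    by rewrite /z -!powR_mulrn ?powR_ge0// powRAC.
  by rewrite -mulr_sumr ler_wpM2l// ?geometric_le// mulr_ge0 ?powR_ge0 ?(ltW A0).
Unshelve. all: by end_near. Qed.

End sobolev_embedding.

(** * Growth of the nonlinearity *)

Section growth.
Context {R : realType}.
Variables (g : R -> R) (q : R).
Hypotheses (q1 : 1 < q) (cg : continuous g) (og : forall s, g (- s) = - g s)
  (g0 : g 0 = 0) (gl0 : g s / s @[s --> 0^'] --> (0 : R))
  (gloo : g s / `|s| `^ q @[s --> +oo] --> (0 : R)).
Implicit Types (a b s : R).

Lemma growth0 (e : R) : 0 < e -> exists2 d : R, 0 < d &
  forall s, `|s| < d -> `|g s| <= e * `|s|.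
Proof.
move=> e0.
have : \forall s \near (0 : R)^', `|g s / s| < e.
  by move/cvgr0_norm_lt : gl0; apply.
rewrite near_withinE => /nbhs_ballP[d /= d0 H].
exists d => // s sd; have [->|s0] := eqVneq s 0; first by rewrite g0 !normr0 mulr0.
have := H s; rewrite /ball /= sub0r normrN => /(_ sd s0).
by rewrite normrM normrV ?unitfE// ltr_pdivrMr ?normr_gt0// => /ltW.
Qed.

Lemma growth_oo (e : R) : 0 < e -> exists2 M : R, 0 < M &
  forall s, M < `|s| -> `|g s| <= e * `|s| `^ q.
Proof.
move=> e0.
have : \forall s \near +oo, `|g s / `|s| `^ q| < e.
  by move/cvgr0_norm_lt : gloo; apply.
move=> [M [_ H]]; exists (Num.max M 1); first by rewrite lt_max ltr01 orbT.
have key s : Num.max M 1 < s -> `|g s| <= e * `|s| `^ q.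
  rewrite gt_max => /andP[Ms s1].
  have s0 : 0 < `|s| by rewrite normr_gt0 gt_eqF// (lt_trans ltr01).
  have := H s Ms; rewrite /= normrM normrV ?unitfE ?gt_eqF ?powR_gt0//.
  by rewrite [ `|_ `^ q| ]ger0_norm ?powR_ge0// ltr_pdivrMr ?powR_gt0// => /ltW.
move=> s Ms; have [s0|s0] := leP 0 s; first by apply: key; rewrite -(ger0_norm s0).
have := key (- s); rewrite og !normrN; apply; by rewrite -(ltr0_norm s0).
Qed.

Lemma continuous_norm_bound (M : R) : exists2 B : R, 0 <= B &
  forall s, `|s| <= M -> `|g s| <= B.
Proof.
have [M0|M0] := ltP M 0.
  exists 0 => // s sM; have := le_lt_trans sM M0; by rewrite normr_lt0.
have [c _ cM] : exists2 c, c \in `[- M, M] &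
    forall t, t \in `[- M, M] -> `|g t| <= `|g c|.
  apply: (@EVT_max _ (fun t => `|g t|)); first by rewrite ge0_cp.
  by apply: continuous_subspaceT => t; apply: continuous_comp; [exact: cg|exact: norm_continuous].
by exists `|g c| => // s sM; apply: cM; rewrite in_itv /= -ler_norml.
Qed.

Lemma growth (e : R) : 0 < e -> exists2 C : R, 0 <= C &
  forall s, `|g s| <= e * `|s| + C * `|s| `^ q.
Proof.
move=> e0; have [d d0 gd] := growth0 e0; have [M M0 gM] := growth_oo ltr01.
have [B B0 gB] := continuous_norm_bound M.
(* The constant chosen next covers the two remaining regimes: [1] serves above [M], while on
   [d <= |s| <= M] the bound [B] is at most [B / d ^ q] times [|s| ^ q]. *)
have dq : 0 < d `^ q by rewrite powR_gt0.
exists (1 + B / d `^ q) => [|s]; first by rewrite addr_ge0// divr_ge0// ltW.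
have es : 0 <= e * `|s| by rewrite mulr_ge0// ltW.
have Bd : 0 <= B / d `^ q by rewrite divr_ge0// ltW.
have sq := powR_ge0 `|s| q.
have [sd|sd] := ltP `|s| d.
  by rewrite (le_trans (gd _ sd))// lerDl mulr_ge0// addr_ge0.
have [sM|sM] := ltP M `|s|.
  have := gM _ sM; have := mulr_ge0 Bd sq; lra.
have H : d `^ q <= `|s| `^ q by rewrite ge0_ler_powR ?nnegrE ?(ltW d0)// ltW// (lt_trans _ q1).
have := gB _ sM; have : B <= B / d `^ q * `|s| `^ q.
  by rewrite mulrAC ler_pdivlMr// ler_wpM2l.
nra.
Qed.

(** Only [a] is confined to the segment, while [a + b] may leave it; hence a covering argument in
    [a] uniform for [b] near [0]. *)
Lemma uniformly_continuous_segment (M e : R) : 0 < e -> exists2 d : R, 0 < d &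
  forall a b, `|a| <= M -> `|b| < d -> `|g (a + b) - g a| <= e.
Proof.
move=> e0.
have /compact_near_coveringP cM := @segment_compact R (- M) M.
have /nbhs_ballP[d /= d0 H] : \forall b \near (0 : R),
    `[- M, M]%classic `<=` [set a | `|g (a + b) - g a| <= e].
  apply: (cM R (nbhs (0 : R)) (fun b a => `|g (a + b) - g a| <= e)) => x _.
  have : g (z.1 + z.2) - g z.1 @[z --> (x, (0 : R))] --> g (x + 0) - g x.
    apply: cvgB.
      apply: (@cvg_comp _ _ _ (fun z : R * R => z.1 + z.2) g _ (nbhs (x + 0))); last exact: cg.
      by apply: cvgD; [exact: cvg_fst|exact: cvg_snd].
    by apply: (@cvg_comp _ _ _ (fun z : R * R => z.1) g _ (nbhs x)); [exact: cvg_fst|exact: cg].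
  rewrite addr0 subrr => /cvgr0_norm_le /(_ _ e0).
  by [].
exists d => // a b aM bd; apply: (H b); last by rewrite /= in_itv /= -ler_norml.
by rewrite /ball /= sub0r normrN.
Qed.

Lemma powR_le (x y : R) : 0 <= x -> x <= y -> x `^ q <= y `^ q.
Proof.
move=> x0 xy; apply: ge0_ler_powR => //.
- by rewrite ltW// (lt_trans _ q1).
- by rewrite nnegrE (le_trans x0).
Qed.

(** For small [a] and for large [a] both values of [g] are small separately. The divisors [3] and
    [2 ^ q + 1] account for [|a + b| <= 2 |a|]. In between uniform continuity applies:
    [|a| >= d / 2] turns the tolerance [e * (d / 2)] into [e |a|], and [h <= t / (2 M)] ensures
    [|b| < t]. *)
Lemma increment_small (e : R) : 0 < e -> exists2 h : R, 0 < h <= 1 / 2 &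
  forall a b, `|b| < h * `|a| -> `|g (a + b) - g a| <= e * (`|a| + `|a| `^ q).
Proof.
move=> e0.
have [d d0 gd] := growth0 (divr_gt0 e0 (ltr0n R 3)).
have p0 : 0 < 2 `^ q + 1 by rewrite addr_gt0 ?powR_gt0.
have [M M0 gM] := growth_oo (divr_gt0 e0 p0).
have [t t0 gt] := uniformly_continuous_segment (2 * M) (mulr_gt0 e0 (divr_gt0 d0 (ltr0n R 2))).
exists (Num.min (1 / 2) (t / (2 * M))).
  by rewrite lt_min ge_min lexx !divr_gt0 ?mulr_gt0.
move=> a b; set h := Num.min _ _ => bh.
have h12 : h <= 1 / 2 by rewrite ge_min lexx.
have ht : h <= t / (2 * M) by rewrite ge_min lexx orbT.
have a0 : 0 <= `|a| by []. have aq := powR_ge0 `|a| q.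
have bh2 : `|b| < `|a| / 2 by nra.
have ab1 : `|a + b| <= 2 * `|a| by have := ler_normD a b; lra.
have tri : `|g (a + b) - g a| <= `|g (a + b)| + `|g a| := ler_normB _ _.
have [ad|ad] := ltP `|a| (d / 2).
  have := gd (a + b); have := gd a => H1 H2.
  have /H1 H1' : `|a| < d by lra.
  have /H2 H2' : `|a + b| < d by lra.
  nra.
have [aM|aM] := ltP (2 * M) `|a|.
  have ab2 : M < `|a + b| by have := ler_normB (a + b) b; rewrite addrK; lra.
  have H2 := gM _ ab2; have H1 : `|g a| <= e / (2 `^ q + 1) * `|a| `^ q by apply: gM; lra.
  have H3 : `|a + b| `^ q <= 2 `^ q * `|a| `^ q by rewrite -powRM//; exact: powR_le.
  have H4 : e / (2 `^ q + 1) * (2 `^ q * `|a| `^ q) + e / (2 `^ q + 1) * `|a| `^ q = e * `|a| `^ q.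
    by field; rewrite gt_eqF.
  have H5 : e / (2 `^ q + 1) * `|a + b| `^ q <= e / (2 `^ q + 1) * (2 `^ q * `|a| `^ q).
    by rewrite ler_wpM2l// ltW// divr_gt0.
  have := mulr_ge0 (ltW e0) a0; lra.
have bt : `|b| < t.
  apply: lt_le_trans bh _; apply: le_trans (_ : t / (2 * M) * (2 * M) <= _).
    by apply: ler_pM => //; rewrite le_min !divr_ge0 ?mulr_ge0 ?ltW.
  by rewrite divfK// gt_eqF// mulr_gt0.
apply: le_trans (gt _ _ aM bt) _; have := mulr_ge0 (ltW e0) aq; nra.
Qed.

(** Either [b] is small relative to [a], which is the preceding case, or [|a|] and [|a + b|] are at
    most [m |b|] and the growth bound serves for both. The arbitrarily small coefficient of the part
    in [a] is what continuity of the operator [u |-> g(u)] amounts to here. *)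
Lemma increment (e : R) : 0 < e -> exists2 C : R, 0 <= C &
  forall a b, `|g (a + b) - g a| <= e * (`|a| + `|a| `^ q) + C * (`|b| + `|b| `^ q).
Proof.
move=> e0; have [h /andP[h0 h1] gh] := increment_small e0.
have [C1 C10 gC] := growth ltr01.
pose m := 1 + h^-1.
have hi0 : 0 < h^-1 by rewrite invr_gt0.
have m1 : 1 <= m by rewrite lerDl ltW.
have m0 : 0 <= m by rewrite (le_trans _ m1).
have mq := powR_ge0 m q.
have c0 : 0 <= 2 * (m + C1 * m `^ q) by rewrite mulr_ge0// addr_ge0// mulr_ge0.
exists (2 * (m + C1 * m `^ q)) => // a b.
have a0 : 0 <= `|a| by []. have aq := powR_ge0 `|a| q.
have b0 : 0 <= `|b| by []. have bq := powR_ge0 `|b| q.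
have ea : 0 <= e * (`|a| + `|a| `^ q) by apply: mulr_ge0; [exact: ltW|exact: addr_ge0].
have cb : 0 <= 2 * (m + C1 * m `^ q) * (`|b| + `|b| `^ q).
  by rewrite mulr_ge0// addr_ge0.
have [bh|bh] := ltP `|b| (h * `|a|).
  by apply: le_trans (gh _ _ bh) _; rewrite lerDl.
have am : `|a| <= h^-1 * `|b| by rewrite ler_pdivlMl.
have am' : `|a| <= m * `|b| by rewrite /m mulrDl mul1r; lra.
have abm : `|a + b| <= m * `|b| by have := ler_normD a b; rewrite /m mulrDl mul1r; lra.
have bnd c : `|c| <= m * `|b| -> `|g c| <= m * `|b| + C1 * (m `^ q * `|b| `^ q).
  move=> cm; apply: le_trans (gC c) _; rewrite mul1r lerD// ler_wpM2l//.
  by rewrite -powRM//; exact: powR_le.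
have := bnd _ am'; have := bnd _ abm.
have tri : `|g (a + b) - g a| <= `|g (a + b)| + `|g a| := ler_normB _ _.
have := mulr_ge0 m0 bq; have := mulr_ge0 (mulr_ge0 C10 mq) b0.
rewrite !mulrDr !mulrDl; nra.
Qed.

Local Notation G := (primitive g).

Lemma primitive_increment a b : exists2 c, `|c| <= `|b| & G (a + b) - G a = g (a + c) * b.
Proof.
have dG s : is_derive s 1 G (g s) by exact: is_derive_primitive.
have cG : continuous G by exact: is_derive1_continuous dG.
have [b0|b0] := leP 0 b.
  have [||c] := @MVT_segment _ G g a (a + b).
  - by rewrite lerDl.
  - exact: continuous_subspaceT.
  rewrite in_itv /= => /andP[ac cb] E; exists (c - a); last by rewrite subrKC E addrAC subrr add0r.
  by rewrite !ger0_norm ?subr_ge0// lerBlDl.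
have [||c] := @MVT_segment _ G g (a + b) a.
- by rewrite gerDl ltW.
- exact: continuous_subspaceT.
rewrite in_itv /= => /andP[ac cb] E; exists (c - a).
  by rewrite !ler0_norm ?subr_le0 ?(ltW b0)// lerN2 lerBrDl.
by rewrite subrKC -opprB E opprD addrA subrr sub0r mulrN opprK.
Qed.

(** By the mean value theorem the remainder is an increment of [g], over a length at most [|b|],
    multiplied by [b]. *)
Lemma primitive_remainder (e : R) : 0 < e -> exists2 C : R, 0 <= C &
  forall a b, `|G (a + b) - G a - g a * b| <=
    (e * (`|a| + `|a| `^ q) + C * (`|b| + `|b| `^ q)) * `|b|.
Proof.
move=> /increment[C C0 gC]; exists C => // a b.
have [c cb ->] := primitive_increment a b.
rewrite -mulrBl normrM ler_wpM2r//; apply: le_trans (gC a c) _.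
by rewrite lerD2l ler_wpM2l// lerD//; exact: powR_le.
Qed.

Lemma primitive_growth (e : R) : 0 < e -> exists2 C : R, 0 <= C &
  forall s, `|G s| <= e * s ^+ 2 + C * `|s| `^ (q + 1).
Proof.
move=> e0; have [C C0 gC] := growth e0; exists C => // s.
have G0 : G 0 = 0 by rewrite /primitive lexx set_itv1 Rintegral_set1.
have [c cs] := primitive_increment 0 s.
rewrite !add0r G0 subr0 => ->; rewrite normrM.
have -> : s ^+ 2 = `|s| * `|s| by rewrite -expr2 real_normK ?num_real.
have -> : `|s| `^ (q + 1) = `|s| `^ q * `|s|.
  rewrite powRD ?powRr1//; apply/implyP => /eqP q10.
  by have := lt_trans ltr01 q1; rewrite -[q](addrK 1) q10 sub0r oppr_gt0 ltr10.
rewrite !mulrA -mulrDl ler_wpM2r//; apply: le_trans (gC c) _.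
by apply: lerD; apply: ler_wpM2l => //; [exact: ltW|exact: powR_le].
Qed.

End growth.

(** * Continuity of functions with continuous partial derivatives *)

Section differentiable_continuous.
Context {R : realType} {N : nat}.
Local Notation E := ('rV[R]_N).
Implicit Types (x y : E) (V : E -> R).

(** The hypothesis speaks of partial derivatives only. Near [x] they are all bounded by [B];
    changing one coordinate at a time and using the mean value theorem on each segment gives the
    Lipschitz constant [N * B] at [x]. *)
Lemma continuously_differentiable_continuous V :
  continuously_differentiable V -> continuous V.
Proof.
move=> dV x.
have dVi i y : is_derive y (unit_rV i) V ('D_(unit_rV i) V y).
  by apply: derivableP; exact: (dV i).1.
pose B := 1 + \sum_(i < N) `|'D_(unit_rV i) V x|.
have Bx i : `|'D_(unit_rV i) V x| < B.
  by rewrite /B (bigD1 i)//= addrCA ltrDl ltr_pwDl// sumr_ge0.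
have B0 : 0 < B by rewrite ltr_pwDl// sumr_ge0.
have nearD (j : 'I_N) : \forall y \near x, `|'D_(unit_rV j) V y| < B.
  have := (dV j).2 x => /cvg_norm cD; exact: (cvgr_lt _ cD _ (Bx j)).
have /filter_forall/nbhs_ballP[r /= r0 rB] := nearD.
have key y : `|y - x| < r -> `|V y - V x| <= N%:R * (B * `|y - x|).
  move=> yx; pose z k : E := \row_j (if (j < k)%N then y ord0 j else x ord0 j).
  have zx k : `|z k - x| <= `|y - x|.
    rewrite [leLHS]mx_normrE; apply/bigmax_leP; split => // -[i j] _ /=.
    rewrite !mxE !ord1; case: ifP => _; last by rewrite subrr normr0.
    by have := rV_norm_coord (y - x) j; rewrite !mxE.
  have step k : (k <= N)%N -> `|V (z k) - V x| <= k%:R * (B * `|y - x|).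
    elim: k => [_|k IH kN].
      rewrite mul0r (_ : z 0%N = x) ?subrr ?normr0//.
      by apply/rowP => j; rewrite !mxE.
    pose i := Ordinal kN; pose h := y ord0 i - x ord0 i.
    have hyx : `|h| <= `|y - x| by have := rV_norm_coord (y - x) i; rewrite !mxE.
    have zS : z k.+1 = h *: unit_rV i + z k.
      apply/rowP => j; rewrite line_coord !mxE ltnS leq_eqVlt.
      have [->|ji] := eqVneq j i; first by rewrite eqxx /= ltnn mulr1 subrK.
      have -> : ((j : nat) == k) = false.
        by apply: contraNF ji => /eqP jk; apply/eqP/val_inj.
      by rewrite /= mulr0 add0r.
    have [t th Et] := @partial_MVT _ _ V (unit_rV i) (z k) _ h (dVi i).
    have tB : `|'D_(unit_rV i) V (t *: unit_rV i + z k)| < B.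
      apply: rB; rewrite -ball_normE /= distrC; apply: le_lt_trans yx.
      rewrite [leLHS]mx_normrE; apply/bigmax_leP; split => // -[m j] _ /=.
      rewrite !ord1 mxE line_coord !mxE.
      have [->|ji] := eqVneq j i.
        by rewrite ltnn mulr1 addrK (le_trans th).
      rewrite mulr0 add0r; case: ifP => _; last by rewrite subrr normr0.
      by have := rV_norm_coord (y - x) j; rewrite !mxE.
    have := IH (ltnW kN).
    have -> : V (z k.+1) - V x = (V (z k) - V x) + 'D_(unit_rV i) V (t *: unit_rV i + z k) * h.
      by rewrite -Et -zS [RHS]addrC addrA subrK.
    move=> IHk; apply: le_trans (ler_normD _ _) _.
    rewrite -natr1 mulrDl mul1r lerD// normrM ler_pM//; exact: ltW.
  have -> : y = z N by apply/rowP => j; rewrite !mxE ltn_ord.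
  have := step N (leqnn _); rewrite (_ : z N = y)//.
  by apply/rowP => j; rewrite !mxE ltn_ord.
have c0 : 0 < N%:R * B + 1 by rewrite ltr_wpDl// mulr_ge0// ltW.
suff : V y @[y --> x] --> V x by [].
apply/(@cvgrPdist_le R R E (nbhs x)) => e e0; near=> y.
rewrite distrC; apply: le_trans (key y _) _.
  rewrite distrC; near: y; apply/nbhs_ballP; exists r => // y.
  by rewrite -ball_normE.
have yd : `|x - y| < e / (N%:R * B + 1).
  near: y; apply/nbhs_ballP; exists (e / (N%:R * B + 1)) => [|y]; first by rewrite /= divr_gt0.
  by rewrite -ball_normE.
move: (ltW yd); rewrite ler_pdivlMr// (distrC x y) mulrDr mulr1.
rewrite mulrA [`|y - x| * _]mulrC => H; apply: le_trans H; by rewrite lerDl.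
Unshelve. all: by end_near. Qed.

End differentiable_continuous.

(** * The embedding in terms of the norm of H1 *)

Section H1_bounds.
Context {R : realType} {N : nat}.
Local Notation E := ('rV[R]_N).
Local Notation leb := (@lebesgue_rV R N).
Implicit Types (x y : E) (u v : E -> R).
Hypothesis N0 : (0 < N)%N.
Local Notation p := (2 + 4 / N%:R : R).
Local Notation K := (@sobolev_constant R N).

Lemma H1_norm_ge0 u : 0 <= H1_norm u. Proof. exact: sqrtr_ge0. Qed.

Lemma H1_norm_le u (t : R) : H1 u -> 0 <= t -> H1_norm u <= t ->
  \int[leb]_x (u x ^+ 2) <= t ^+ 2 /\
  \int[leb]_x dot (wgrad u x) (wgrad u x) <= t ^+ 2.
Proof.
move=> Hu t0; rewrite /H1_norm => ut.
have i1 := integrable_dot_wgrad Hu Hu; have i2 := sqint_sqr (H1_sqint Hu).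
have I1 : 0 <= \int[leb]_x dot (wgrad u x) (wgrad u x) by apply: Rint_ge0 => x; exact: dot_ge0.
have I2 : 0 <= \int[leb]_x (u x ^+ 2) by apply: Rint_ge0 => x; exact: sqr_ge0.
have : \int[leb]_x (dot (wgrad u x) (wgrad u x) + u x ^+ 2) <= t ^+ 2.
  rewrite -ler_sqrt ?exprn_even_ge0// sqrtr_sqr ger0_norm//.
by rewrite RintD//; lra.
Qed.

Lemma weak_gradientZ (c : R) u : H1 u ->
  is_weak_gradient (fun x => c * u x) (fun x => c *: wgrad u x).
Proof.
move=> Hu.
have := weak_gradient_lin c (H1_sqint Hu) (H1_sqint H1_0) (H1_wgrad Hu) weak_gradient0.
by congr is_weak_gradient; apply/funext => x; rewrite addr0.
Qed.

(** Dividing by a positive [t] above the norm, rather than by the norm, normalises [u] even when its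
    norm is zero. *)
Lemma sobolev u (t : R) : H1 u -> 0 < t -> H1_norm u <= t ->
  integrableR leb (fun x => `|u x| `^ p) /\
  \int[leb]_x (`|u x| `^ p) <= K * t `^ p.
Proof.
move=> Hu t0 ut; have [u2 w2] := H1_norm_le Hu (ltW t0) ut.
pose v x := t^-1 * u x.
have [||||iv vK] := @sobolev_normalized R N N0 v (fun x => t^-1 *: wgrad u x).
- by apply: sqintZ; exact: H1_sqint.
- exact: weak_gradientZ.
- move=> i; under eq_Rintegral do rewrite mxE exprMn.
  rewrite RintZ; last by apply: sqint_sqr; exact: wgrad_sqint.
  rewrite exprVn ler_pdivrMl ?exprn_gt0// mulr1; apply: le_trans w2.
  apply: Rint_le; [by apply: sqint_sqr; exact: wgrad_sqint|exact: integrable_dot_wgrad|].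
  move=> x; rewrite /dot (bigD1 i)//= expr2 lerDl sumr_ge0// => j _.
  by rewrite -expr2 sqr_ge0.
- rewrite /v; under eq_Rintegral do rewrite exprMn.
  rewrite RintZ; last exact: sqint_sqr (H1_sqint Hu).
  by rewrite exprVn ler_pdivrMl ?exprn_gt0// mulr1.
have uE x : `|u x| `^ p = t `^ p * `|v x| `^ p.
  rewrite -powRM ?(ltW t0)//; congr (_ `^ _).
  by rewrite /v normrM gtr0_norm ?invr_gt0// mulVKf// gt_eqF.
rewrite (_ : (fun x => `|u x| `^ p) = fun x => t `^ p * `|v x| `^ p); last by apply/funext.
split; first exact: integrableRZ.
by rewrite RintZ// mulrC ler_wpM2r// powR_ge0.
Qed.

Lemma integrable_powR u : H1 u -> integrableR leb (fun x => `|u x| `^ p).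
Proof.
move=> Hu; apply: (@sobolev u (H1_norm u + 1) Hu _ _).1; last by rewrite lerDl.
by rewrite ltr_wpDl// H1_norm_ge0.
Qed.

End H1_bounds.

Section limit_bounds.
Context {R : realType}.

(** Passes from bounds valid for every positive [t >= n] to [n] itself. For [n = 0] a positive [X]
    would violate the bound at some [t <= X / (2 (|c| + 1))]. *)
Lemma le_linear (X c n d : R) : 0 <= n -> n < d ->
  (forall t, 0 < t -> n <= t -> t < d -> X <= c * t) -> X <= c * n.
Proof.
rewrite le_eqVlt => /predU1P[<- d0 H|n0 nd H]; last exact: H.
rewrite mulr0 leNgt; apply/negP => X0.
pose t := Num.min (d / 2) (X / (2 * (`|c| + 1))).
have c1 : 0 < `|c| + 1 by rewrite ltr_wpDl.
have t0 : 0 < t by rewrite lt_min !divr_gt0 ?mulr_gt0.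
have td : t < d by rewrite gt_min ltr_pdivrMr// mulrC ltr_pMl// ltr1n.
have := H t t0 (ltW t0) td.
have tX : t <= X / (2 * (`|c| + 1)) by rewrite ge_min lexx orbT.
have : (`|c| + 1) * t <= X / 2.
  rewrite mulrC -ler_pdivlMr//; apply: le_trans tX _.
  by rewrite invfM mulrA.
have := ler_norm c; nra.
Qed.

End limit_bounds.

(** * The energy functional *)

Section energy_derivative.
Context {R : realType} {N : nat}.
Local Notation E := ('rV[R]_N).
Local Notation leb := (@lebesgue_rV R N).
Implicit Types (x y : E) (u v : E -> R).
Local Notation p := (2 + 4 / N%:R : R).
Local Notation q := (1 + 4 / N%:R : R).
Local Notation K := (@sobolev_constant R N).
Variables (g : R -> R) (V : E -> R) (B : R).
Local Notation G := (primitive g).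
Hypotheses (N0 : (0 < N)%N) (cg : continuous g) (og : forall s, g (- s) = - g s)
  (g0 : g 0 = 0) (gl0 : g s / s @[s --> 0^'] --> (0 : R))
  (gloo : g s / `|s| `^ q @[s --> +oo] --> (0 : R))
  (mV : measurable_fun setT V) (VB : forall x, `|V x| <= B).

Let q1 : 1 < q. Proof. by rewrite ltrDl divr_gt0// ltr0n. Qed.
Let q1p : q + 1 = p. Proof. by rewrite addrAC. Qed.
Let B0 : 0 <= B. Proof. by apply: le_trans (VB 0). Qed.
Let mg : measurable_fun setT g. Proof. exact: continuous_measurable_fun. Qed.

Let cG : continuous G.
Proof. by apply: is_derive1_continuous => s; exact: is_derive_primitive. Qed.

Lemma powRS (s : R) : 0 <= s -> s `^ p = s `^ q * s.
Proof.
move=> s0; rewrite -q1p powRD ?powRr1//; apply/implyP => /eqP q10.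
by have := lt_trans ltr01 q1; rewrite -[q](addrK 1) q10 sub0r oppr_gt0 ltr10.
Qed.

(** With [c = b / t], the product [a ^ q * c] is at most the larger of [a ^ p] and [c ^ p]. When the
    [L^p] integral of [b] is of order [t ^ p], integration gives a bound linear in [t], as Hölder's
    inequality would. *)
Lemma powR_mul_le (a b t : R) : 0 <= a -> 0 <= b -> 0 < t ->
  a `^ q * b <= t * (a `^ p + (t `^ p)^-1 * b `^ p).
Proof.
move=> a0 b0 t0; pose c := t^-1 * b.
have c0 : 0 <= c by rewrite mulr_ge0// invr_ge0 ltW.
have bE : b = t * c by rewrite /c mulVKf// gt_eqF.
have -> : (t `^ p)^-1 * b `^ p = c `^ p.
  by rewrite bE powRM// ?(ltW t0)// mulKf// gt_eqF// powR_gt0.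
rewrite {1}bE mulrCA ler_pM2l//.
have ap := powR_ge0 a p; have cp := powR_ge0 c p.
have [ca|ac] := leP c a.
  rewrite (powRS a0); apply: le_trans (_ : a `^ q * a <= _); last by rewrite lerDl.
  by rewrite ler_wpM2l ?powR_ge0.
rewrite (powRS c0); apply: le_trans (_ : c `^ q * c <= _); last by rewrite lerDr.
rewrite ler_wpM2r//; apply: (powR_le q1) => //; exact: ltW.
Qed.

Lemma mul_le_sqr (a b t : R) : 0 < t -> `|a * b| <= t * (a ^+ 2 + (t ^+ 2)^-1 * b ^+ 2).
Proof.
move=> t0; pose c := t^-1 * b.
have bE : b = t * c by rewrite /c mulVKf// gt_eqF.
have -> : (t ^+ 2)^-1 * b ^+ 2 = c ^+ 2 by rewrite /c exprMn exprVn.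
rewrite bE mulrCA normrM gtr0_norm// ler_pM2l//.
have := sqr_ge0 (a - c); have := sqr_ge0 (a + c); rewrite ler_norml => ? ?.
by apply/andP; split; nra.
Qed.

Lemma integrable_qmul u v : H1 u -> H1 v ->
  integrableR leb (fun x => `|u x| `^ q * `|v x|).
Proof.
move=> Hu Hv; have mu := H1_meas Hu; have mv := H1_meas Hv.
apply: (@integrableR_le _ _ _ _ _ (fun x => 1 * (`|u x| `^ p + (1 `^ p)^-1 * `|v x| `^ p))).
- apply: measurable_funM; last exact: measurableT_comp.
  by apply: (measurableT_comp (measurable_powR q)); exact: measurableT_comp.
- by move=> x; rewrite ger0_norm ?mulr_ge0 ?powR_ge0//; exact: powR_mul_le.
- apply: integrableRZ; apply: integrableRD; first exact: integrable_powR.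
  by apply: integrableRZ; exact: integrable_powR.
Qed.

Lemma Rint_qmul u v (t : R) : H1 u -> H1 v -> 0 < t -> H1_norm v <= t ->
  \int[leb]_x (`|u x| `^ q * `|v x|) <= t * (\int[leb]_x (`|u x| `^ p) + K).
Proof.
move=> Hu Hv t0 vt; have [ip pK] := sobolev N0 Hv t0 vt; have iu := integrable_powR N0 Hu.
have tp : 0 < t `^ p by rewrite powR_gt0.
have iv : integrableR leb (fun x => (t `^ p)^-1 * `|v x| `^ p) by exact: integrableRZ.
apply: (@le_trans _ _ (\int[leb]_x (t * (`|u x| `^ p + (t `^ p)^-1 * `|v x| `^ p)))).
  apply: Rint_le; [exact: integrable_qmul|by apply: integrableRZ; exact: integrableRD|].
  by move=> x; exact: powR_mul_le.
rewrite RintZ; last exact: integrableRD.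
rewrite RintD// RintZ// ler_pM2l// lerD2l ler_pdivrMl// [_ * K]mulrC.
exact: pK.
Qed.

Lemma Rint_mul u v (t : R) : H1 u -> H1 v -> 0 < t -> H1_norm v <= t ->
  \int[leb]_x `|u x * v x| <= t * (\int[leb]_x (u x ^+ 2) + 1).
Proof.
move=> Hu Hv t0 vt; have [v2 _] := H1_norm_le Hv (ltW t0) vt.
have iu := sqint_sqr (H1_sqint Hu); have iv := sqint_sqr (H1_sqint Hv).
have iv' : integrableR leb (fun x => (t ^+ 2)^-1 * v x ^+ 2) by exact: integrableRZ.
apply: (@le_trans _ _ (\int[leb]_x (t * (u x ^+ 2 + (t ^+ 2)^-1 * v x ^+ 2)))).
  apply: Rint_le.
  - by apply: integrableR_norm; apply: sqint_mul; exact: H1_sqint.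
  - by apply: integrableRZ; exact: integrableRD.
  - by move=> x; exact: mul_le_sqr.
rewrite RintZ; last exact: integrableRD.
by rewrite RintD// RintZ// ler_pM2l// lerD2l ler_pdivrMl ?exprn_gt0// mulr1.
Qed.

Lemma Rint_dot u v (t : R) : H1 u -> H1 v -> 0 < t -> H1_norm v <= t ->
  `|\int[leb]_x dot (wgrad u x) (wgrad v x)| <=
  t * (\int[leb]_x dot (wgrad u x) (wgrad u x) + 1).
Proof.
move=> Hu Hv t0 vt; have [_ v2] := H1_norm_le Hv (ltW t0) vt.
have iu := integrable_dot_wgrad Hu Hu; have iv := integrable_dot_wgrad Hv Hv.
have iv' : integrableR leb (fun x => (t ^+ 2)^-1 * dot (wgrad v x) (wgrad v x)).
  exact: integrableRZ.
apply: (@le_trans _ _ (\int[leb]_x (t * (dot (wgrad u x) (wgrad u x) +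
    (t ^+ 2)^-1 * dot (wgrad v x) (wgrad v x))))).
  apply: Rint_norm_le.
  - exact: integrableR_meas (integrable_dot_wgrad Hu Hv).
  - move=> x; rewrite /dot mulr_sumr -big_split /= mulr_sumr.
    apply: le_trans (ler_norm_sum _ _ _) _; apply: ler_sum => i _.
    by rewrite -!expr2; exact: mul_le_sqr.
  - by apply: integrableRZ; exact: integrableRD.
rewrite RintZ; last exact: integrableRD.
by rewrite RintD// RintZ// ler_pM2l// lerD2l ler_pdivrMl ?exprn_gt0// mulr1.
Qed.

Lemma measurable_primitive u : H1 u -> measurable_fun setT (fun x => G (u x)).
Proof.
move=> Hu; apply: (measurableT_comp _ (H1_meas Hu)).
exact: continuous_measurable_fun.
Qed.

Lemma integrable_primitive u : H1 u -> integrableR leb (fun x => G (u x)).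
Proof.
move=> Hu; have [C C0 GC] := primitive_growth q1 cg og g0 gl0 gloo ltr01.
apply: (integrableR_le (measurable_primitive Hu) (fun x => GC (u x))).
rewrite q1p; apply: integrableRD; apply: integrableRZ.
  exact: sqint_sqr (H1_sqint Hu).
exact: integrable_powR.
Qed.

Lemma integrable_Vmul u v : H1 u -> H1 v -> integrableR leb (fun x => V x * (u x * v x)).
Proof.
move=> Hu Hv; have iuv := sqint_mul (H1_sqint Hu) (H1_sqint Hv).
apply: (integrableR_le _ _ (integrableRZ B (integrableR_norm iuv))).
  by apply: measurable_funM => //; exact: integrableR_meas iuv.
by move=> x; rewrite normrM ler_wpM2r.
Qed.

Lemma integrable_gmul u v : H1 u -> H1 v -> integrableR leb (fun x => g (u x) * v x).
Proof.
move=> Hu Hv; have [C C0 gC] := growth q1 cg og g0 gl0 gloo ltr01.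
have mgu : measurable_fun setT (fun x => g (u x)) := measurableT_comp mg (H1_meas Hu).
apply: (@integrableR_le _ _ _ _ _ (fun x => `|u x * v x| + C * (`|u x| `^ q * `|v x|))).
- by apply: measurable_funM => //; exact: H1_meas.
- move=> x; rewrite !normrM mulrA -mulrDl ler_wpM2r//.
  by have := gC (u x); rewrite mul1r.
- apply: integrableRD.
    by apply: integrableR_norm; apply: sqint_mul; exact: H1_sqint.
  by apply: integrableRZ; exact: integrable_qmul.
Qed.

Definition energy_diff u v : R :=
  \int[leb]_x dot (wgrad u x) (wgrad v x) + \int[leb]_x (V x * (u x * v x)) -
  \int[leb]_x (g (u x) * v x).

Lemma energy_diff_lin u (c : R) v w : H1 u -> H1 v -> H1 w ->
  energy_diff u (fun x => c * v x + w x) = c * energy_diff u v + energy_diff u w.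
Proof.
move=> Hu Hv Hw; have Hcvw := H1_lin c Hv Hw; rewrite /energy_diff.
have -> : \int[leb]_x dot (wgrad u x) (wgrad (fun x => c * v x + w x) x) =
    c * \int[leb]_x dot (wgrad u x) (wgrad v x) + \int[leb]_x dot (wgrad u x) (wgrad w x).
  have i1 := integrable_dot_wgrad Hu Hv; have i2 := integrable_dot_wgrad Hu Hw.
  rewrite -RintZ// -RintD//; last exact: integrableRZ.
  apply: Rint_ae.
  - exact: integrableR_meas (integrable_dot_wgrad Hu Hcvw).
  - exact: (integrableR_meas (integrableRD (integrableRZ c i1) i2)).
  - by apply: filterS (wgrad_lin c Hv Hw) => x ->; rewrite dotDr dotZr.
have -> : \int[leb]_x (V x * (u x * (c * v x + w x))) =
    c * \int[leb]_x (V x * (u x * v x)) + \int[leb]_x (V x * (u x * w x)).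
  have i1 := integrable_Vmul Hu Hv; have i2 := integrable_Vmul Hu Hw.
  rewrite -RintZ// -RintD//; last exact: integrableRZ.
  by apply: eq_Rintegral => x _; ring.
have -> : \int[leb]_x (g (u x) * (c * v x + w x)) =
    c * \int[leb]_x (g (u x) * v x) + \int[leb]_x (g (u x) * w x).
  have i1 := integrable_gmul Hu Hv; have i2 := integrable_gmul Hu Hw.
  rewrite -RintZ// -RintD//; last exact: integrableRZ.
  by apply: eq_Rintegral => x _; ring.
have alg (k a1 a2 b1 b2 d1 d2 : R) :
    k * a1 + a2 + (k * b1 + b2) - (k * d1 + d2) = k * (a1 + b1 - d1) + (a2 + b2 - d2) by ring.
exact: alg.
Qed.

Lemma energy_diff_bounded u : H1 u -> exists C : R, forall v, H1 v ->
  `|energy_diff u v| <= C * H1_norm v.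
Proof.
move=> Hu; have [C C0 gC] := growth q1 cg og g0 gl0 gloo ltr01.
pose A1 := \int[leb]_x dot (wgrad u x) (wgrad u x) + 1.
pose A2 := \int[leb]_x (u x ^+ 2) + 1.
pose A3 := \int[leb]_x (`|u x| `^ p) + K.
exists (A1 + B * A2 + (A2 + C * A3)) => v Hv.
apply: (@le_linear _ _ _ _ (H1_norm v + 1)); [exact: H1_norm_ge0|by rewrite ltrDl|].
move=> t t0 vt _.
have iuv : integrableR leb (fun x => `|u x * v x|).
  by apply: integrableR_norm; apply: sqint_mul; exact: H1_sqint.
have H1' := Rint_dot Hu Hv t0 vt; have H2' := Rint_mul Hu Hv t0 vt.
have H3' := Rint_qmul Hu Hv t0 vt; have iq := integrable_qmul Hu Hv.
have HV : `|\int[leb]_x (V x * (u x * v x))| <= B * (t * A2).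
  apply: le_trans (ler_wpM2l B0 H2'); rewrite -RintZ//.
  apply: Rint_norm_le; [exact: integrableR_meas (integrable_Vmul Hu Hv)| |exact: integrableRZ].
  by move=> x; rewrite normrM ler_wpM2r.
have Hg : `|\int[leb]_x (g (u x) * v x)| <= t * A2 + C * (t * A3).
  apply: le_trans (lerD H2' (ler_wpM2l C0 H3')); rewrite -RintZ// -RintD//; last exact: integrableRZ.
  apply: Rint_norm_le; [exact: integrableR_meas (integrable_gmul Hu Hv)| |].
    move=> x; rewrite !normrM mulrA -mulrDl ler_wpM2r//.
    by have := gC (u x); rewrite mul1r.
  by apply: integrableRD => //; exact: integrableRZ.
rewrite /energy_diff; apply: le_trans (ler_normB _ _) _.
apply: le_trans (lerD (ler_normD _ _) (lexx _)) _.
apply: le_trans (lerD (lerD H1' HV) Hg) _.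
have alg (a1 a2 a3 : R) : t * a1 + B * (t * a2) + (t * a2 + C * (t * a3)) =
  (a1 + B * a2 + (a2 + C * a3)) * t by ring.
by rewrite alg.
Qed.

End energy_derivative.

Section energy_frechet.
Context {R : realType} {N : nat}.
Local Notation E := ('rV[R]_N).
Local Notation leb := (@lebesgue_rV R N).
Implicit Types (x y : E) (u v : E -> R).
Local Notation p := (2 + 4 / N%:R : R).
Local Notation q := (1 + 4 / N%:R : R).
Local Notation K := (@sobolev_constant R N).
Variables (g : R -> R) (V : E -> R) (B : R).
Local Notation G := (primitive g).
Hypotheses (N0 : (0 < N)%N) (cg : continuous g) (og : forall s, g (- s) = - g s)
  (g0 : g 0 = 0) (gl0 : g s / s @[s --> 0^'] --> (0 : R))
  (gloo : g s / `|s| `^ q @[s --> +oo] --> (0 : R))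
  (mV : measurable_fun setT V) (VB : forall x, `|V x| <= B).

Let q1 : 1 < q. Proof. by rewrite ltrDl divr_gt0// ltr0n. Qed.
Let q1p : q + 1 = p. Proof. by rewrite addrAC. Qed.
Let B0 : 0 <= B. Proof. by apply: le_trans (VB 0). Qed.
Let mg : measurable_fun setT g. Proof. exact: continuous_measurable_fun. Qed.

Let iG u : H1 u -> integrableR leb (fun x => G (u x)).
Proof. exact: integrable_primitive N0 cg og g0 gl0 gloo _. Qed.
Let igm u v : H1 u -> H1 v -> integrableR leb (fun x => g (u x) * v x).
Proof. exact: integrable_gmul N0 cg og g0 gl0 gloo _ _. Qed.
Let iVm u v : H1 u -> H1 v -> integrableR leb (fun x => V x * (u x * v x)).
Proof. exact: integrable_Vmul mV VB _ _. Qed.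

Lemma Rint_dotD u v : H1 u -> H1 v ->
  \int[leb]_x dot (wgrad (fun x => u x + v x) x) (wgrad (fun x => u x + v x) x) =
  \int[leb]_x dot (wgrad u x) (wgrad u x) + 2 * \int[leb]_x dot (wgrad u x) (wgrad v x) +
  \int[leb]_x dot (wgrad v x) (wgrad v x).
Proof.
move=> Hu Hv; have Huv := H1D Hu Hv.
have i1 := integrable_dot_wgrad Hu Hu; have i2 := integrable_dot_wgrad Hu Hv.
have i3 := integrable_dot_wgrad Hv Hv.
have i12 := integrableRD i1 (integrableRZ 2 i2).
rewrite -RintZ// -RintD//; last exact: integrableRZ.
rewrite -RintD//; apply: Rint_ae.
- exact: integrableR_meas (integrable_dot_wgrad Huv Huv).
- exact: integrableR_meas (integrableRD i12 i3).
- have -> : (fun x => u x + v x) = fun x => 1 * u x + v x by apply/funext => x; rewrite mul1r.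
  apply: filterS (wgrad_lin 1 Hu Hv) => x ->.
  by rewrite scale1r dotDr !dotDl (dotC (wgrad v x)); ring.
Qed.

(** The quadratic terms of the energy expand exactly, so that only the primitive leaves a remainder
    to be made small. *)
Lemma energyD u v : H1 u -> H1 v ->
  energy g V (fun x => u x + v x) - energy g V u - energy_diff g V u v =
  2^-1 * \int[leb]_x dot (wgrad v x) (wgrad v x) + 2^-1 * \int[leb]_x (V x * v x ^+ 2) -
  \int[leb]_x (G (u x + v x) - G (u x) - g (u x) * v x).
Proof.
move=> Hu Hv; have Huv := H1D Hu Hv.
rewrite /energy /energy_diff Rint_dotD//.
have iG1 := iG Huv; have iG2 := iG Hu; have ig := igm Hu Hv.
have iG12 := integrableRB iG1 iG2.
rewrite [in RHS]RintB// [in RHS]RintB//.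
have -> : \int[leb]_x (V x * (u x + v x) ^+ 2) = \int[leb]_x (V x * u x ^+ 2) +
    2 * \int[leb]_x (V x * (u x * v x)) + \int[leb]_x (V x * v x ^+ 2).
  have i1 : integrableR leb (fun x => V x * u x ^+ 2) by exact: iVm.
  have i3 : integrableR leb (fun x => V x * v x ^+ 2) by exact: iVm.
  have i2 := iVm Hu Hv; have i12 := integrableRD i1 (integrableRZ 2 i2).
  rewrite -RintZ// -RintD//; last exact: integrableRZ.
  by rewrite -RintD//; apply: eq_Rintegral => x _; ring.
have alg (a1 a2 a3 b1 b2 b3 c1 c2 c3 : R) :
  2^-1 * (a1 + 2 * a2 + a3) + 2^-1 * (b1 + 2 * b2 + b3) - c1 -
  (2^-1 * a1 + 2^-1 * b1 - c2) - (a2 + b2 - c3) = 2^-1 * a3 + 2^-1 * b3 - (c1 - c2 - c3).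
  by lra.
exact: alg.
Qed.

(** Half of [e * t] absorbs the part of the remainder that involves [u]; all the rest is at most
    [D * t ^ 2], which is below the other half once [t < e / (2 D)]. *)
Lemma energy_remainder u (e : R) : H1 u -> 0 < e -> exists2 d : R, 0 < d &
  forall v t, H1 v -> 0 < t -> H1_norm v <= t -> t < d ->
    `|energy g V (fun x => u x + v x) - energy g V u - energy_diff g V u v| <= e * t.
Proof.
move=> Hu e0.
pose A := \int[leb]_x (u x ^+ 2) + 1 + (\int[leb]_x (`|u x| `^ p) + K).
have K0 : 0 <= K by exact: sobolev_constant_ge0.
have A0 : 0 < A.
  have h1 : 0 <= \int[leb]_x (u x ^+ 2) by apply: Rint_ge0 => x; exact: sqr_ge0.
  have h2 : 0 <= \int[leb]_x (`|u x| `^ p) by apply: Rint_ge0 => x; exact: powR_ge0.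
  by apply: ltr_wpDr; [exact: addr_ge0|exact: ltr_wpDl].
(* The tolerance is fixed by [A], which collects the integrals of [u] multiplying [t], so that this
   part of the remainder is exactly [e / 2 * t]. *)
have [C C0 GC] := primitive_remainder q1 cg og g0 gl0 gloo (divr_gt0 e0 (mulr_gt0 (ltr0n R 2) A0)).
pose D := 1 + B + C * (1 + K).
have D0 : 0 < D by rewrite /D -addrA ltr_pwDl// addr_ge0// mulr_ge0// addr_ge0.
exists (Num.min 1 (e / (2 * D))); first by rewrite lt_min ltr01 divr_gt0// mulr_gt0.
move=> v t Hv t0 vt; rewrite lt_min => /andP[t1 tD].
rewrite energyD//.
have [v2 w2] := H1_norm_le Hv (ltW t0) vt.
have [ivp vp] := sobolev N0 Hv t0 vt.
have w0 : 0 <= \int[leb]_x dot (wgrad v x) (wgrad v x) by apply: Rint_ge0 => x; exact: dot_ge0.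
have iv2 := sqint_sqr (H1_sqint Hv).
have bV : `|\int[leb]_x (V x * v x ^+ 2)| <= B * t ^+ 2.
  apply: le_trans (ler_wpM2l B0 v2); rewrite -RintZ//.
  apply: Rint_norm_le; [exact: integrableR_meas (iVm Hv Hv)| |exact: integrableRZ].
  by move=> x; rewrite normrM [ `|_ ^+ 2| ]ger0_norm ?sqr_ge0// ler_wpM2r ?sqr_ge0.
(* The bound [t <= 1] makes the contribution of [|v|^p] quadratic in [t] as well. *)
have tp : t `^ p <= t ^+ 2.
  rewrite -powR_mulrn ?(ltW t0)// powRD; last by rewrite (gt_eqF t0) implybT.
  rewrite ler_piMr ?powR_ge0// -[leRHS](congr1 (@^~ (4 / N%:R)) (@powR1 R)).
  by apply: ge0_ler_powR; rewrite ?nnegrE ?(ltW t0) ?(ltW t1)// divr_ge0.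
set eps := e / (2 * A).
have eps0 : 0 < eps by rewrite divr_gt0// mulr_gt0.
have iuv : integrableR leb (fun x => `|u x * v x|).
  by apply: integrableR_norm; apply: sqint_mul; exact: H1_sqint.
have iq := integrable_qmul N0 Hu Hv.
have bG : `|\int[leb]_x (G (u x + v x) - G (u x) - g (u x) * v x)| <=
    eps * (t * A) + C * (t ^+ 2 + K * t ^+ 2).
  have i1 : integrableR leb (fun x => eps * (`|u x * v x| + `|u x| `^ q * `|v x|)).
    by apply: integrableRZ; exact: integrableRD.
  have i2 : integrableR leb (fun x => C * (v x ^+ 2 + `|v x| `^ p)).
    by apply: integrableRZ; exact: integrableRD.
  apply: (@le_trans _ _ (\int[leb]_x (eps * (`|u x * v x| + `|u x| `^ q * `|v x|) +
      C * (v x ^+ 2 + `|v x| `^ p)))).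
    apply: Rint_norm_le; last exact: integrableRD.
      exact: integrableR_meas (integrableRB (integrableRB (iG (H1D Hu Hv)) (iG Hu)) (igm Hu Hv)).
    move=> x; apply: le_trans (GC _ _) _; rewrite le_eqVlt; apply/orP; left; apply/eqP.
    have -> : v x ^+ 2 = `|v x| * `|v x| by rewrite -expr2 real_normK ?num_real.
    rewrite (powRS N0)// normrM -/eps; ring.
  rewrite RintD// RintZ; last exact: integrableRD.
  rewrite RintZ; last exact: integrableRD.
  rewrite RintD// [X in _ + C * X <= _]RintD//.
  have H2' := Rint_mul Hu Hv t0 vt; have H3' := Rint_qmul N0 Hu Hv t0 vt.
  apply: lerD; first by rewrite ler_pM2l//; rewrite /A mulrDr lerD.
  rewrite ler_wpM2l// lerD//; apply: le_trans vp _; exact: ler_wpM2l.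
have epsA : eps * (t * A) = e / 2 * t by rewrite /eps; field; rewrite gt_eqF.
have tDe : D * t ^+ 2 <= e / 2 * t.
  rewrite expr2 mulrA ler_pM2r//; move: (ltW tD); rewrite ler_pdivlMr ?mulr_gt0//; lra.
rewrite epsA in bG.
apply: le_trans (ler_normB _ _) _.
apply: le_trans (lerD (ler_normD _ _) (lexx _)) _.
rewrite !normrM (ger0_norm w0) ger0_norm//.
have alg (a X Y Z : R) : 0 <= X -> X <= a -> Y <= B * a -> Z <= e / 2 * t + C * (a + K * a) ->
    (1 + B + C * (1 + K)) * a <= e / 2 * t -> 0 <= B * a -> 2^-1 * X + 2^-1 * Y + Z <= e * t.
  by move: (K) => k *; nra.
apply: (alg (t ^+ 2) _ _ _ w0 w2 bV bG tDe); by rewrite mulr_ge0 ?sqr_ge0.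
Qed.

Lemma energy_frechet u : H1 u ->
  is_frechet_derivative (energy g V) u (energy_diff g V u).
Proof.
move=> Hu; split.
- move=> c v w Hv Hw; exact: (energy_diff_lin N0 cg og g0 gl0 gloo mV VB).
- exact: (energy_diff_bounded N0 cg og g0 gl0 gloo mV VB).
- move=> e e0; have [d d0 H] := energy_remainder Hu e0; exists d => // v Hv vd.
  by apply: le_linear vd _ => [|t t0 vt td]; [exact: H1_norm_ge0|exact: H].
Qed.

End energy_frechet.

(** * Minimisers on the sphere are constrained critical points *)

Section variation_arithmetic.
Context {R : realType}.

(** [c] is the factor that brings a tangential variation back to the sphere. As [s] will be of order
    [t ^ 2], the estimate [1 - c <= s] makes the correction of second order. *)
Lemma inv_sqrt_bounds (s : R) : 0 <= s -> s <= 1 ->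
  let c := (Num.sqrt (1 + s))^-1 in
  [/\ c ^+ 2 * (1 + s) = 1, 1 / 2 <= c, c <= 1 & 1 - c <= s].
Proof.
move=> s0 s1 c; have s2 : 0 < 1 + s by rewrite ltr_pwDl.
have c2 : c ^+ 2 * (1 + s) = 1.
  by rewrite /c exprVn sqr_sqrtr ?(ltW s2)// mulVf// gt_eqF.
have c0 : 0 < c by rewrite invr_gt0 sqrtr_gt0.
move: c c2 c0 => c c2 c0; have cc := mulr_gt0 c0 c0.
have c1 : c <= 1 by nra.
by split=> //; nra.
Qed.

(** The conditions ensure in turn that [s <= 1], that the increment lies within the radius of
    Fréchet differentiability, and that the second-order terms stay below the first-order gain. *)
Lemma small_time (m b e lu nu nv d : R) : 0 < m -> 0 <= b -> 0 < e -> 0 <= lu ->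
  0 <= nu -> 0 <= nv -> 0 < d ->
  exists t : R, [/\ 0 < t, t <= 1, t * b <= 1, 2 * (t * (b * nu + nv)) < d &
    t * (b * (lu + 2 * e * nu)) <= m / 8].
Proof.
move=> m0 b0 e0 lu0 nu0 nv0 d0.
have near_le (c k : R) : 0 <= c -> 0 < k -> \forall t \near (0 : R)^'+, t * c < k.
  move=> c0 k0; have c1 : 0 < c + 1 by rewrite ltr_wpDl.
  near=> t.
  have tk : t < k / (c + 1).
    near: t; exact: (nbhs_right_lt (divr_gt0 k0 c1)).
  have t0 : 0 < t by near: t; exact: nbhs_right_gt.
  move: tk; rewrite ltr_pdivlMr// mulrDr mulr1; apply: le_lt_trans.
  by rewrite lerDl ltW.
have Z1 : 0 <= b * nu + nv by rewrite addr_ge0// mulr_ge0.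
have Z2 : 0 <= b * (lu + 2 * e * nu).
  apply: mulr_ge0 => //; apply: addr_ge0 => //; apply: mulr_ge0 => //.
  by apply: mulr_ge0 => //; exact: ltW.
near (0 : R)^'+ => t; exists t; split.
- by near: t; exact: nbhs_right_gt.
- by rewrite -(mulr1 t) ltW//; near: t; exact: near_le.
- by rewrite ltW//; near: t; exact: near_le.
- by rewrite mulrC -ltr_pdivlMr//; near: t; apply: near_le => //; rewrite divr_gt0.
- by rewrite ltW//; near: t; apply: near_le => //; rewrite divr_gt0.
Unshelve. all: by end_near. Qed.

(** The gain [c * t * m] is at least [t * m / 2]. The losses are at most [t * m / 8] from the
    renormalisation and [2 * (t * m / 16)] from the remainder, together [t * m / 4]. *)
Lemma variation_contra (m t b e Lu nu nv c nh : R) : 0 < m -> 0 < t -> 0 <= b ->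
  0 < e -> 0 <= nu -> 0 <= nv -> 1 / 2 <= c -> c <= 1 -> 1 - c <= t ^+ 2 * b ->
  nh <= 2 * (t ^+ 2 * b * nu + t * nv) -> e * nv <= m / 16 ->
  t * (b * (`|Lu| + 2 * e * nu)) <= m / 8 ->
  0 <= (c - 1) * Lu - c * t * m + e * nh -> False.
Proof.
move=> m0 t0 b0 e0 nu0 nv0 c12 c1 cs nhle ev tm.
have cLu : (c - 1) * Lu <= t ^+ 2 * b * `|Lu|.
  apply: le_trans (ler_norm _) _; rewrite normrM ler0_norm ?subr_le0// opprB.
  by rewrite ler_wpM2r.
have ctm : t * m / 2 <= c * t * m.
  by have tm0 := mulr_gt0 t0 m0; have := ler_wpM2r (ltW tm0) c12; rewrite mulrAC mul1r mulrC mulrA.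
have enh : e * nh <= e * (2 * (t ^+ 2 * b * nu + t * nv)) by rewrite ler_pM2l.
have tev : t * (e * nv) <= t * (m / 16) by rewrite ler_pM2l.
have ttm : t * (t * (b * (`|Lu| + 2 * e * nu))) <= t * (m / 8) by rewrite ler_pM2l.
have tmpos := mulr_gt0 t0 m0.
move: (`|Lu|) cLu ttm => lu cLu ttm H.
suff : t * m / 2 <= t * m / 4 by lra.
have E1 : t ^+ 2 * b * lu + e * (2 * (t ^+ 2 * b * nu + t * nv)) =
  t * (t * (b * (lu + 2 * e * nu))) + 2 * (t * (e * nv)) by ring.
lra.
Qed.

End variation_arithmetic.

Section constrained_minimizers.
Context {R : realType} {N : nat}.
Local Notation E := ('rV[R]_N).
Local Notation leb := (@lebesgue_rV R N).
Implicit Types (x y : E) (u v : E -> R).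

Lemma H1_norm_lin (b c : R) u v : H1 u -> H1 v ->
  H1_norm (fun x => b * u x + c * v x) <= 2 * (`|b| * H1_norm u + `|c| * H1_norm v).
Proof.
move=> Hu Hv; have Hcv := H1Z c Hv; have Hw := H1_lin b Hu Hcv.
set w := fun x => _ in Hw *.
have nrm z : H1 z -> H1_norm z ^+ 2 =
    \int[leb]_x dot (wgrad z x) (wgrad z x) + \int[leb]_x (z x ^+ 2).
  move=> Hz; rewrite /H1_norm sqr_sqrtr; last first.
    by apply: Rint_ge0 => x; rewrite addr_ge0 ?sqr_ge0 ?dot_ge0.
  by rewrite RintD//; [exact: integrable_dot_wgrad|exact: sqint_sqr (H1_sqint Hz)].
have sq : H1_norm w ^+ 2 <= 2 * b ^+ 2 * H1_norm u ^+ 2 + 2 * c ^+ 2 * H1_norm v ^+ 2.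
  rewrite !nrm//.
  have i1 := integrable_dot_wgrad Hu Hu; have i2 := integrable_dot_wgrad Hv Hv.
  have j1 := sqint_sqr (H1_sqint Hu); have j2 := sqint_sqr (H1_sqint Hv).
  have k1 := integrableRZ (2 * b ^+ 2) i1; have k2 := integrableRZ (2 * c ^+ 2) i2.
  have l1 := integrableRZ (2 * b ^+ 2) j1; have l2 := integrableRZ (2 * c ^+ 2) j2.
  have D1 : \int[leb]_x dot (wgrad w x) (wgrad w x) <=
      2 * b ^+ 2 * \int[leb]_x dot (wgrad u x) (wgrad u x) +
      2 * c ^+ 2 * \int[leb]_x dot (wgrad v x) (wgrad v x).
    rewrite -!RintZ// -RintD//.
    apply: (Rint_le_ae _ _ _ (integrableRD k1 k2)).2.
    - exact: integrableR_meas (integrable_dot_wgrad Hw Hw).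
    - by move=> x; exact: dot_ge0.
    - apply: filterS2 (wgrad_lin b Hu Hcv) (wgradZ c Hv) => x -> ->.
      rewrite /dot !mulr_sumr -big_split /=; apply: ler_sum => i _; rewrite !mxE.
      move: (wgrad u x _ _) (wgrad v x _ _) => s t.
      by have := sqr_ge0 (b * s - c * t); clear; lra.
  have D2 : \int[leb]_x (w x ^+ 2) <=
      2 * b ^+ 2 * \int[leb]_x (u x ^+ 2) + 2 * c ^+ 2 * \int[leb]_x (v x ^+ 2).
    rewrite -!RintZ// -RintD//; apply: Rint_le.
    - exact: sqint_sqr (H1_sqint Hw).
    - exact: integrableRD l1 l2.
    - move=> x; rewrite /w; move: (u x) (v x) => s t; have := sqr_ge0 (b * s - c * t).
      by clear; lra.
  apply: le_trans (lerD D1 D2) _.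
  have alg (s t a1 a2 b1 b2 : R) : s * a1 + t * a2 + (s * b1 + t * b2) <=
    s * (a1 + b1) + t * (a2 + b2).
    by rewrite !mulrDr addrACA.
  exact: alg.
have nu := H1_norm_ge0 u; have nv := H1_norm_ge0 v; have nw := H1_norm_ge0 w.
have r0 : 0 <= 2 * (`|b| * H1_norm u + `|c| * H1_norm v) by rewrite mulr_ge0// addr_ge0// mulr_ge0.
rewrite -ler_sqr ?nnegrE//; apply: le_trans sq _.
rewrite -(real_normK (num_real b)) -(real_normK (num_real c)); clear nw r0 nrm.
move: (H1_norm u) (H1_norm v) nu nv (`|b|) (`|c|) (normr_ge0 b) (normr_ge0 c) => s t s0 t0 k l k0 l0.
have := mulr_ge0 (mulr_ge0 k0 s0) (mulr_ge0 l0 t0).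
have := sqr_ge0 (k * s); have := sqr_ge0 (l * t).
by rewrite !exprMn; clear; nra.
Qed.

Lemma frechet_linear J u L : is_frechet_derivative J u L ->
  (forall (c : R) v, H1 v -> L (fun x => c * v x) = c * L v) /\
  (forall (b c : R) v w, H1 v -> H1 w -> L (fun x => b * v x + c * w x) = b * L v + c * L w).
Proof.
move=> [lin _ _].
have LZ (c : R) v : H1 v -> L (fun x => c * v x) = c * L v.
  move=> Hv; have L0 : L (fun=> 0) = 0.
    have := lin 1 _ _ H1_0 H1_0; rewrite (_ : (fun x => 1 * 0 + 0) = fun=> 0); last first.
      by apply/funext => x; rewrite mulr0 addr0.
    by rewrite mul1r => /eqP; rewrite -subr_eq0 opprD addNKr oppr_eq0 => /eqP.
  have := lin c _ _ Hv H1_0; rewrite L0 addr0 => <-.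
  by congr L; apply/funext => x; rewrite addr0.
split=> // b c v w Hv Hw.
by rewrite (lin b v (fun x => c * w x))// ?LZ//; exact: H1Z.
Qed.

(* If [L v < 0] for a tangent [v], then [(u + t v) / sqrt (1 + s)], where
   [s = t ^ 2 * |v| ^ 2 / a], stays on the sphere and has smaller energy for small [t]. *)
Lemma minimizer_critical J u L (a : R) : 0 < a -> mass_sphere a u ->
  is_frechet_derivative J u L -> (forall v, mass_sphere a v -> J u <= J v) ->
  forall v, H1 v -> \int[leb]_x (u x * v x) = 0 -> L v = 0.
Proof.
move=> a0 [Hu ua] dJ minu.
have [LZ Llin] := frechet_linear dJ; have [_ _ frechet] := dJ.
(* Tangent directions come with their opposites, so one inequality is enough. *)
suff ge0 v : H1 v -> \int[leb]_x (u x * v x) = 0 -> 0 <= L v.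
  move=> v Hv uv; apply/eqP; rewrite eq_le ge0// andbT -oppr_ge0 -mulN1r -LZ//.
  apply: ge0; first exact: H1Z.
  under eq_Rintegral do rewrite mulN1r mulrN -mulN1r.
  by rewrite RintZ ?uv ?mulr0//; apply: sqint_mul; exact: H1_sqint.
move=> Hv uv; rewrite leNgt; apply/negP => Lv.
pose m := - L v; have m0 : 0 < m by rewrite oppr_gt0.
(* By orthogonality the mass of [u + t v] is [a * (1 + t ^ 2 * b)]. *)
pose b := (\int[leb]_x (v x ^+ 2)) / a.
have b0 : 0 <= b by rewrite divr_ge0 ?(ltW a0)//; apply: Rint_ge0 => x; exact: sqr_ge0.
have nu := H1_norm_ge0 u; have nv := H1_norm_ge0 v.
(* The summand [1] covers a direction of norm zero. *)
pose e := m / (16 * (H1_norm v + 1)).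
have v1 : 0 < H1_norm v + 1 by rewrite ltr_wpDl.
have e0 : 0 < e by rewrite divr_gt0// mulr_gt0.
have ev : e * H1_norm v <= m / 16.
  have m16 : m / (16 * (H1_norm v + 1)) * (H1_norm v + 1) = m / 16.
    by rewrite invfM mulrA -mulrA mulVf ?mulr1// gt_eqF.
  by rewrite -m16 ler_wpM2l ?(ltW e0)// lerDl.
have [d d0 dH] := frechet e e0.
have [t [t0 t1 tb td tm]] := small_time m0 b0 e0 (normr_ge0 (L u)) nu nv d0.
pose s := t ^+ 2 * b.
have s0 : 0 <= s by rewrite mulr_ge0// sqr_ge0.
have st : s <= t * b by rewrite /s expr2 -mulrA ler_piMl// mulr_ge0// ltW.
have [c2 c12 c1 cs] := inv_sqrt_bounds s0 (le_trans st tb).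
set c := _^-1 in c2 c12 c1 cs.
have c0 : 0 < c by apply: lt_le_trans c12.
pose h x := (c - 1) * u x + c * t * v x.
have Hh : H1 h by apply: H1_lin => //; exact: H1Z.
have uh x : u x + h x = c * (u x + t * v x) by rewrite /h; ring.
have mass : mass_sphere a (fun x => u x + h x).
  split; first exact: H1D.
  under eq_Rintegral do rewrite uh exprMn.
  have j1 := sqint_sqr (H1_sqint Hu); have j2 := sqint_sqr (H1_sqint Hv).
  have j3 := sqint_mul (H1_sqint Hu) (H1_sqint Hv).
  have j12 := integrableRD j1 (integrableRZ (2 * t) j3).
  have sqE : (fun x => (u x + t * v x) ^+ 2) =
      fun x => u x ^+ 2 + 2 * t * (u x * v x) + t ^+ 2 * v x ^+ 2.
    by apply/funext => x; ring.
  have jE : integrableR leb (fun x => (u x + t * v x) ^+ 2).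
    by rewrite sqE; apply: integrableRD => //; exact: integrableRZ.
  rewrite RintZ// sqE RintD//; last exact: integrableRZ.
  rewrite RintD//; last exact: integrableRZ.
  rewrite !RintZ// uv mulr0 addr0 ua.
  have -> : \int[leb]_x (v x ^+ 2) = b * a by rewrite /b divfK// gt_eqF.
  by move: c2; rewrite /s => c2; rewrite -[RHS]mul1r -c2; ring.
have nh : H1_norm h <= 2 * (s * H1_norm u + t * H1_norm v).
  apply: le_trans (H1_norm_lin _ _ Hu Hv) _; rewrite ler_pM2l// lerD// ler_wpM2r//.
    by rewrite ler0_norm ?subr_le0// opprB.
  by rewrite ger0_norm ?mulr_ge0 ?(ltW c0) ?(ltW t0)// ler_piMl// ltW.
have hd : H1_norm h < d.
  apply: le_lt_trans nh _; apply: le_lt_trans td; rewrite ler_pM2l// mulrDr lerD2r mulrA.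
  exact: ler_wpM2r.
have := dH h Hh hd; rewrite ler_norml => /andP[_ J2].
apply: (@variation_contra _ m t b e (L u) (H1_norm u) (H1_norm v) c (H1_norm h)) => //.
have Lh : L h = (c - 1) * L u - c * t * m by rewrite Llin// /m mulrN opprK.
rewrite -Lh; apply: le_trans (_ : J (fun x => u x + h x) - J u <= _).
  by rewrite subr_ge0 minu.
by rewrite -lerBlDl.
Qed.

End constrained_minimizers.

(** * Plateau functions on cubes *)

Section plateau.
Context {R : realType}.
Implicit Types (s L : R).

Definition plateau s : R := smoothstep ((-1) * s + 2) * smoothstep (1 * s + 2).

Lemma Cinfty_plateau : Cinfty plateau.
Proof.
by move=> n; apply: Ck_mul; apply: Ck_affine; exact: Cinfty_smoothstep.
Qed.

Lemma plateau_ge0 s : 0 <= plateau s.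
Proof. by rewrite mulr_ge0// smoothstep_ge0. Qed.

Lemma plateau_le1 s : plateau s <= 1.
Proof. by rewrite mulr_ile1 ?smoothstep_ge0 ?smoothstep_le1. Qed.

Lemma plateau1 s : `|s| <= 1 -> plateau s = 1.
Proof.
by rewrite ler_norml => /andP[s1 s2]; rewrite /plateau !smoothstep1 ?mulr1//; lra.
Qed.

Lemma plateau0 s : 2 <= `|s| -> plateau s = 0.
Proof.
rewrite /plateau ler_normr => /orP[s2|s2].
  by rewrite smoothstep0 ?mul0r//; lra.
by rewrite [X in _ * X]smoothstep0 ?mulr0//; lra.
Qed.

Definition dplateau : R -> R := (plateau^`())%classic.

Lemma is_derive_plateau s : is_derive s 1 plateau (dplateau s).
Proof. exact: (Cinfty_derive Cinfty_plateau).1. Qed.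

Lemma dplateau_eq0 s : `|s| < 1 \/ 2 < `|s| -> dplateau s = 0.
Proof.
move=> sP; have [c cP] : exists c : R, \forall t \near s, c = plateau t.
  case: sP => sP; [exists 1|exists 0]; near=> t; apply/esym.
    apply: plateau1; apply/ltW; near: t; apply: (cvgr_lt `|s|) => //.
    exact: norm_continuous.
  apply: plateau0; apply/ltW; near: t; apply: (cvgr_gt `|s|) => //.
  exact: norm_continuous.
have d0 : is_derive s 1 plateau 0 by exact: (near_eq_is_derive cP).
have ds := is_derive_plateau s.
by rewrite -[LHS](@derive_val _ _ _ _ _ _ _ ds) (@derive_val _ _ _ _ _ _ _ d0).
Unshelve. all: by end_near. Qed.

Lemma dplateau_bounded : exists2 D : R, 0 < D & forall s, `|dplateau s| <= D.
Proof.
have [dP Cd] := Cinfty_derive Cinfty_plateau.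
have bd : bump dplateau.
  by split=> //; exists 2 => s s2; apply: dplateau_eq0; right.
have [D dD] := bump_bounded bd; exists (D + 1) => [|s].
  by rewrite ltr_wpDl// (le_trans _ (dD 0)).
by rewrite (le_trans (dD s))// lerDl.
Qed.

End plateau.

Section plateau_rV.
Context {R : realType} {N : nat}.
Local Notation E := ('rV[R]_N).
Local Notation leb := (@lebesgue_rV R N).
Implicit Types (x y : E) (L : R).

(** The vanishing summand keeps the affine form to which [Ck_affine] and [is_derive1_affine]
    apply. *)
Definition scaled_plateau L (_ : 'I_N) (s : R) : R := plateau (L^-1 * s + 0).

Definition psi L : E -> R := tprod (scaled_plateau L).

Lemma bump_scaled_plateau L i : 0 < L -> bump (scaled_plateau L i).
Proof.
move=> L0; split; first by move=> n; apply: Ck_affine; exact: Cinfty_plateau.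
exists (2 * L) => s sL; rewrite /scaled_plateau addr0 plateau0//.
by rewrite normrM gtr0_norm ?invr_gt0// ler_pdivlMl// mulrC ltW.
Qed.

Lemma test_function_psi L : 0 < L -> test_function (psi L).
Proof. by move=> L0; apply: test_function_tprod => j; exact: bump_scaled_plateau. Qed.

Lemma psi_ge0 L x : 0 <= psi L x.
Proof. by apply: prodr_ge0 => j _; exact: plateau_ge0. Qed.

Lemma psi_le1 L x : psi L x <= 1.
Proof. by apply: prodr_ile1 => j _; rewrite plateau_ge0 plateau_le1. Qed.

Definition cube (r : R) : set E := ocbox (const_mx (- r)) (const_mx r).

Lemma psi1 L x : 0 < L -> cube L x -> psi L x = 1.
Proof.
move=> L0 xL; rewrite /psi /tprod big1// => j _.
rewrite /scaled_plateau addr0 plateau1// normrM gtr0_norm ?invr_gt0// ler_pdivrMl// mulr1.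
by have := xL j; rewrite !mxE ler_norml => /andP[/ltW -> ->].
Qed.

(** [psi L] vanishes as soon as some [|x_i|] reaches [2 L]; the larger half-side [3 L] leaves a
    margin, so that the half-open faces of the cube need no separate treatment. *)
Lemma cubeNP L x : 0 < L -> ~ cube (3 * L) x -> exists i, 2 < `|L^-1 * x ord0 i|.
Proof.
move=> L0; rewrite /cube /ocbox /= => /existsNP[i /negP xi]; exists i.
rewrite normrM gtr0_norm ?invr_gt0// ltr_pdivlMl//.
move: xi; rewrite !mxE negb_and -leNgt -ltNge => /orP[xi|xi].
  by rewrite ler0_norm; lra.
by rewrite ger0_norm; lra.
Qed.

Lemma psi0 L x : 0 < L -> ~ cube (3 * L) x -> psi L x = 0.
Proof.
move=> L0 /(cubeNP L0)[i xi]; rewrite /psi /tprod (bigD1 i)//=.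
by rewrite /scaled_plateau addr0 plateau0 ?mul0r// ltW.
Qed.

Lemma is_derive_psi L x i : is_derive x (unit_rV i) (psi L)
  (tprod_others (scaled_plateau L) i x * (L^-1 * dplateau (L^-1 * x ord0 i))).
Proof.
have ds (s : R) : is_derive s 1 (scaled_plateau L i) (L^-1 * dplateau (L^-1 * s + 0)).
  apply: is_derive1_affine; exact: is_derive_plateau.
have := is_derive_tprod x ds; by rewrite tprod_upd_split addr0.
Qed.

Lemma gradient_psi L x i : gradient (psi L) x ord0 i =
  tprod_others (scaled_plateau L) i x * (L^-1 * dplateau (L^-1 * x ord0 i)).
Proof. by rewrite mxE; have [] := is_derive_psi L x i. Qed.

Lemma tprod_others_plateau L i x : 0 <= tprod_others (scaled_plateau L) i x <= 1.
Proof.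
apply/andP; split; first by apply: prodr_ge0 => j _; exact: plateau_ge0.
by apply: prodr_ile1 => j _; rewrite plateau_ge0 plateau_le1.
Qed.

(** Each partial derivative lives in a pair of slabs that depends only on its own coordinate; for
    two scales of ratio greater than [2] these are disjoint, so the gradients are orthogonal
    coordinate by coordinate. *)
Lemma gradient_psi_neq0 L x i : 0 < L -> gradient (psi L) x ord0 i != 0 ->
  L <= `|x ord0 i| <= 2 * L.
Proof.
move=> L0; apply: contraNT; rewrite negb_and -!ltNge => H.
rewrite gradient_psi dplateau_eq0 ?mulr0//.
rewrite normrM gtr0_norm ?invr_gt0// ltr_pdivrMl// mulr1 ltr_pdivlMl//.
by rewrite [L * 2]mulrC; exact/orP.
Qed.

Lemma gradient_psi_le (D L : R) x i : (forall s, `|dplateau s| <= D) -> 0 < L ->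
  (gradient (psi L) x ord0 i) ^+ 2 <= (D / L) ^+ 2 * \1_(cube (3 * L)) x.
Proof.
move=> dD L0; rewrite indicE; have [xc|xc] := boolP (x \in _).
  rewrite mulr1 gradient_psi -(real_normK (num_real (_ * _))).
  have /andP[c0 c1] := tprod_others_plateau L i x.
  have D0 : 0 <= D / L by rewrite divr_ge0 ?(ltW L0)// (le_trans _ (dD 0)).
  rewrite ler_sqr ?nnegrE// normrM ger0_norm// -[leRHS]mul1r ler_pM//.
  by rewrite normrM gtr0_norm ?invr_gt0// mulrC ler_wpM2r// invr_ge0 ltW.
have [|j xj] := cubeNP L0 (x := x).
  by move=> xc'; move/negP: xc; apply; rewrite inE.
rewrite mulr0 gradient_psi; have [ij|ij] := eqVneq j i.
  by rewrite -ij dplateau_eq0 ?mulr0 ?expr0n//; right.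
rewrite /tprod_others (bigD1 j)//= {1}/scaled_plateau addr0 plateau0; last exact: ltW.
by rewrite !mul0r expr0n.
Qed.

Lemma Rint_symmetric_cube (r : R) : 0 <= r ->
  integrableR leb (\1_(cube r) : E -> R) /\ \int[leb]_x (\1_(cube r) x) = (2 * r) ^+ N.
Proof.
move=> r0; have r20 : 0 <= 2 * r by rewrite mulr_ge0.
have [ic cE] := Rint_cube (N := N) r20.
have eqc : (fun x => \1_(ocbox 0 (const_mx (2 * r))) (x + const_mx r)) = \1_(cube r) :> (E -> R).
  apply/funext => x; rewrite !indicE; congr (nat_of_bool _)%:R.
  apply/idP/idP; rewrite !inE => H i; have := H i; rewrite !mxE => /andP[h1 h2];
    apply/andP; split; lra.
have [ic' cE'] := Rint_shift (const_mx r) ic.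
by rewrite eqc in ic'; split=> //; rewrite -cE -cE' eqc.
Qed.

Lemma H1_psi L : 0 < L -> H1 (psi L).
Proof.
move=> L0; split; first exact: sqint_test_function (test_function_psi L0).
by exists (gradient (psi L)); exact: is_weak_gradient_test_function (test_function_psi L0).
Qed.

Lemma psi_sqr L : 0 < L -> (2 * L) ^+ N <= \int[leb]_x (psi L x ^+ 2) <= (6 * L) ^+ N.
Proof.
move=> L0; have i2 := sqint_sqr (H1_sqint (H1_psi L0)).
have [i1 E1] := Rint_symmetric_cube (ltW L0).
have L30 : 0 <= 3 * L by rewrite mulr_ge0// ltW.
have [i3 E3] := Rint_symmetric_cube L30.
have -> : 6 * L = 2 * (3 * L) by rewrite mulrA -natrM.
rewrite -E1 -E3; apply/andP; split; apply: Rint_le => // x; rewrite indicE.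
  have [xc|_] := boolP (x \in _); last exact: sqr_ge0.
  by rewrite psi1 ?expr1n//; move: xc; rewrite inE.
have [xc|xc] := boolP (x \in _).
  by rewrite expr_le1// ?psi_le1 ?psi_ge0.
by rewrite psi0 ?expr0n// => xc'; move/negP: xc; apply; rewrite inE.
Qed.

End plateau_rV.

(** * Functions of small mass and negative energy *)

Section negative_energy.
Context {R : realType} {N : nat}.
Local Notation E := ('rV[R]_N).
Local Notation leb := (@lebesgue_rV R N).
Implicit Types (x y : E) (u v : E -> R).
Local Notation p := (2 + 4 / N%:R : R).
Local Notation q := (1 + 4 / N%:R : R).
Variables (g : R -> R) (V : E -> R) (B : R).
Local Notation G := (primitive g).
Hypotheses (N0 : (0 < N)%N) (cg : continuous g) (og : forall s, g (- s) = - g s)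
  (g0 : g 0 = 0) (gl0 : g s / s @[s --> 0^'] --> (0 : R))
  (gloo : g s / `|s| `^ q @[s --> +oo] --> (0 : R))
  (mV : measurable_fun setT V) (VB : forall x, `|V x| <= B) (V0 : forall x, V x <= 0).

Let q1 : 1 < q. Proof. by rewrite ltrDl divr_gt0// ltr0n. Qed.
Let q1p : q + 1 = p. Proof. by rewrite addrAC. Qed.

Lemma energyZ u (s : R) : H1 u -> energy g V (fun x => s * u x) =
  2^-1 * (s ^+ 2 * \int[leb]_x dot (wgrad u x) (wgrad u x)) +
  2^-1 * (s ^+ 2 * \int[leb]_x (V x * u x ^+ 2)) - \int[leb]_x G (s * u x).
Proof.
move=> Hu; have Hsu := H1Z s Hu; rewrite /energy.
have i1 := integrable_dot_wgrad Hu Hu.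
have i2 : integrableR leb (fun x => V x * u x ^+ 2) by exact: (integrable_Vmul mV VB Hu Hu).
have -> : \int[leb]_x dot (wgrad (fun x => s * u x) x) (wgrad (fun x => s * u x) x) =
    s ^+ 2 * \int[leb]_x dot (wgrad u x) (wgrad u x).
  rewrite -RintZ//; apply: Rint_ae.
  - exact: integrableR_meas (integrable_dot_wgrad Hsu Hsu).
  - exact: integrableR_meas (integrableRZ (s ^+ 2) i1).
  - by apply: filterS (wgradZ s Hu) => x ->; rewrite dotZl dotZr mulrA.
have -> // : \int[leb]_x (V x * (s * u x) ^+ 2) = s ^+ 2 * \int[leb]_x (V x * u x ^+ 2).
by rewrite -RintZ//; apply: eq_Rintegral => x _; rewrite exprMn mulrCA.
Qed.

Lemma psi_gradient_sqr (D L : R) : (forall s, `|dplateau s| <= D) -> 0 < L ->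
  \int[leb]_x dot (wgrad (psi L) x) (wgrad (psi L) x) <=
  N%:R * (D / L) ^+ 2 * (6 * L) ^+ N.
Proof.
move=> dD L0; have Hp := H1_psi (N := N) L0.
have L30 : 0 <= 3 * L by rewrite mulr_ge0// ltW.
have [i3 E3] := Rint_symmetric_cube (N := N) L30.
have -> : 6 * L = 2 * (3 * L) by rewrite mulrA -natrM.
rewrite -E3 -RintZ//.
apply: (Rint_le_ae _ _ _ (integrableRZ _ i3)).2.
- exact: integrableR_meas (integrable_dot_wgrad Hp Hp).
- by move=> x; exact: dot_ge0.
- apply: filterS (wgrad_ae (is_weak_gradient_test_function (test_function_psi (N := N) L0))) => x ->.
  apply: (@le_trans _ _ (\sum_(i < N) (D / L) ^+ 2 * \1_(cube (3 * L)) x)).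
    by apply: ler_sum => i _; rewrite -expr2; exact: gradient_psi_le.
  by rewrite sumr_const cardT size_enum_ord -[leRHS]mulrA [leRHS]mulr_natl.
Qed.

Lemma negative_energy_superquadratic (a0 : R) : 0 < a0 ->
  limf_einf (fun t : R => (G t / t `^ p)%:E) 0^'+ = +oo%E ->
  exists u, [/\ H1 u, 0 < \int[leb]_x (u x ^+ 2) < a0 & energy g V u < 0].
Proof.
move=> a00 Goo; have [D D0 dD] := @dplateau_bounded R.
(* The mass will be at most [m ^ 2 * 6 ^ N], which this choice makes equal to [a0 / 2]. *)
pose m : R := Num.sqrt (a0 / (2 * 6 ^+ N)).
have m0 : 0 < m by rewrite sqrtr_gt0 divr_gt0// mulr_gt0// exprn_gt0.
have m2 : m ^+ 2 * 6 ^+ N = a0 / 2.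
  rewrite sqr_sqrtr; last by rewrite divr_ge0 ?(ltW a00)// mulr_ge0// exprn_ge0.
  by rewrite invfM mulrA divfK// expf_neq0.
have mp : 0 < m `^ p * 2 ^+ N by rewrite mulr_gt0 ?powR_gt0 ?exprn_gt0.
pose A := 2^-1 * (m ^+ 2 * (N%:R * D ^+ 2 * 6 ^+ N)).
have A0 : 0 <= A by rewrite mulr_ge0// mulr_ge0 ?sqr_ge0// mulr_ge0// mulr_ge0 ?sqr_ge0.
(* [A * t ^ (4 / N)] will bound the Dirichlet energy; with this [K] the integral of the primitive is
   at least [(A + 1) * t ^ (4 / N)]. *)
pose K := (A + 1) / (m `^ p * 2 ^+ N).
have K0 : 0 < K by rewrite divr_gt0// ltr_wpDl.
have [d d0 GK] : exists2 d : R, 0 < d & forall t, 0 < t -> t < d -> K * t `^ p <= G t.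
  (* The lower limit is the opposite of an upper limit, an infimum of suprema over neighbourhoods;
     one neighbourhood with supremum below [- K] gives the pointwise bound. *)
  have : (limf_esup (\- (fun t : R => (G t / t `^ p)%:E)) 0^'+ < (- K)%:E)%E.
    by move: Goo; rewrite /limf_einf => /eqe_oppLRP ->; rewrite ltNyr.
  rewrite limf_esupE => /ereal_inf_lt[_ [S S0 <-] KS].
  move: S0; rewrite /at_right /within /= => /nbhs_ballP[d /= d0 dS].
  exists d => // t t0 td; have tp : 0 < t `^ p by rewrite powR_gt0.
  rewrite -ler_pdivlMr// -lerN2 -lee_fin; apply: le_trans (ltW KS).
  apply: ereal_sup_ubound; exists t => //; apply: dS => //.
  by rewrite -ball_normE /= sub0r normrN gtr0_norm.
(* Then [s = d / 2], so all positive values of [s * psi L] lie in the range where the bound on [G]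
   holds. *)
pose t := d / (2 * m); have t0 : 0 < t by rewrite divr_gt0// mulr_gt0.
pose s := m * t; have s0 : 0 < s by rewrite mulr_gt0.
have sd : s < d.
  have -> : s = d / 2 by rewrite /s /t; field; rewrite gt_eqF.
  by rewrite ltr_pdivrMr// ltr_pMr// ltr1n.
(* [L ^ N = t ^ (- 2)] cancels the square of the height in the mass, and [L ^ (- 2) = t ^ (4 / N)]
   is the remaining factor of the Dirichlet energy. *)
pose L := t `^ (- (2 / N%:R)); have L0 : 0 < L by rewrite powR_gt0.
have NR0 : N%:R != 0 :> R by rewrite pnatr_eq0 -lt0n.
have LN : L ^+ N = t ^- 2.
  rewrite -powR_mulrn ?(ltW L0)// -powRrM -powR_invn ?(ltW t0)//.
  by congr (_ `^ _); rewrite mulNr divfK.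
have L2 : L ^- 2 = t `^ (4 / N%:R).
  rewrite -powR_invn ?(ltW L0)// -powRrM; congr (_ `^ _).
  by field.
have Hp := H1_psi (N := N) L0.
have /andP[p1 p2] := psi_sqr (N := N) L0.
exists (fun x => s * psi L x).
have massE : \int[leb]_x ((s * psi L x) ^+ 2) = s ^+ 2 * \int[leb]_x (psi L x ^+ 2).
  under eq_Rintegral do rewrite exprMn.
  by rewrite RintZ//; exact: sqint_sqr (H1_sqint Hp).
have s2 : 0 < s ^+ 2 by rewrite exprn_gt0.
have t2 : t ^+ 2 * t ^- 2 = 1 by rewrite mulfV// expf_neq0// gt_eqF.
split; first exact: H1Z.
  rewrite massE; apply/andP; split.
    by rewrite mulr_gt0// (lt_le_trans _ p1)// exprn_gt0// mulr_gt0.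
  apply: le_lt_trans (_ : s ^+ 2 * (6 * L) ^+ N < _); first by rewrite ler_pM2l.
  rewrite [(6 * L) ^+ N]exprMn LN /s exprMn mulrACA m2 t2 mulr1.
  by rewrite ltr_pdivrMr// ltr_pMr// ltr1n.
rewrite energyZ//.
have Vle : \int[leb]_x (V x * psi L x ^+ 2) <= 0.
  have i2 : integrableR leb (fun x => V x * psi L x ^+ 2) by exact: (integrable_Vmul mV VB Hp Hp).
  rewrite -oppr_ge0 -mulN1r -RintZ//; apply: Rint_ge0 => x.
  by rewrite mulN1r oppr_ge0 mulr_le0_ge0// sqr_ge0.
have Gge : K * s `^ p * (2 * L) ^+ N <= \int[leb]_x G (s * psi L x).
  have [i1 E1] := Rint_symmetric_cube (N := N) (ltW L0).
  rewrite -E1 -RintZ//; apply: Rint_le; first exact: integrableRZ.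
    exact: (integrable_primitive N0 cg og g0 gl0 gloo (H1Z s Hp)).
  have G0 : G 0 = 0 by rewrite /primitive lexx set_itv1 Rintegral_set1.
  move=> x; rewrite indicE; have [xc|xc] := boolP (x \in _).
    by rewrite mulr1 psi1 ?mulr1 ?GK//; move: xc; rewrite inE.
  (* Off the inner cube only nonnegativity of [G] is used, which the same bound provides. *)
  rewrite mulr0; have := psi_ge0 L x; rewrite le_eqVlt => /predU1P[<-|px].
    by rewrite mulr0 G0.
  have sp : 0 < s * psi L x by rewrite mulr_gt0.
  apply: le_trans (GK _ sp _); first by rewrite mulr_ge0 ?powR_ge0 ?(ltW K0).
  by apply: le_lt_trans sd; rewrite ler_piMr ?psi_le1// ltW.
have Dle := psi_gradient_sqr dD L0.
have E1 : 2^-1 * (s ^+ 2 * (N%:R * (D / L) ^+ 2 * (6 * L) ^+ N)) = A * t `^ (4 / N%:R).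
  rewrite [(6 * L) ^+ N]exprMn [(D / L) ^+ 2]exprMn exprVn L2 LN /s /A.
  have alg (k b c f : R) : 2^-1 * ((m * t) ^+ 2 * (k * (D ^+ 2 * c) * (f * b))) =
      2^-1 * (m ^+ 2 * (k * D ^+ 2 * f)) * c * (t ^+ 2 * b) by ring.
  by rewrite alg t2 mulr1.
have E2 : K * s `^ p * (2 * L) ^+ N = (A + 1) * t `^ (4 / N%:R).
  rewrite [(2 * L) ^+ N]exprMn LN /s powRM ?(ltW m0) ?(ltW t0)//.
  have -> : t `^ p = t ^+ 2 * t `^ (4 / N%:R).
    by rewrite powRD ?powR_mulrn ?(ltW t0)//; rewrite (gt_eqF t0) implybT.
  rewrite /K.
  have alg (k y b c e : R) : k * (y * (t ^+ 2 * c)) * (e * b) = k * (y * e) * c * (t ^+ 2 * b) by ring.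
  by rewrite alg t2 mulr1 divfK// gt_eqF.
have h1 : 2^-1 * (s ^+ 2 * \int[leb]_x dot (wgrad (psi L) x) (wgrad (psi L) x)) <= A * t `^ (4 / N%:R).
  by rewrite -E1 ler_pM2l// ler_pM2l.
have h2 : 2^-1 * (s ^+ 2 * \int[leb]_x (V x * psi L x ^+ 2)) <= 0.
  by rewrite pmulr_rle0// pmulr_rle0.
apply: le_lt_trans (lerB (lerD h1 h2) Gge) _.
by rewrite addr0 E2 -mulrBl opprD addNKr mulN1r oppr_lt0 powR_gt0.
Qed.

End negative_energy.

Section negative_quadratic_form.
Context {R : realType} {N : nat}.
Local Notation E := ('rV[R]_N).
Local Notation leb := (@lebesgue_rV R N).
Implicit Types (x y : E) (u v : E -> R).
Local Notation p := (2 + 4 / N%:R : R).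
Local Notation q := (1 + 4 / N%:R : R).
Variables (V : E -> R) (B : R).
Hypotheses (N0 : (0 < N)%N)
  (mV : measurable_fun setT V) (VB : forall x, `|V x| <= B) (V0 : forall x, V x <= 0).

Lemma negative_energy_quadratic (g : R -> R) (phi : E -> R) (a0 : R) :
  continuous g -> (forall s, g (- s) = - g s) -> g 0 = 0 ->
  g s / s @[s --> 0^'] --> (0 : R) -> g s / `|s| `^ q @[s --> +oo] --> (0 : R) ->
  H1 phi -> 0 < \int[leb]_x (phi x ^+ 2) ->
  \int[leb]_x dot (wgrad phi x) (wgrad phi x) + \int[leb]_x (V x * phi x ^+ 2) < 0 ->
  0 < a0 ->
  exists u, [/\ H1 u, 0 < \int[leb]_x (u x ^+ 2) < a0 & energy g V u < 0].
Proof.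
move=> cg og g0 gl0 gloo Hphi M0 Q0 a00.
have q1 : 1 < q by rewrite ltrDl divr_gt0// ltr0n.
have q1p : q + 1 = p by rewrite addrAC.
have i2 := sqint_sqr (H1_sqint Hphi); have ip := integrable_powR N0 Hphi.
set M := \int[leb]_x (phi x ^+ 2) in M0.
set I1 := \int[leb]_x dot (wgrad phi x) (wgrad phi x) in Q0.
set I2 := \int[leb]_x (V x * phi x ^+ 2) in Q0.
pose Qn := - (I1 + I2); have Qn0 : 0 < Qn by rewrite oppr_gt0.
pose P := \int[leb]_x (`|phi x| `^ p).
have P0 : 0 <= P by apply: Rint_ge0 => x; exact: powR_ge0.
have M8 : 0 < 8 * M by rewrite mulr_gt0.
(* The quadratic part of the bound on the primitive becomes [s ^ 2 * Qn / 8]. The part of power [p]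
   has the extra factor [s ^ (4 / N)] and is brought below the same value; both are outweighed by
   the form, which contributes [- s ^ 2 * Qn / 2]. *)
have [C C0 GC] := primitive_growth q1 cg og g0 gl0 gloo (divr_gt0 Qn0 M8).
have near_le (c k : R) : 0 <= c -> 0 < k -> \forall t \near (0 : R)^'+, t * c < k.
  move=> c0 k0; have c1 : 0 < c + 1 by rewrite ltr_wpDl.
  near=> t.
  have tk : t < k / (c + 1) by near: t; exact: (nbhs_right_lt (divr_gt0 k0 c1)).
  have t0 : 0 < t by near: t; exact: nbhs_right_gt.
  move: tk; rewrite ltr_pdivlMr// mulrDr mulr1; apply: le_lt_trans.
  by rewrite lerDl ltW.
have CP0 : 0 <= C * P by rewrite mulr_ge0.
have pw0 : (fun s : R => s `^ (4 / N%:R)) @ 0^'+ --> (0 : R).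
  by apply: powR_cvg0; rewrite divr_gt0// ltr0n.
have [s [s0 s1 sM sC]] : exists s : R, [/\ 0 < s, s <= 1, s * M < a0 &
    s `^ (4 / N%:R) * (C * P) <= Qn / 8].
  have k0 : 0 < Qn / 8 / (C * P + 1) by rewrite !divr_gt0// ltr_wpDl.
  near (0 : R)^'+ => s; exists s; split.
  - by near: s; exact: nbhs_right_gt.
  - by near: s; apply: nbhs_right_le.
  - by near: s; apply: near_le => //; exact: ltW.
  - have : s `^ (4 / N%:R) < Qn / 8 / (C * P + 1).
      by near: s; exact: (cvgr_lt _ pw0).
    rewrite ltr_pdivlMr ?ltr_wpDl// mulrDr mulr1 => /ltW; apply: le_trans.
    by rewrite lerDl powR_ge0.
have s2 : 0 < s ^+ 2 by rewrite exprn_gt0.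
have Hs := H1Z s Hphi.
exists (fun x => s * phi x); split=> //.
  under eq_Rintegral do rewrite exprMn.
  rewrite RintZ// -/M mulr_gt0//=; apply: le_lt_trans sM.
  by rewrite ler_pM2r// expr2 ler_piMl// ltW.
rewrite (energyZ _ mV VB)// -/I1 -/I2.
have GP : `|\int[leb]_x primitive g (s * phi x)| <=
    Qn / (8 * M) * (s ^+ 2 * M) + C * (s `^ p * P).
  have j1 := integrableRZ (Qn / (8 * M)) (integrableRZ (s ^+ 2) i2).
  have j2 := integrableRZ C (integrableRZ (s `^ p) ip).
  have -> : Qn / (8 * M) * (s ^+ 2 * M) + C * (s `^ p * P) =
      \int[leb]_x (Qn / (8 * M) * (s ^+ 2 * phi x ^+ 2) + C * (s `^ p * `|phi x| `^ p)).
    rewrite RintD// RintZ; last exact: integrableRZ.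
    rewrite RintZ// RintZ; last exact: integrableRZ.
    by rewrite RintZ.
  apply: Rint_norm_le; last exact: integrableRD j1 j2.
    exact: (measurable_primitive cg Hs).
  move=> x; apply: le_trans (GC _) _; rewrite q1p exprMn normrM (gtr0_norm s0).
  by rewrite powRM// ltW.
have sp : s `^ p = s ^+ 2 * s `^ (4 / N%:R).
  by rewrite powRD ?powR_mulrn ?(ltW s0)//; rewrite (gt_eqF s0) implybT.
have e1 : Qn / (8 * M) * (s ^+ 2 * M) = s ^+ 2 * (Qn / 8) by field; rewrite gt_eqF.
have e2 : C * (s `^ p * P) = s ^+ 2 * (s `^ (4 / N%:R) * (C * P)) by rewrite sp; ring.
have e3 : C * (s `^ p * P) <= s ^+ 2 * (Qn / 8) by rewrite e2 ler_pM2l.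
rewrite e1 in GP; move: GP e3; rewrite ler_norml => /andP[GP _] e3.
have e4 : 2^-1 * (s ^+ 2 * I1) + 2^-1 * (s ^+ 2 * I2) = - (s ^+ 2 * Qn) / 2.
  by rewrite /Qn; field.
rewrite e4; have sQ := mulr_gt0 s2 Qn0.
have e5 : s ^+ 2 * (Qn / 8) = s ^+ 2 * Qn / 8 by rewrite mulrA.
rewrite e5 in GP e3; move: GP e3 sQ.
have alg (J a b : R) : - (a / 8 + b) <= J -> b <= a / 8 -> 0 < a -> - a / 2 - J < 0 by lra.
exact: alg.
Unshelve. all: by end_near. Qed.

Lemma sqr_sum_orthogonal n (a : 'I_n -> R) :
  (forall j k, j != k -> a j * a k = 0) ->
  (\sum_(k < n) a k) ^+ 2 = \sum_(k < n) a k ^+ 2.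
Proof.
move=> aa; rewrite expr2 mulr_suml; apply: eq_bigr => j _.
rewrite mulr_sumr (bigD1 j)//= big1 ?addr0 ?expr2// => k kj.
by apply: aa; rewrite eq_sym.
Qed.

(** Every scale is at least [1], so near the origin all plateaus equal [1] and the sum equals [n];
    its square meets the negative values of [V] there, while orthogonality keeps the Dirichlet
    energy linear in [n]. *)
Lemma low_dimension_negative : (N <= 2)%N -> continuous V -> V 0 < 0 ->
  exists phi, [/\ H1 phi, 0 < \int[leb]_x (phi x ^+ 2) &
    \int[leb]_x dot (wgrad phi x) (wgrad phi x) + \int[leb]_x (V x * phi x ^+ 2) < 0].
Proof.
move=> N2 cV V00; have [D D0 dD] := @dplateau_bounded R.
pose L (k : nat) : R := 4 ^+ k.
have L0 k : 0 < L k by rewrite exprn_gt0.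
have L1 k : 1 <= L k by rewrite exprn_ege1// ler1n.
pose phi n x := \sum_(k < n) psi (L k) x.
pose w n x : E := \sum_(k < n) gradient (psi (L k)) x.
have phiS n : phi n.+1 = fun x => 1 * phi n x + psi (L n) x.
  by apply/funext => x; rewrite /phi big_ord_recr /= mul1r.
have wS n : w n.+1 = fun x => 1 *: w n x + gradient (psi (L n)) x.
  by apply/funext => x; rewrite /w big_ord_recr /= scale1r.
have Hphi n : H1 (phi n) /\ is_weak_gradient (phi n) (w n).
  elim: n => [|n [IH1 IH2]].
    rewrite (_ : phi 0%N = fun=> 0); last by apply/funext => x; rewrite /phi big_ord0.
    rewrite (_ : w 0%N = fun=> 0); last by apply/funext => x; rewrite /w big_ord0.
    by split; [exact: H1_0|exact: weak_gradient0].
  have Hp := H1_psi (N := N) (L0 n).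
  rewrite phiS wS; split; first exact: H1_lin.
  apply: weak_gradient_lin => //; [exact: H1_sqint|exact: H1_sqint|].
  exact: is_weak_gradient_test_function (test_function_psi (L0 n)).
have grad n : \int[leb]_x dot (wgrad (phi n) x) (wgrad (phi n) x) <= n%:R * (N%:R * D ^+ 2 * 36).
  have [Hn wn] := Hphi n.
  have L30 k : 0 <= 3 * L k by rewrite mulr_ge0// ltW.
  pose F (k : 'I_n) x : R := N%:R * (D / L k) ^+ 2 * \1_(cube (3 * L k)) x.
  have iF k : integrableR leb (F k).
    by apply: integrableRZ; exact: (Rint_symmetric_cube (L30 k)).1.
  have iS := integrableR_sum iF.
  apply: (@le_trans _ _ (\int[leb]_x (\sum_(k < n) F k x))).
    apply: (Rint_le_ae _ _ _ iS).2.
    - exact: integrableR_meas (integrable_dot_wgrad Hn Hn).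
    - by move=> x; exact: dot_ge0.
    - apply: filterS (wgrad_ae wn) => x ->.
      have -> : \sum_(k < n) F k x =
          \sum_(i < N) \sum_(k < n) (D / L k) ^+ 2 * \1_(cube (3 * L k)) x.
        rewrite sumr_const cardT size_enum_ord -[RHS](mulr_natl _ N) mulr_sumr.
        by apply: eq_bigr => k _; rewrite /F mulrA.
      apply: ler_sum => i _; rewrite -expr2 /w summxE sqr_sum_orthogonal.
        by apply: ler_sum => k _; exact: gradient_psi_le.
      move=> j k jk; apply/eqP; rewrite mulf_eq0 -implyNb; apply/implyP => gj.
      apply: contraT => gk.
      have /andP[j1 j2] := gradient_psi_neq0 (L0 j) gj.
      have /andP[k1 k2] := gradient_psi_neq0 (L0 k) gk.
      have step (a b : nat) : (a < b)%N -> 2 * L a < L b.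
        move=> ab; apply: (@lt_le_trans _ _ (L a.+1)).
          by rewrite /L exprS ltr_pM2r ?exprn_gt0// ltr_nat.
        by rewrite /L ler_weXn2l// ler1n.
      move: jk; rewrite neq_ltn => /orP[/step|/step] H.
        by have := lt_le_trans (le_lt_trans j2 H) k1; rewrite ltxx.
      by have := lt_le_trans (le_lt_trans k2 H) j1; rewrite ltxx.
  rewrite Rint_sum//.
  apply: (@le_trans _ _ (\sum_(k < n) N%:R * D ^+ 2 * 36)); last first.
    by rewrite sumr_const cardT size_enum_ord -[leLHS](mulr_natl _ n).
  apply: ler_sum => k _; rewrite RintZ; last exact: (Rint_symmetric_cube (L30 k)).1.
  rewrite (Rint_symmetric_cube (L30 k)).2.
  have NR : 0 <= N%:R * D ^+ 2 :> R by rewrite mulr_ge0// sqr_ge0.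
  have -> : N%:R * (D / L k) ^+ 2 * (2 * (3 * L k)) ^+ N =
      N%:R * D ^+ 2 * ((6 * L k) ^+ N / L k ^+ 2).
    have -> : 2 * (3 * L k) = 6 * L k by rewrite mulrA -natrM.
    by rewrite exprMn exprVn; ring.
  rewrite ler_wpM2l// ler_pdivrMr ?exprn_gt0//.
  have -> : 36 * L k ^+ 2 = (6 * L k) ^+ 2 by rewrite exprMn; ring.
  (* Here [N <= 2] enters: the Dirichlet energy at scale [L] is of order [L ^ (N - 2)], bounded
     because [6 L >= 1]. *)
  rewrite ler_weXn2l//; have := L1 k; lra.
have /nbhs_ballP[r /= r0 Vr] : \forall x \near (0 : E), V x < V 0 / 2.
  have V02 : V 0 < V 0 / 2 by lra.
  exact: (cvgr_lt _ (cV 0) _ V02).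
(* Less than [r] so that [V < V 0 / 2] on the cube, and at most [1] so that the cube lies in the
   flat part of every plateau. *)
pose r' := Num.min (r / 2) 1.
have r'0 : 0 < r' by rewrite lt_min divr_gt0//=.
have r'1 : r' <= 1 by rewrite ge_min lexx orbT.
have r'r : r' < r by rewrite gt_min ltr_pdivrMr// ltr_pMr// ltr1n.
have [ic cE] := Rint_symmetric_cube (N := N) (ltW r'0).
have pot n : \int[leb]_x (V x * phi n x ^+ 2) <= (n%:R ^+ 2 * (V 0 / 2)) * (2 * r') ^+ N.
  have [Hn _] := Hphi n.
  have iV : integrableR leb (fun x => V x * phi n x ^+ 2) by exact: (integrable_Vmul mV VB Hn Hn).
  rewrite -cE -RintZ//; apply: Rint_le => //; first exact: integrableRZ.
  move=> x; rewrite indicE; have [xc|xc] := boolP (x \in _); last first.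
    by rewrite mulr0 mulr_le0_ge0// sqr_ge0.
  have {}xc : cube r' x by move: xc; rewrite inE.
  have -> : phi n x = n%:R.
    rewrite /phi (eq_bigr (fun=> 1)); first by rewrite sumr_const cardT size_enum_ord.
    move=> k _; apply: psi1 => // i; have := xc i; rewrite !mxE => /andP[h1 h2].
    by have := L1 k => Lk; apply/andP; split; lra.
  rewrite mulr1 mulrC ler_wpM2l ?sqr_ge0// ltW//; apply: Vr.
  rewrite -ball_normE /= sub0r normrN; apply: le_lt_trans r'r.
  rewrite [leLHS]mx_normrE; apply/bigmax_leP; split; first exact: ltW.
  move=> [j i] _ /=; have := xc i; rewrite !mxE ord1 ler_norml => /andP[h1 h2].
  by rewrite /= (ord1 j) h2 ltW.
pose c := - (V 0 / 2) * (2 * r') ^+ N.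
have c0 : 0 < c.
  by rewrite mulr_gt0 ?exprn_gt0 ?mulr_gt0// oppr_gt0 pmulr_llt0.
pose A := N%:R * D ^+ 2 * 36.
pose n := (Num.truncn (A / c)).+1.
have nA : A < n%:R * c by rewrite -ltr_pdivrMr// truncnS_gt.
have [Hn _] := Hphi n; exists (phi n).
have n0 : 0 < n%:R :> R by rewrite ltr0n.
have neg : \int[leb]_x dot (wgrad (phi n) x) (wgrad (phi n) x) +
    \int[leb]_x (V x * phi n x ^+ 2) < 0.
  apply: le_lt_trans (lerD (grad n) (pot n)) _.
  have -> : n%:R * (N%:R * D ^+ 2 * 36) + n%:R ^+ 2 * (V 0 / 2) * (2 * r') ^+ N =
    n%:R * (A - n%:R * c) by rewrite /A /c; ring.
  by rewrite pmulr_rlt0// subr_lt0.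
split=> //.
have i2 := sqint_sqr (H1_sqint Hn).
rewrite lt0r; apply/andP; split; last by apply: Rint_ge0 => x; exact: sqr_ge0.
(* With zero mass the potential term would vanish and leave a negative Dirichlet energy. *)
apply/eqP => M0; have ae0 := Rint_eq0 i2 (fun x => sqr_ge0 (phi n x)) M0.
have iV : integrableR leb (fun x => V x * phi n x ^+ 2) by exact: (integrable_Vmul mV VB Hn Hn).
have : \int[leb]_x (V x * phi n x ^+ 2) = \int[leb]_x (0 : R).
  apply: Rint_ae => //; first exact: integrableR_meas iV.
  by apply: filterS ae0 => x ->; rewrite mulr0.
rewrite [RHS]/Rintegral integral0 /= => V0'; move: neg; rewrite V0' addr0 ltNge.
by rewrite Rint_ge0// => x; exact: dot_ge0.
Qed.

End negative_quadratic_form.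

(** * Lagrange multiplier and ground state *)

Section lagrange_multiplier.
Context {R : realType} {N : nat}.
Local Notation E := ('rV[R]_N).
Local Notation leb := (@lebesgue_rV R N).
Local Notation q := (1 + 4 / N%:R : R).
Variables (g : R -> R) (V : E -> R) (B : R).
Hypotheses (N0 : (0 < N)%N) (cg : continuous g) (og : forall s, g (- s) = - g s)
  (g0 : g 0 = 0) (gl0 : g s / s @[s --> 0^'] --> (0 : R))
  (gloo : g s / `|s| `^ q @[s --> +oo] --> (0 : R))
  (mV : measurable_fun setT V) (VB : forall x, `|V x| <= B).

(** The derivative of the energy vanishes on the tangent part [phi - c u] of any [phi], so it is a
    multiple of the [L^2] product with [u]; the weak equation restates this. *)
Lemma minimizer_weak_solution (a : R) u : 0 < a -> mass_sphere a u ->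
  (forall v, mass_sphere a v -> energy g V u <= energy g V v) ->
  constrained_critical (energy g V) a u /\ exists lambda, weak_solution g V lambda u.
Proof.
move=> a0 mu minu; have [Hu ua] := mu.
have dJ := energy_frechet N0 cg og g0 gl0 gloo mV VB Hu.
have crit := minimizer_critical a0 mu dJ minu.
have [LZ Llin] := frechet_linear dJ.
set L := energy_diff g V u in dJ crit LZ Llin.
split; first by split=> //; exists L.
exists (- (L u / a)); split=> // phi Hphi.
have iup := sqint_mul (H1_sqint Hu) (H1_sqint Hphi).
have iuu := sqint_mul (H1_sqint Hu) (H1_sqint Hu).
have idot := integrable_dot_wgrad Hu Hphi.
have iV := integrable_Vmul mV VB Hu Hphi.
pose c := (\int[leb]_x (u x * phi x)) / a.
have : L (fun x => 1 * phi x + (- c) * u x) = 0.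
  apply: crit; first by apply: H1_lin => //; exact: H1Z.
  under eq_Rintegral do rewrite mul1r mulrDr mulrCA.
  rewrite RintD//; last exact: integrableRZ.
  rewrite RintZ//; under [X in _ + _ * X]eq_Rintegral do rewrite -expr2.
  by rewrite ua /c mulNr divfK ?subrr// gt_eqF.
rewrite Llin// mul1r mulNr => /eqP; rewrite subr_eq0 => /eqP Lphi.
have -> : \int[leb]_x (dot (wgrad u x) (wgrad phi x) + (V x - L u / a) * u x * phi x) =
    \int[leb]_x dot (wgrad u x) (wgrad phi x) + \int[leb]_x (V x * (u x * phi x)) -
    c * L u.
  under eq_Rintegral do rewrite -[_ * u _ * phi _]mulrA mulrBl addrA.
  rewrite RintB; last 2 first.
  - exact: integrableRD.
  - exact: integrableRZ.
  by rewrite RintD// RintZ// /c mulrAC -mulrA [X in _ - X]mulrC.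
by rewrite -Lphi {1}/L /energy_diff subKr.
Qed.

(** A minimiser over the whole sphere is itself critical, so the infimum over critical points is the
    same number. *)
Lemma attained_ground_state (a : R) : 0 < a -> min_energy_attained g V a ->
  exists u0 lambda,
    [/\ mass_sphere a u0, ground_state g V a u0 & weak_solution g V lambda u0].
Proof.
move=> a0 [u mu Eu].
have minu v : mass_sphere a v -> energy g V u <= energy g V v.
  move=> mv; have Ev : (min_energy g V a <= (energy g V v)%:E)%E.
    exact: (ereal_inf_lbound (ex_intro2 _ _ v mv erefl)).
  by move: Ev; rewrite -Eu lee_fin.
have [crit [lambda wu]] := minimizer_weak_solution a0 mu minu.
exists u, lambda; split=> //; split=> //; apply/eqP; rewrite eq_le; apply/andP; split.
  by apply: le_ereal_inf_tmp => _ [v [mv _] <-]; rewrite lee_fin minu.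
exact: (ereal_inf_lbound (ex_intro2 _ _ u crit erefl)).
Qed.

End lagrange_multiplier.

Theorem theorem3 (R : realType) (N : nat) (g : R -> R) (V : 'rV[R]_N -> R)
    (a0 : R) :
  (1 <= N)%N ->
  continuous g ->
  (forall s, g (- s) = - g s) ->
  g 0 = 0 ->
  g s / s @[s --> 0^'] --> (0 : R) ->
  g s / `|s| `^ (1 + 4 / N%:R) @[s --> +oo] --> (0 : R) ->
  (exists2 s1, 0 < s1 & 0 < primitive g s1) ->
  (exists2 alpha, 2 < alpha &
    forall s, 0 <= s -> alpha * primitive g s <= g s * s) ->
  continuously_differentiable V ->
  (exists x, V x != 0) ->
  V x @[x --> at_infty] --> (0 : R) ->
  ereal_sup [set (V x)%:E | x in setT] = 0%E ->
  (forall x, V 0 <= V x) ->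
  dot (gradient V x) x @[x --> at_infty] --> (0 : R) ->
  0 <= a0 ->
  (forall a, a0 < a -> (min_energy g V a < 0)%E /\ min_energy_attained g V a) ->
  (forall a, 0 < a -> a < a0 ->
    min_energy g V a = 0%E /\ ~ min_energy_attained g V a) ->
  (limf_einf (fun t : R => (primitive g t / t `^ (2 + 4 / N%:R))%:E) 0^'+ =
     +oo%E \/
   (exists2 s0, 0 < s0 & forall s, 0 <= s <= s0 -> 0 <= g s) /\
   ((3 <= N)%N -> (spectral_bottom V < 0)%E)) ->
  a0 = 0 /\
  forall a, 0 < a -> exists u0 lambda,
    [/\ mass_sphere a u0, ground_state g V a u0 & weak_solution g V lambda u0].
Proof.
move=> N0 cg og g0 gl0 gloo _ _ dV [x1 Vx1] _ supV minV _ a00 att natt alt.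
have V0 x : V x <= 0.
  suff : ((V x)%:E <= 0)%E by rewrite lee_fin.
  by rewrite -supV; apply: ereal_sup_ubound; exists x.
have VB x : `|V x| <= - V 0 by rewrite ler0_norm// lerN2.
have cV := continuously_differentiable_continuous dV.
have mV := continuous_rV_measurable cV.
(* A nonzero value of [V] is negative, and the minimum lies below it. *)
have V00 : V 0 < 0 by rewrite (le_lt_trans (minV x1))// lt_neqAle Vx1 V0.
have small b : 0 < b -> exists u,
    [/\ H1 u, 0 < \int[@lebesgue_rV R N]_x (u x ^+ 2) < b & energy g V u < 0].
  move=> b0; case: alt => [Goo|[_ spec]].
    exact: (negative_energy_superquadratic N0 cg og g0 gl0 gloo mV VB V0).
  have [phi [Hphi M0 Q0]] : exists phi, [/\ H1 phi,
      0 < \int[@lebesgue_rV R N]_x (phi x ^+ 2) &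
      \int[@lebesgue_rV R N]_x dot (wgrad phi x) (wgrad phi x) +
      \int[@lebesgue_rV R N]_x (V x * phi x ^+ 2) < 0].
    have [N2|N3] := leqP N 2; first exact: (low_dimension_negative mV VB V0 N2 cV V00).
    have [_ [phi [Hphi phi1] <-]] := ereal_inf_lt (spec N3).
    rewrite lte_fin RintD => [Q0||].
    - by exists phi; rewrite phi1 ltr01.
    - exact: integrable_dot_wgrad.
    - exact: (integrable_Vmul mV VB Hphi Hphi).
  exact: (negative_energy_quadratic N0 mV VB cg og g0 gl0 gloo Hphi M0 Q0 b0).
have a0E : a0 = 0.
  apply/eqP; rewrite eq_le a00 andbT leNgt; apply/negP => a0gt.
  have [u [Hu /andP[m0 ma] Eu]] := small _ a0gt.
  (* The hypothesis on [a0] is applied at the mass of [u] itself, where the infimum of the energy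
     would be zero. *)
  have [E0 _] := natt _ m0 ma.
  have : (min_energy g V (\int[@lebesgue_rV R N]_x (u x ^+ 2)) <= (energy g V u)%:E)%E.
    exact: (ereal_inf_lbound (ex_intro2 _ _ u (conj Hu erefl) erefl)).
  by rewrite E0 lee_fin leNgt Eu.
split=> // a a_gt0.
apply: (attained_ground_state N0 cg og g0 gl0 gloo mV VB a_gt0).
by have [] := att a; rewrite ?a0E.
Qed.
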